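(* Let $\mu\in\mathcal M_+$ be such that $\mu((0,a])>0$, $\mu(\{b\})>0$ and $\mu([0,a])+\mu(\{b\})=1$, where $0<a<b$, and $\lim_{x\uparrow 1/a}\psi_\mu(x)\ge-1$. Then $\mu$ is an indecomposable probability measure in $(\mathcal M_+,\boxtimes)$.
   Context: $\mathbb C^+$ is the open upper half-plane, $\mathbb R_+=[0,\infty)$. $\mathcal M_+$ is the set of Borel probability measures on $\mathbb R_+$ with $\mu(\{0\})<1$. $\psi_\mu(z)=\int_{\mathbb R_+}\frac{z\xi}{1-z\xi}\mu(d\xi)$ for $z\in\mathbb C\setminus\mathbb R_+$ (and, for $\mu$ as in the claim, by the same integral for real $z=x\in(1/b,1/a)$), and $K_\mu=\psi_\mu/(1+\psi_\mu)$ on $\mathbb C\setminus\mathbb R_+$. $\mathcal K$ is the class of analytic $f:\mathbb C^+\to\mathbb C^+\cup\mathbb R$ that are analytic and nonpositive on $(-\infty,0)$ with $f(-x)\to0$ as $x\downarrow0$. Given $\mu_1,\mu_2\in\mathcal M_+$ there are unique $Z_1,Z_2\in\mathcal K$ (not identically zero) with $Z_1(z)Z_2(z)=zK_{\mu_1}(Z_1(z))$ and $K_{\mu_1}(Z_1(z))=K_{\mu_2}(Z_2(z))$ on $\mathbb C^+$; the free multiplicative convolution $\mu_1\boxtimes\mu_2$ is the measure in $\mathcal M_+$ with $K_{\mu_1\boxtimes\mu_2}(z)=K_{\mu_1}(Z_1(z))$. $\mu_1\in\mathcal M_+$ is a factor of $\mu$ if $\mu=\mu_1\boxtimes\mu_2$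 for some $\mu_2\in\mathcal M_+$; the improper factors of $\mu$ are $\delta_c$ and $\mu\boxtimes\delta_c$, $c>0$ ($\delta_c$ the Dirac measure at $c$). $\mu$ is indecomposable if it is not a Dirac measure and has improper factors only. *)

(* Defs.v *)
From HB Require Import structures.
From mathcomp Require Import all_boot all_order all_algebra.
From mathcomp Require Import all_classical all_reals all_analysis.
From mathcomp Require Import complex.
Set Implicit Arguments.
Unset Strict Implicit.
Unset Printing Implicit Defensive.
Import Order.TTheory GRing.Theory Num.Theory.
Import numFieldNormedType.Exports.
Local Open Scope classical_set_scope.
Local Open Scope ring_scope.
Local Open Scope complex_scope.

(* The topology and norm of R[i] as a numFieldType; the library declares them for
   R[i]^o only. *)
HB.instance Definition _ (R : realType) := NormedModule.copy R[i] R[i]^o.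

(* Borel measures on [0, +oo[ are represented by Borel measures on R
   concentrated on [0, +oo[. *)
Definition Mplus (R : realType) (mu : probability (measurableTypeR R) R) :=
  mu `[0, +oo[%classic = 1%E /\ (mu [set 0%R] < 1)%E.

(* A measure is a function on all sets, but only its values on measurable sets
   are meaningful, so Leibniz equality would be too strong. *)
Definition eq_measure (R : realType)
    (mu nu : probability (measurableTypeR R) R) :=
  forall A : set (measurableTypeR R), measurable A -> mu A = nu A.

Definition Dirac (R : realType) (c : R) :
    probability (measurableTypeR R) R :=
  @dirac _ (measurableTypeR R) c R.

Definition Cintegral (R : realType) (mu : probability (measurableTypeR R) R)
    (D : set (measurableTypeR R)) (f : R -> R[i]) : R[i] :=
  (\int[mu]_(x in D) complex.Re (f x)) +i* (\int[mu]_(x in D) complex.Im (f x)).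

(* Meaningful for z outside [0, +oo[, and for those real z > 0 where the
   integrand is integrable. *)
Definition psi (R : realType) (mu : probability (measurableTypeR R) R)
    (z : R[i]) : R[i] :=
  Cintegral mu `[0, +oo[%classic
    (fun xi : R => (z * xi%:C) / (1 - z * xi%:C)).

Definition Kfun (R : realType) (mu : probability (measurableTypeR R) R)
    (z : R[i]) : R[i] := psi mu z / (1 + psi mu z).

Definition upper_half (R : realType) : set R[i] := [set z | 0 < complex.Im z].

Definition analytic_at (R : realType) (f : R[i] -> R[i]) (z : R[i]) :=
  exists c : nat -> R[i],
    \forall w \near z, [series c n * (w - z) ^+ n]_n @ \oo --> f w.

(* Functions are total, so a function on upper_half that is analytic on
   ]-oo, 0[ is one that, with suitable values on ]-oo, 0[ and just below it,
   has local power series there as well.  Values elsewhere are irrelevant.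
   The order of R[i] compares only numbers with equal imaginary parts, so
   f x <= 0 says that f x is real and nonpositive. *)
Definition classK (R : realType) (f : R[i] -> R[i]) :=
  [/\ forall z, upper_half z -> analytic_at f z /\ 0 <= complex.Im (f z),
      forall x : R, x < 0 -> analytic_at f x%:C /\ f x%:C <= 0
    & f (- x)%:C @[x --> (0 : R)^'+] --> (0 : R[i])].

(* The graph of free multiplicative convolution: mu is the convolution of mu1
   and mu2.  The measure mu is determined, up to eq_measure, by mu1 and mu2. *)
Definition free_mconv (R : realType)
    (mu1 mu2 mu : probability (measurableTypeR R) R) :=
  [/\ Mplus mu1, Mplus mu2, Mplus mu &
    exists Z1 Z2 : R[i] -> R[i],
      [/\ classK Z1 /\ (exists2 z, upper_half z & Z1 z != 0),
          classK Z2 /\ (exists2 z, upper_half z & Z2 z != 0) &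
          forall z, upper_half z ->
            [/\ Z1 z * Z2 z = z * Kfun mu1 (Z1 z),
                Kfun mu1 (Z1 z) = Kfun mu2 (Z2 z) &
                Kfun mu z = Kfun mu1 (Z1 z)]]].

Definition factor (R : realType)
    (mu1 mu : probability (measurableTypeR R) R) :=
  Mplus mu1 /\ exists2 mu2, Mplus mu2 & free_mconv mu1 mu2 mu.

Definition improper (R : realType)
    (mu1 mu : probability (measurableTypeR R) R) :=
  exists2 c : R, 0 < c &
    eq_measure mu1 (Dirac c) \/ free_mconv mu (Dirac c) mu1.

Definition indecomposable (R : realType)
    (mu : probability (measurableTypeR R) R) :=
  (forall c : R, ~ eq_measure mu (Dirac c)) /\
  (forall mu1, factor mu1 mu -> improper mu1 mu).

(* Main.v *)
Require Import Defs.
From mathcomp Require Import all_boot all_order all_algebra.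
From mathcomp Require Import all_classical all_reals all_analysis.
From mathcomp Require Import measurable_realfun complex.
From mathcomp Require Import ring lra.
Import Order.TTheory GRing.Theory Num.Theory.
Import numFieldNormedType.Exports.
Set Implicit Arguments.
Unset Strict Implicit.
Unset Printing Implicit Defensive.
Local Open Scope classical_set_scope.
Local Open Scope ring_scope.
Local Open Scope complex_scope.

Local Notation normc := Normc.normc.
Local Notation normcM := Normc.normcM.
Local Notation normcV := Normc.normcV.

#[local] Arguments psi : simpl never.
#[local] Arguments Kfun : simpl never.

(** Suppose that mu is the free convolution of mu1 and mu2, with subordination
functions Z1 and Z2. Write K for the transform of mu, D x for
[(1 - b x) (1 + psi x)] and x0 for the first zero of D on ]0, 1/a], read as a
limit when x0 = 1/a. Since mu has no mass between a and its top atom b, K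
extends to a positive function on ]0, x0[, equal to [1 - (1 - b x) / D x].
The condition on psi at 1/a says that D does come down to 0, so that K is
unbounded near x0.

On the upper half-plane Z1, Z2 and K take their values in the upper half-plane,
and [Z1 Z2 = z K]. Near ]0, x0[ the argument of z K is O(Im z); as the arguments
of Z1 and Z2 are positive and add up to it, both are O(Im z) too
([angle_le], [Im_le_near_real]). The Schwarz-Pick inequality turns the bound
[Im Zj <= C |Zj| Im z] into a Lipschitz bound for Zj up to the real axis
([schwarz_pick_lipschitz]), so that Z1 and Z2 have continuous positive boundary
values on ]0, x0[ ([regular_boundaryP]). Schwarz-Pick itself is derived from a
maximum principle, for which second-order Taylor expansions suffice
([jet2_not_local_max], [max_modulus]).

Let s be a boundary value of Z1 strictly between two others that are taken on
the same side of 1/b. By the intermediate value theorem on horizontal lines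
close to the axis, Z1 takes there values s + i eta with eta small and
Im psi_mu1 (s + i eta) = O(Im z), and this bounds the mass of mu1 near 1/s by a
small multiple of the length of the interval ([sweep_small_mass]). A supremum argument
([null_closed_interval]) then shows that mu1 has no mass on 1/s for s in the
range of the boundary values of Z1, except for the single point corresponding
to x = 1/b, where psi has its pole ([small_mass_in_range]).

The boundary values satisfy Z1 Z2 = x K x, which is unbounded, so one of them,
say Z1, is unbounded. They also approach 0: otherwise Z2 tends to 0 at 0+,
mu2 has bounded support, K_mu2 (w) = O(w), and
Z1 = z K_mu2 (Z2) / Z2 = O(z) ([boundary_fun_inf0]). Hence mu1 is carried by 0 and one
point u > 0. If mu1 had mass p > 0 at 0, its transform
(1 - p) u w / (1 - p u w) would be negative for large w, while
K_mu1 (Z1) = K is positive ([dirac_of_unbounded]). So mu1 or mu2 is a Dirac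
measure ([factor_dirac]); in the second case mu1 is the convolution of mu with
a Dirac measure ([dirac_cofactor_improper]). *)

(** * The modulus of a complex number *)

Lemma normc_ge0 (R : realType) (z : R[i]) : 0 <= normc z.
Proof. by case: z => x y; exact: sqrtr_ge0. Qed.

Lemma normc_sqr (R : realType) (z : R[i]) :
  normc z ^+ 2 = complex.Re z ^+ 2 + complex.Im z ^+ 2.
Proof. by case: z => x y /=; rewrite sqr_sqrtr ?addr_ge0 ?sqr_ge0. Qed.

Lemma normcE (R : realType) (z : R[i]) : `|z| = (normc z)%:C.
Proof. by case: z. Qed.

Lemma normc_Re (R : realType) (z : R[i]) : `|complex.Re z| <= normc z.
Proof.
by rewrite -(@ler_pXn2r _ 2) ?nnegrE ?normc_ge0// normc_sqr real_normK ?num_real// lerDl sqr_ge0.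
Qed.

Lemma normc_Im (R : realType) (z : R[i]) : `|complex.Im z| <= normc z.
Proof.
by rewrite -(@ler_pXn2r _ 2) ?nnegrE ?normc_ge0// normc_sqr real_normK ?num_real// lerDr sqr_ge0.
Qed.

Lemma normcX (R : realType) (z : R[i]) n : normc (z ^+ n) = normc z ^+ n.
Proof.
elim: n => [|n IH]; first by rewrite !expr0 Normc.normc1.
by rewrite !exprS normcM IH.
Qed.

Lemma normcB (R : realType) (x y : R[i]) : normc (x - y) = normc (y - x).
Proof. by rewrite -normcN opprB. Qed.

Lemma le_normcB (R : realType) (x y : R[i]) : normc x - normc y <= normc (x - y).
Proof. by rewrite lerBlDr -{1}(subrK y x) le_normcD. Qed.

Lemma normc_real (R : realType) (x : R) : normc x%:C = `|x|.
Proof. by rewrite /= expr0n/= addr0 sqrtr_sqr. Qed.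

Lemma normc_ReIm (R : realType) (z : R[i]) :
  normc z <= `|complex.Re z| + `|complex.Im z|.
Proof.
rewrite -(@ler_pXn2r _ 2) ?nnegrE ?normc_ge0 ?addr_ge0// normc_sqr sqrrD.
rewrite !real_normK ?num_real//.
have : 0 <= `|complex.Re z| * `|complex.Im z| by rewrite mulr_ge0.
lra.
Qed.

Lemma normc_eq0 (R : realType) (z : R[i]) : (normc z == 0) = (z == 0).
Proof.
apply/eqP/eqP => [/Normc.eq0_normc//|->]; exact: Normc.normc0.
Qed.

Lemma normc_gt0 (R : realType) (z : R[i]) : (0 < normc z) = (z != 0).
Proof. by rewrite lt_def normc_ge0 andbT normc_eq0. Qed.

(** The balls of R[i] have radii in R[i]; this passes to real radii, on which
all later estimates rely. *)
Lemma nearP_normc (R : realType) (P : set R[i]) (z : R[i]) :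
  (\forall w \near z, P w) <->
  exists2 d : R, 0 < d & forall v, normc v < d -> P (z + v).
Proof.
split=> [/nbhs_ballP[e /= e0 He]|[d d0 H]].
  have [e1 e2] : complex.Im e = 0 /\ 0 < complex.Re e.
    by move: e0; rewrite ltcE /= => /andP[/eqP ? ?].
  exists (complex.Re e) => // v vd; apply: He; rewrite -ball_normE /=.
  rewrite opprD addrA subrr sub0r normrN normcE.
  have -> : e = (complex.Re e)%:C by case: (e) e1 => ? ? /= ->.
  by rewrite ltcR.
apply/nbhs_ballP; exists d%:C; first by rewrite /= ltcR.
move=> w; rewrite -ball_normE /= normcE ltcR => wz.
by rewrite -(subrKC z w); apply: H; rewrite normcB.
Qed.

Lemma cvg_seq_normc (R : realType) (u : nat -> R[i]) (l : R[i]) :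
  u @ \oo --> l ->
  forall e : R, 0 < e -> exists N, forall n, (N <= n)%N -> normc (l - u n) < e.
Proof.
move=> /cvgrPdist_lt H e e0.
have /H [N _ HN] : (0 : R[i]) < e%:C by rewrite ltcR.
exists N => n Nn; have := HN n Nn; by rewrite /= normcE ltcR.
Qed.

(** * Taylor expansions of functions given by power series *)

Lemma geo_half_le2 (R : realType) (t : R) n :
  0 <= t -> t <= 2^-1 -> \sum_(k < n) t ^+ k <= 2.
Proof.
move=> t0 t2; suff : \sum_(k < n) t ^+ k <= 2 - 2 * t ^+ n.
  have : 0 <= t ^+ n by rewrite exprn_ge0.
  lra.
elim: n => [|n IH]; first by rewrite big_ord0 expr0; lra.
rewrite big_ord_recr /= exprS.
have : 0 <= t ^+ n by rewrite exprn_ge0.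
nra.
Qed.

Lemma power_series_bounded (R : realType) (u : nat -> R[i]) (l : R[i]) :
  [series u n]_n @ \oo --> l -> exists M, forall n, normc (u n) <= M.
Proof.
move=> /cvg_seq_normc /(_ 1 ltr01) [N HN].
exists (2 + \sum_(k < N) normc (u k)) => n.
have [nN|Nn] := ltnP n N.
  rewrite (bigD1 (Ordinal nN)) //= addrCA lerDl addr_ge0//.
  by rewrite sumr_ge0 // => i _; exact: normc_ge0.
have -> : u n = (l - [series u n]_n n) - (l - [series u n]_n n.+1).
  by rewrite /series /= big_nat_recr //=; ring.
have h1 := HN n Nn; have h2 := HN n.+1 (leqW Nn).
have h3 := le_normcD (l - [series u n]_n n) (- (l - [series u n]_n n.+1)).
rewrite normcN in h3.
have h4 : 0 <= \sum_(k < N) normc (u k).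
  by rewrite sumr_ge0 // => i _; exact: normc_ge0.
lra.
Qed.

Lemma normc_sum (R : realType) n (F : nat -> R[i]) :
  normc (\sum_(k < n) F k) <= \sum_(k < n) normc (F k).
Proof.
elim: n => [|n IH]; first by rewrite !big_ord0 Normc.normc0.
by rewrite !big_ord_recr /= (le_trans (le_normcD _ _))// lerD2r.
Qed.

(** The terms of a convergent power series are bounded at some point of radius
d/2, so on the disc of radius d/4 the tail is dominated by a geometric series
of ratio 1/2. *)
Lemma analytic_jet3 (R : realType) (f : R[i] -> R[i]) (z : R[i]) :
  analytic_at f z ->
  exists c1 c2 c3 : R[i], exists2 d : R, 0 < d & exists M : R,
    forall v, normc v < d -> exists2 r, normc r <= M &
      f (z + v) = f z + c1 * v + c2 * v ^+ 2 + c3 * v ^+ 3 + r * v ^+ 4.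
Proof.
move=> [c /nearP_normc [d d0 H]].
have {}H v : normc v < d -> [series c n * v ^+ n]_n @ \oo --> f (z + v).
  by move=> /H; rewrite addrC addKr.
have d20 : 0 < d / 2 by rewrite divr_gt0.
have /H/power_series_bounded[M0 HM0] : normc (d / 2)%:C < d.
  by rewrite normc_real gtr0_norm //; lra.
have {}HM0 n : normc (c n) <= M0 * (2 / d) ^+ n.
  have := HM0 n; rewrite normcM normcX normc_real gtr0_norm //.
  move=> h; rewrite -(@ler_pM2r _ ((d/2) ^+ n)) ?exprn_gt0//.
  rewrite -mulrA -exprMn.
  have -> : 2 / d * (d / 2) = 1 by field; rewrite gt_eqF.
  by rewrite expr1n mulr1.
have M00 : 0 <= M0.
  by have := HM0 0%N; rewrite expr0 mulr1; apply: le_trans; exact: normc_ge0.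
pose M := 2 * (M0 * (2 / d) ^+ 4).
have key v : normc v < d / 4 ->
    normc (f (z + v) - (c 0%N + c 1%N * v + c 2%N * v ^+ 2 + c 3%N * v ^+ 3))
      <= M * normc v ^+ 4.
  move=> vd; apply/ler_addgt0Pr => e e0.
  have /H/cvg_seq_normc/(_ _ e0)[N HN] : normc v < d by apply: lt_trans vd _; lra.
  have := HN (4 + N)%N (leq_addl _ _).
  rewrite /series /= big_mkord big_split_ord /=.
  rewrite !big_ord_recl big_ord0 /= /bump /= ?add0n ?add1n.
  set T := \sum_(i < N) _; set F := f _ => hF.
  rewrite (_ : F - _ = (F - (c 0%N * v ^+ 0 + (c 1%N * v ^+ 1 + (c 2%N * v ^+ 2 +
    (c 3%N * v ^+ 3 + 0))) + T)) + T); last first.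
    by rewrite expr0 expr1; ring.
  rewrite (le_trans (le_normcD _ _))// addrC lerD//; last exact: ltW.
  have -> : T = v ^+ 4 * \sum_(i < N) c (4 + i)%N * v ^+ i.
    by rewrite /T big_distrr /=; apply: eq_bigr => i _; rewrite exprD mulrCA.
  rewrite normcM normcX mulrC ler_wpM2r ?exprn_ge0 ?normc_ge0//.
  rewrite (le_trans (normc_sum _ (fun i => c (4 + i)%N * v ^+ i)))//.
  apply: (@le_trans _ _ (\sum_(k < N) M0 * (2 / d) ^+ 4 * (2 / d * normc v) ^+ k)).
    apply: ler_sum => i _; rewrite normcM normcX [X in _ <= _ * X]exprMn mulrA.
    rewrite ler_wpM2r ?exprn_ge0 ?normc_ge0//.
    by rewrite -mulrA -exprD.
  rewrite -big_distrr /= /M mulrC ler_wpM2r ?(mulr_ge0, exprn_ge0, invr_ge0, ltW d0)//.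
  apply: geo_half_le2; first by rewrite ?(mulr_ge0, normc_ge0, invr_ge0, ltW d0).
  rewrite mulrAC ler_pdivrMr//; lra.
have fz : f z = c 0%N.
  have /key : normc (0 : R[i]) < d / 4 by rewrite Normc.normc0; lra.
  rewrite Normc.normc0 expr0n /= mulr0 !expr0n /= !mulr0 !addr0 => h.
  apply/eqP; rewrite -subr_eq0 -normc_eq0 eq_le h; exact: normc_ge0.
exists (c 1%N), (c 2%N), (c 3%N), (d / 4); first lra.
exists M => v vd.
have [->|v0] := eqVneq v 0.
  exists 0; first by rewrite Normc.normc0 ?(mulr_ge0, exprn_ge0, invr_ge0, ltW d0).
  by rewrite addr0 !expr0n /= !mulr0 !addr0.
exists ((f (z + v) - (c 0%N + c 1%N * v + c 2%N * v ^+ 2 + c 3%N * v ^+ 3)) / v ^+ 4).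
  rewrite normcM normcV normcX ler_pdivrMr ?exprn_gt0 ?normc_gt0//; exact: key.
by rewrite fz divfK ?expf_neq0//; ring.
Qed.

(** A second-order expansion with bounded remainder. Unlike convergence of the
power series, this is easily seen to be stable under products and inverses, and
it is all that the maximum principle needs. *)
Definition jet2 (R : realType) (f : R[i] -> R[i]) (z : R[i]) :=
  exists c1 c2 : R[i], exists2 d : R, 0 < d & exists M : R,
    forall v, normc v < d -> exists2 r, normc r <= M &
      f (z + v) = f z + c1 * v + c2 * v ^+ 2 + r * v ^+ 3.

Lemma normc_leD (R : realType) (x y : R[i]) (A B : R) :
  normc x <= A -> normc y <= B -> normc (x + y) <= A + B.
Proof. by move=> xA yB; rewrite (le_trans (le_normcD _ _))// lerD. Qed.

Lemma normc_leM (R : realType) (x y : R[i]) (A B : R) :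
  normc x <= A -> normc y <= B -> normc (x * y) <= A * B.
Proof. by move=> xA yB; rewrite normcM ler_pM// normc_ge0. Qed.

Lemma normc_leN (R : realType) (x : R[i]) (A : R) : normc x <= A -> normc (- x) <= A.
Proof. by rewrite normcN. Qed.

Lemma analytic_jet2 (R : realType) (f : R[i] -> R[i]) (z : R[i]) :
  analytic_at f z -> jet2 f z.
Proof.
move=> /analytic_jet3 [c1 [c2 [c3 [d d0 [M H]]]]].
exists c1, c2, (Num.min d 1); first by rewrite lt_min d0 ltr01.
eexists => v; rewrite lt_min => /andP[/H[r rM ->] /ltW v1].
exists (c3 + r * v); last by ring.
by apply: normc_leD; [exact: lexx|apply: normc_leM; [exact: rM|exact: v1]].
Qed.

Lemma jet2_continuous (R : realType) (f : R[i] -> R[i]) (z : R[i]) :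
  jet2 f z -> forall e : R, 0 < e ->
  exists2 d : R, 0 < d & forall v, normc v < d -> normc (f (z + v) - f z) < e.
Proof.
move=> [c1 [c2 [d d0 [M H]]]] e e0.
pose B := normc c1 + normc c2 + `|M| + 1.
have B0 : 0 < B by rewrite /B ltr_wpDl// ?addr_ge0 ?normc_ge0.
exists (Num.min (Num.min d 1) (e / B)).
  by rewrite !lt_min d0 ltr01 divr_gt0.
move=> v; rewrite !lt_min => /andP[/andP[/H[r rM ->] /ltW v1] ve].
rewrite (_ : _ - _ = (c1 + c2 * v + r * v ^+ 2) * v); last by ring.
rewrite normcM.
have hb : normc (c1 + c2 * v + r * v ^+ 2) <= B.
  have v2 : normc (v ^+ 2) <= 1 by rewrite normcX expr_le1// normc_ge0.
  have h := normc_leD (normc_leD (lexx (normc c1))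
    (normc_leM (lexx (normc c2)) v1)) (normc_leM rM v2).
  rewrite (le_trans h)// /B !mulr1.
  have := ler_norm M; lra.
rewrite (@le_lt_trans _ _ (B * normc v))// ?ler_wpM2r ?normc_ge0//.
by rewrite mulrC -ltr_pdivlMr.
Qed.

Lemma jet2_local (R : realType) (f g : R[i] -> R[i]) (z : R[i]) (d : R) :
  0 < d -> (forall v, normc v < d -> f (z + v) = g (z + v)) ->
  jet2 f z -> jet2 g z.
Proof.
move=> d0 fg [c1 [c2 [e e0 [M H]]]].
exists c1, c2, (Num.min d e); first by rewrite lt_min d0 e0.
exists M => v; rewrite lt_min => /andP[vd /H[r rM E]].
exists r => //; rewrite -fg// E; congr (_ + _ + _ + _).
by have := fg 0; rewrite addr0; apply; rewrite Normc.normc0.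
Qed.

Lemma jet2_affine (R : realType) (c k z : R[i]) : jet2 (fun w => k * w + c) z.
Proof.
exists k, 0, 1; first exact: ltr01.
exists 0 => v _; exists 0; first by rewrite Normc.normc0.
by ring.
Qed.

Lemma jet2_add_cst (R : realType) (f : R[i] -> R[i]) (c z : R[i]) :
  jet2 f z -> jet2 (fun w => f w + c) z.
Proof.
move=> [c1 [c2 [e e0 [M H]]]]; exists c1, c2, e => //.
exists M => v /H[r rM ->]; exists r => //; ring.
Qed.

Lemma jet2_mul (R : realType) (f g : R[i] -> R[i]) (z : R[i]) :
  jet2 f z -> jet2 g z -> jet2 (fun w => f w * g w) z.
Proof.
move=> [a1 [a2 [d d0 [M H]]]] [b1 [b2 [e e0 [N K]]]].
exists (f z * b1 + a1 * g z), (f z * b2 + a1 * b1 + a2 * g z).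
exists (Num.min (Num.min d 1) e); first by rewrite !lt_min d0 e0 ltr01.
eexists => v; rewrite !lt_min => /andP[/andP[/H[r rM ->] /ltW v1] /K[s sN ->]].
have v2 : normc (v ^+ 2) <= 1 by rewrite normcX expr_le1// normc_ge0.
have v3 : normc (v ^+ 3) <= 1 by rewrite normcX expr_le1// normc_ge0.
exists (r * (g z + b1 * v + b2 * v ^+ 2 + s * v ^+ 3)
   + (f z + a1 * v + a2 * v ^+ 2) * s + (a1 * b2 + a2 * b1) + a2 * b2 * v);
  last by ring.
apply: normc_leD; [apply: normc_leD; [apply: normc_leD|exact: lexx] |].
- apply: normc_leM; first exact: rM.
  apply: normc_leD; [apply: normc_leD; [apply: normc_leD; [exact: lexx|]|]|].
  + by apply: normc_leM; [exact: lexx|exact: v1].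
  + by apply: normc_leM; [exact: lexx|exact: v2].
  + by apply: normc_leM; [exact: sN|exact: v3].
- apply: normc_leM; last exact: sN.
  apply: normc_leD; [apply: normc_leD; [exact: lexx|]|].
  + by apply: normc_leM; [exact: lexx|exact: v1].
  + by apply: normc_leM; [exact: lexx|exact: v2].
- by apply: normc_leM; [exact: lexx|exact: v1].
Qed.

Lemma jet2_inv (R : realType) (f : R[i] -> R[i]) (z : R[i]) :
  f z != 0 -> jet2 f z -> jet2 (fun w => (f w)^-1) z.
Proof.
move=> fz0 jf; have n0 : 0 < normc (f z) / 2 by rewrite divr_gt0 ?normc_gt0.
have [e e0 K] := jet2_continuous jf n0.
move: jf => [a1 [a2 [d d0 [M H]]]].
pose b1 := - a1 / f z ^+ 2; pose b2 := a1 ^+ 2 / f z ^+ 3 - a2 / f z ^+ 2.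
exists b1, b2.
exists (Num.min (Num.min d 1) e); first by rewrite !lt_min d0 e0 ltr01.
eexists => v; rewrite !lt_min => /andP[/andP[/H[r rM E] /ltW v1] /K ve].
have v2 : normc (v ^+ 2) <= 1 by rewrite normcX expr_le1// normc_ge0.
have F2 : normc (f z) / 2 <= normc (f (z + v)).
  by have := le_normcB (f z) (f (z + v)); rewrite normcB; lra.
have F0 : f (z + v) != 0 by rewrite -normc_gt0; lra.
exists (- ((r * ((f z)^-1 + b1 * v + b2 * v ^+ 2) + (a1 * b2 + a2 * b1)
            + a2 * b2 * v) * (f (z + v))^-1)).
  apply: normc_leN; apply: normc_leM.
    apply: normc_leD; [apply: normc_leD; [|exact: lexx] |].
    - apply: normc_leM; first exact: rM.
      apply: normc_leD; [apply: normc_leD; [exact: lexx|]|].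
      + by apply: normc_leM; [exact: lexx|exact: v1].
      + by apply: normc_leM; [exact: lexx|exact: v2].
    - by apply: normc_leM; [exact: lexx|exact: v1].
  rewrite normcV; apply: (_ : _ <= (normc (f z) / 2)^-1).
  by rewrite lef_pV2 ?posrE// (lt_le_trans n0).
rewrite E in F0 *; rewrite /b1 /b2; field; by rewrite F0 fz0.
Qed.

(** * The maximum modulus principle *)

Lemma sqr_perturb (R : realType) (h p P dl : R) :
  0 <= h -> 0 <= p -> 0 <= dl -> p <= h + dl -> p <= P -> p ^+ 2 - 2 * P * dl <= h ^+ 2.
Proof.
move=> h0 p0 d0 ph pP.
have Pd : 0 <= (P - p) * dl by rewrite mulr_ge0// subr_ge0.
have [hp|hp] := leP p h; first by have : 0 <= p * dl := mulr_ge0 p0 d0; nra.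
nra.
Qed.

(** Averaging over v = t, -t, it, -it removes all cross terms between 1, v and
v^2, so |p|^2 has a mean at least its value at the centre, and the mean of
|z + v|^2 exceeds |z|^2 by t^2. *)
Lemma four_point_mean (R : realType) (c0 c1 c2 z : R[i]) (t e : R) :
  let F v := normc (c0 + c1 * v + c2 * v ^+ 2) ^+ 2 + e * normc (z + v) ^+ 2 in
  F (t +i* 0) + F (- t +i* 0) + F (0 +i* t) + F (0 +i* - t)
  = 4 * (normc c0 ^+ 2 + e * normc z ^+ 2
         + t ^+ 2 * (normc c1 ^+ 2 + t ^+ 2 * normc c2 ^+ 2 + e)).
Proof.
rewrite /= !normc_sqr; case: c0 c1 c2 z => [a0 b0] [a1 b1] [a2 b2] [x y].
by rewrite !expr2 /=; ring.
Qed.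

(** The four-point mean gains e t^2 over the centre while the remainder of the
expansion loses only O(t^3). *)
Lemma jet2_not_local_max (R : realType) (h : R[i] -> R[i]) (z : R[i]) (e d0 : R) :
  jet2 h z -> 0 < e -> 0 < d0 ->
  exists2 v, normc v < d0 &
    normc (h z) ^+ 2 + e * normc z ^+ 2
    < normc (h (z + v)) ^+ 2 + e * normc (z + v) ^+ 2.
Proof.
move=> [c1 [c2 [d dgt0 [M H]]]] e0 d00; apply: contrapT => nex.
have {}nex v : normc v < d0 ->
    normc (h (z + v)) ^+ 2 + e * normc (z + v) ^+ 2
    <= normc (h z) ^+ 2 + e * normc z ^+ 2.
  by move=> vd; rewrite leNgt; apply/negP => lt; apply: nex; exists v.
pose P := normc (h z) + normc c1 + normc c2 + 1.
(* M' is positive and bounds the remainder even when M is not positive *)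
pose M' := `|M| + 1.
have M'0 : 0 < M' by rewrite /M' ltr_wpDl.
have P0 : 0 < P by rewrite /P ltr_wpDl// ?addr_ge0 ?normc_ge0.
pose t := Num.min (Num.min (d / 2) (d0 / 2)) (Num.min 1 (e / (4 * P * M'))).
have PM : 0 < 4 * P * M' by rewrite !mulr_gt0.
have t0 : 0 < t by rewrite !lt_min ltr01 !divr_gt0.
have [td [td0 [t1 te]]] : t <= d / 2 /\ t <= d0 / 2 /\ t <= 1 /\ t <= e / (4 * P * M').
  by rewrite /t !ge_min !lexx ?orbT.
have key v : normc v = t ->
    normc (h z + c1 * v + c2 * v ^+ 2) ^+ 2 + e * normc (z + v) ^+ 2
    <= normc (h z) ^+ 2 + e * normc z ^+ 2 + 2 * P * (M' * t ^+ 3).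
  move=> vt.
  have [|r rM E] := H v; first by rewrite vt; lra.
  have : normc v < d0 by rewrite vt; lra.
  move=> /nex; rewrite E; set p := h z + _ + _ => hh.
  have pP : normc p <= P.
    have v1 : normc v <= 1 by rewrite vt.
    have v2 : normc (v ^+ 2) <= 1 by rewrite normcX vt expr_le1// ltW.
    have := normc_leD (normc_leD (lexx (normc (h z))) (normc_leM (lexx (normc c1)) v1))
              (normc_leM (lexx (normc c2)) v2).
    by rewrite !mulr1 -/p /P; lra.
  have pq : normc p <= normc (p + r * v ^+ 3) + M' * t ^+ 3.
    have := le_normcB p (- (r * v ^+ 3)); rewrite opprK normcN normcM normcX vt.
    have : normc r * t ^+ 3 <= M' * t ^+ 3.
      by rewrite ler_wpM2r ?exprn_ge0 ?ltW// /M'; have := ler_norm M; lra.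
    lra.
  have := sqr_perturb (normc_ge0 _) (normc_ge0 p) _ pq pP.
  have -> : 0 <= M' * t ^+ 3 by rewrite mulr_ge0 ?exprn_ge0 ?ltW.
  move=> /(_ isT); lra.
pose F v := normc (h z + c1 * v + c2 * v ^+ 2) ^+ 2 + e * normc (z + v) ^+ 2.
have S : F (t +i* 0) + F (- t +i* 0) + F (0 +i* t) + F (0 +i* - t)
  = 4 * (normc (h z) ^+ 2 + e * normc z ^+ 2
         + t ^+ 2 * (normc c1 ^+ 2 + t ^+ 2 * normc c2 ^+ 2 + e)).
  exact: four_point_mean.
have n1 : normc (t +i* 0) = t by rewrite normc_real gtr0_norm.
have n2 : normc (- t +i* 0) = t by rewrite normc_real normrN gtr0_norm.
have n3 : normc (0 +i* t) = t by rewrite /= expr0n/= add0r sqrtr_sqr gtr0_norm.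
have n4 : normc (0 +i* - t) = t
  by rewrite /= expr0n/= add0r sqrtr_sqr normrN gtr0_norm.
move: (key _ n1) (key _ n2) (key _ n3) (key _ n4).
rewrite -!/(F _) => k1 k2 k3 k4.
have : 0 <= t ^+ 2 * (normc c1 ^+ 2 + t ^+ 2 * normc c2 ^+ 2).
  apply: mulr_ge0; first exact: sqr_ge0.
  by apply: addr_ge0; [exact: sqr_ge0|apply: mulr_ge0; exact: sqr_ge0].
move=> q0.
have : e * t ^+ 2 <= 2 * P * (M' * t ^+ 3) by lra.
have -> : 2 * P * (M' * t ^+ 3) = (2 * P * M' * t) * t ^+ 2 by ring.
rewrite ler_pM2r ?exprn_gt0//.
move: te; rewrite ler_pdivlMr//; lra.
Qed.

Lemma continuous_normc_jet2 (R : realType) (g : R[i] -> R[i]) (p : R * R) :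
  jet2 g (p.1 +i* p.2) ->
  normc (g (q.1 +i* q.2)) ^+ 2 @[q --> p] --> normc (g (p.1 +i* p.2)) ^+ 2.
Proof.
move=> jg.
have cg : (fun q : R * R => normc (g (q.1 +i* q.2))) q @[q --> p]
    --> normc (g (p.1 +i* p.2)).
  apply/cvgrPdist_lt => e e0; have [d d0 H] := jet2_continuous jg e0.
  have d2 : 0 < d / 2 by rewrite divr_gt0.
  exists (ball p.1 (d / 2), ball p.2 (d / 2)).
    by split; exact: nbhsx_ballx.
  move=> [x y] [] /=; rewrite -!ball_normE /= => xd yd.
  pose v := (x - p.1) +i* (y - p.2).
  have -> : x +i* y = (p.1 +i* p.2) + v by rewrite /v; simpc; rewrite !subrKC.
  have vd : normc v < d.
    rewrite (le_lt_trans (normc_ReIm _))//= (distrC x) (distrC y); lra.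
  rewrite (le_lt_trans _ (H v vd))// ler_norml.
  rewrite lerNl opprB le_normcB /= normcB; exact: le_normcB.
exact: (cvgM cg cg).
Qed.

(** Perturbing |h|^2 by a small multiple of |z|^2 makes the maximum over the
compact K impossible at interior points, by [jet2_not_local_max]; the
perturbation then tends to 0. *)
Lemma max_modulus (R : realType) (K : set (R * R)) (h : R[i] -> R[i]) (B Rad : R) :
  compact K ->
  (forall p, K p -> jet2 h (p.1 +i* p.2)) ->
  (forall p, K p -> normc (p.1 +i* p.2) ^+ 2 <= Rad) ->
  (forall p, K p -> normc (h (p.1 +i* p.2)) ^+ 2 <= B \/
    exists2 d : R, 0 < d & forall v, normc v < d ->
      K (p.1 + complex.Re v, p.2 + complex.Im v)) ->
  forall p, K p -> normc (h (p.1 +i* p.2)) ^+ 2 <= B.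
Proof.
move=> cK jK rK bK p Kp; apply/ler_addgt0Pr => e e0.
have Rad0 : 0 <= Rad by apply: le_trans (rK _ Kp); exact: sqr_ge0.
pose e' := e / (Rad + 1).
have e'0 : 0 < e' by rewrite divr_gt0// ltr_wpDl.
have e'R : e' * Rad <= e.
  by rewrite /e' mulrAC ler_pdivrMr ?ltr_wpDl// ler_pM2l// lerDl.
pose U (q : R * R) := normc (h (q.1 +i* q.2)) ^+ 2 + e' * normc (q.1 +i* q.2) ^+ 2.
have cU : {within K, continuous U}.
  apply: continuous_in_subspaceT => q /set_mem Kq.
  apply: cvgD; first exact: continuous_normc_jet2 (jK _ Kq).
  apply: cvgMr.
  apply: (continuous_normc_jet2 (g := id)).
  by apply: (jet2_local ltr01 _ (jet2_affine 0 1 _)) => v _; rewrite mul1r addr0.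
have [//|m /set_mem Km mmax] := compact_EVT_max _ cK cU; first by exists p.
have {}mmax q : K q -> U q <= U m by move=> Kq; apply: mmax; exact/mem_set.
have [hB|[d d0 Kd]] := bK m Km.
  have := mmax _ Kp; rewrite /U.
  have : 0 <= e' * normc (p.1 +i* p.2) ^+ 2 by rewrite mulr_ge0 ?sqr_ge0// ltW.
  have : e' * normc (m.1 +i* m.2) ^+ 2 <= e' * Rad by rewrite ler_pM2l// rK.
  lra.
have [v vd lt] := jet2_not_local_max (jK _ Km) e'0 d0.
have := mmax _ (Kd v vd); rewrite /U /= leNgt.
by move: lt; case: (v) => a b; simpc => ->.
Qed.

(** * The Schwarz-Pick inequality *)

Lemma normc_subJ (R : realType) (w z : R[i]) :
  normc (w - z^*) ^+ 2 = normc (w - z) ^+ 2 + 4 * (complex.Im w * complex.Im z).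
Proof. by rewrite !normc_sqr; case: w z => [p q] [a c] /=; ring. Qed.

(** At the removable point z the expansion of the quotient comes from the
third-order expansion of f. *)
Lemma jet2_diff_quotient (R : realType) (f : R[i] -> R[i]) (z c1 : R[i]) :
  (exists c2 c3 : R[i], exists2 d : R, 0 < d & exists M : R,
    forall v, normc v < d -> exists2 r, normc r <= M &
      f (z + v) = f z + c1 * v + c2 * v ^+ 2 + c3 * v ^+ 3 + r * v ^+ 4) ->
  forall w, jet2 f w ->
  jet2 (fun w => if w == z then c1 else (f w - f z) / (w - z)) w.
Proof.
move=> [c2 [c3 [d d0 [M H]]]] w jw; have [->|wz] := eqVneq w z.
  exists c2, c3, d => //; exists M => v /H[r rM E].
  exists r => //; rewrite eqxx.
  have [v0|v0] := eqVneq (z + v) z.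
    have -> : v = 0 by apply: (addrI z); rewrite addr0.
    by ring.
  have {}v0 : v != 0 by apply: contra_neq v0 => ->; rewrite addr0.
  by rewrite E (_ : z + v - z = v); [field|ring].
have nwz : 0 < normc (w - z) by rewrite normc_gt0 subr_eq0.
apply: (jet2_local (f := fun w => (f w + - f z) * (1 * w + - z)^-1) nwz).
  move=> v vd; case: eqVneq => [E|_]; last by rewrite mul1r.
  by move: vd; rewrite -E opprD addrA subrr sub0r normcN ltxx.
apply: jet2_mul; first exact: jet2_add_cst.
by apply: jet2_inv; [rewrite mul1r subr_eq0|exact: jet2_affine].
Qed.

(** |w - z| <= r |w - z^*| bounds |w - z| by 2 r Im z / (1 - r). *)
Lemma hyperbolic_disc_compact (R : realType) (z : R[i]) (r : R) :
  0 < complex.Im z -> 0 < r -> r < 1 ->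
  let K := [set p : R * R | normc (p.1 +i* p.2 - z) <= r * normc (p.1 +i* p.2 - z^*)] in
  compact K /\
  exists Rad, forall p, K p -> normc (p.1 +i* p.2) ^+ 2 <= Rad.
Proof.
move=> z0 r0 r1 K.
pose rho := 2 * complex.Im z / (1 - r).
have zz : normc (z - z^*) = 2 * complex.Im z.
  case: z {K rho} z0 => a c /= c0; rewrite subrr expr0n/= add0r sqrtr_sqr.
  by rewrite gtr0_norm; lra.
have Kb p : K p -> normc (p.1 +i* p.2 - z) <= rho.
  move=> Kp; have := le_normcD (p.1 +i* p.2 - z) (z - z^*).
  rewrite addrA subrK zz => h.
  rewrite /rho ler_pdivlMr ?subr_gt0//.
  move: Kp; rewrite /K /=; set A := normc _ in h *; set B := normc _ in h *.
  by move=> AB; have := normc_ge0 (p.1 +i* p.2 - z); rewrite -/A; nra.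
split; last first.
  exists ((rho + normc z) ^+ 2) => p Kp.
  rewrite ler_pXn2r ?nnegrE ?addr_ge0 ?normc_ge0//; last first.
    by rewrite (le_trans _ (Kb _ Kp))// normc_ge0.
  have := le_normcD (p.1 +i* p.2 - z) z; rewrite subrK; have := Kb _ Kp; lra.
apply: (@subclosed_compact _ _ (`[complex.Re z - rho, complex.Re z + rho] `*`
   `[complex.Im z - rho, complex.Im z + rho])); last first.
- move=> [x y] /Kb Kp; have := le_trans (normc_Re _) Kp.
  have := le_trans (normc_Im _) Kp; case: (z) => a c /=.
  by rewrite !ler_norml => /andP[? ?] /andP[? ?]; split;
    rewrite /= in_itv/=; apply/andP; split; lra.
- apply: compact_setX; exact: segment_compact.
pose F (p : R * R) := normc (p.1 +i* p.2 - z) ^+ 2 - r ^+ 2 * normc (p.1 +i* p.2 - z^*) ^+ 2.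
have -> : K = F @^-1` [set x | x <= 0].
  apply/seteqP; split => p; rewrite /K /F /= subr_le0 -exprMn;
  by rewrite ler_pXn2r ?nnegrE ?mulr_ge0 ?normc_ge0// ltW.
apply: preimage_closed; last exact: closed_le.
have sub c (p : R * R) :
  normc (q.1 +i* q.2 - c) ^+ 2 @[q --> p] --> normc (p.1 +i* p.2 - c) ^+ 2.
  apply: (continuous_normc_jet2 (g := fun w => w - c)).
  by apply: (jet2_local ltr01 _ (jet2_affine (-c) 1 _)) => v _; rewrite mul1r.
move=> p _; apply: cvgB; first exact: sub.
by apply: cvgMr; exact: sub.
Qed.

(** The function h, the quotient of (f w - f z) / (f w - (f z)^* ) by
(w - z) / (w - z^* ), has modulus at most 1 / r on the boundary of the disc
|w - z| <= r |w - z^*|, hence inside it; let r tend to 1. In view of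
[normc_subJ], |h| <= 1 is the stated inequality, a form that avoids the
denominators. *)
Lemma schwarz_pick (R : realType) (f : R[i] -> R[i]) :
  (forall z, upper_half z -> analytic_at f z /\ 0 < complex.Im (f z)) ->
  forall z w, upper_half z -> upper_half w ->
  normc (f w - f z) ^+ 2 * (complex.Im w * complex.Im z)
  <= normc (w - z) ^+ 2 * (complex.Im (f w) * complex.Im (f z)).
Proof.
move=> Hf z w0 z0 w00.
have [[/[dup] /analytic_jet2 jz /analytic_jet3 [c1 Hc1] fz0] [_ fw00]] :=
  (Hf z z0, Hf w0 w00).
have [->|wz] := eqVneq w0 z.
  by rewrite !subrr Normc.normc0 expr0n /= !mul0r.
pose g w := if w == z then c1 else (f w - f z) / (w - z).
pose h w := g w * (1 * w + - z^*) * (f w + - (f z)^*)^-1.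
have n0 w : upper_half w -> f w + - (f z)^* != 0.
  move=> /Hf[_ fw0]; apply/eqP => /(congr1 (@complex.Im R)).
  move: fw0 fz0; case: (f w) => ? ?; case: (f z) => ? ? /=; lra.
have jh w : upper_half w -> jet2 h w.
  move=> w1; have jw : jet2 f w by apply: analytic_jet2; case: (Hf w w1).
  apply: jet2_mul; first apply: jet2_mul.
  - exact: jet2_diff_quotient.
  - exact: jet2_affine.
  - by apply: jet2_inv; [exact: n0|exact: jet2_add_cst].
have hE w : w != z -> normc (h w) =
   normc (f w - f z) * normc (w - z^*) / (normc (w - z) * normc (f w - (f z)^*)).
  move=> wz'; rewrite /h /g (negbTE wz') mul1r !normcM !normcV.
  by rewrite invfM mulrACA !mulrA (mulrAC (normc (f w - f z))).
have fle w : upper_half w -> normc (f w - f z) <= normc (f w - (f z)^*).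
  move=> /Hf[_ fw0]; rewrite -(@ler_pXn2r _ 2) ?nnegrE ?normc_ge0//.
  by rewrite normc_subJ lerDl !mulr_ge0// ltW.
have lt1 w : upper_half w -> normc (w - z) < normc (w - z^*).
  move=> w1; rewrite -(@ltr_pXn2r _ 2) ?nnegrE ?normc_ge0//.
  by rewrite normc_subJ ltrDl !mulr_gt0.
have key r : 0 < r -> r < 1 -> normc (w0 - z) <= r * normc (w0 - z^*) ->
    r * normc (h w0) <= 1.
  move=> r0 r1 Kw; have [cK [Rad HRad]] := hyperbolic_disc_compact z0 r0 r1.
  have up p : normc (p.1 +i* p.2 - z) <= r * normc (p.1 +i* p.2 - z^*) ->
      upper_half (p.1 +i* p.2).
    move=> pK; rewrite /upper_half /= ltNge; apply/negP => p2.
    have : normc (p.1 +i* p.2 - z^*) <= normc (p.1 +i* p.2 - z).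
      rewrite -(@ler_pXn2r _ 2) ?nnegrE ?normc_ge0//.
      by rewrite normc_subJ gerDl pmulr_rle0// mulr_le0_ge0// ltW.
    move=> BA; have B0 := normc_ge0 (p.1 +i* p.2 - z^*).
    have A0 : normc (p.1 +i* p.2 - z) = 0.
      have := normc_ge0 (p.1 +i* p.2 - z); nra.
    move/eqP: A0; rewrite normc_eq0 subr_eq0 => /eqP A0.
    by move: z0; rewrite /upper_half /= -A0 /= ltNge p2.
  have : normc (h w0) ^+ 2 <= r^-1 ^+ 2.
    have := max_modulus cK (fun p Kp => jh _ (up p Kp)) HRad _
      (p := (complex.Re w0, complex.Im w0)).
    rewrite /= => /(_ (r^-1 ^+ 2)).
    have -> : complex.Re w0 +i* complex.Im w0 = w0 by case: (w0).
    apply => //.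
    move=> p pK; have [pe|plt] := leP (r * normc (p.1 +i* p.2 - z^*)) (normc (p.1 +i* p.2 - z)).
      left; have wp := up _ pK.
      have Ap := lt1 _ wp; have A0 := normc_ge0 (p.1 +i* p.2 - z).
      have B0 := le_lt_trans A0 Ap.
      have Ae : normc (p.1 +i* p.2 - z) = r * normc (p.1 +i* p.2 - z^*).
        by apply/eqP; rewrite eq_le pe andbT.
      have wz1 : p.1 +i* p.2 != z.
        by rewrite -subr_eq0 -normc_gt0 Ae mulr_gt0.
      have Y0 : 0 < normc (f (p.1 +i* p.2) - (f z)^*) by rewrite normc_gt0 n0.
      rewrite ler_pXn2r ?nnegrE ?invr_ge0 ?normc_ge0 ?(ltW r0)//.
      rewrite hE// Ae ler_pdivrMr ?mulr_gt0// !mulrA mulVf ?gt_eqF// mul1r mulrC.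
      by rewrite ler_pM2l// fle.
    right; exists ((r * normc (p.1 +i* p.2 - z^*) - normc (p.1 +i* p.2 - z)) / 2).
      by rewrite divr_gt0// subr_gt0.
    move=> v vd.
    have -> : (p.1 + complex.Re v) +i* (p.2 + complex.Im v) = (p.1 +i* p.2) + v.
      by case: (v).
    have k1 := le_normcD (p.1 +i* p.2 - z) v.
    have k2 := le_normcD (p.1 +i* p.2 + v - z^*) (- v).
    rewrite addrAC in k1.
    have k3 : p.1 +i* p.2 + v - z^* - v = p.1 +i* p.2 - z^* by ring.
    rewrite k3 normcN in k2.
    have := normc_ge0 v; nra.
  rewrite ler_pXn2r ?nnegrE ?invr_ge0 ?normc_ge0 ?(ltW r0)//.
  by rewrite -(ler_pM2l r0) divff// gt_eqF.
have h1 : normc (h w0) <= 1.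
  rewrite leNgt; apply/negP => hgt.
  have den0 : 0 < normc (w0 - z^*) by apply: le_lt_trans (lt1 _ w00); exact: normc_ge0.
  (* the disc of radius r contains w0, and r exceeds 1 / |h w0| *)
  pose r := Num.max (normc (w0 - z) / normc (w0 - z^*)) ((1 + (normc (h w0))^-1) / 2).
  have hi : 0 < (normc (h w0))^-1 < 1 by rewrite invr_gt0 invf_lt1 (lt_trans ltr01 hgt).
  have r1 : r < 1.
    rewrite gt_max ltr_pdivrMr// mul1r lt1//=; lra.
  have r2 : (1 + (normc (h w0))^-1) / 2 <= r by rewrite le_max lexx orbT.
  have r3 : normc (w0 - z) / normc (w0 - z^*) <= r by rewrite le_max lexx.
  have r0 : 0 < r by lra.
  have := key r r0 r1; rewrite -ler_pdivrMr// => /(_ r3).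
  have : (1 + (normc (h w0))^-1) / 2 * normc (h w0) <= r * normc (h w0).
    by rewrite ler_pM2r// (lt_trans ltr01).
  have -> : (1 + (normc (h w0))^-1) / 2 * normc (h w0) = (normc (h w0) + 1) / 2.
    by field; rewrite gt_eqF// (lt_trans ltr01).
  lra.
have d1 : 0 < normc (w0 - z) by rewrite normc_gt0 subr_eq0.
have d2 : 0 < normc (f w0 - (f z)^*) by rewrite normc_gt0 n0.
have : normc (f w0 - f z) * normc (w0 - z^*) <= normc (w0 - z) * normc (f w0 - (f z)^*).
  by move: h1; rewrite hE// ler_pdivrMr ?mulr_gt0// mul1r.
move=> h2; have := @lerXn2r _ 2 _ _ _ _ h2.
rewrite !nnegrE !mulr_ge0 ?normc_ge0// => /(_ isT isT).
rewrite !exprMn !normc_subJ; lra.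
Qed.

(** * The transforms psi and K of a probability measure *)

(** Real inversion, with the convention 0^-1 = 0, is continuous off 0. *)
Lemma measurable_invr (R : realType) : measurable_fun [set: R] (@GRing.inv R).
Proof.
have -> : [set: R] = [set 0] `|` ~` [set 0] by rewrite setUv.
apply/measurable_funU => //; first exact: measurableC.
split; first exact: measurable_fun_set1.
apply: subspace_continuous_measurable_fun; first exact: measurableC.
apply: continuous_in_subspaceT => x; rewrite inE /= => /eqP x0.
exact: inv_continuous.
Qed.

Lemma measurable_fun_div (R : realType) (D : set R) (f g : R -> R) :
  measurable D -> measurable_fun D f -> measurable_fun D g ->
  measurable_fun D (fun x => f x / g x).
Proof.
move=> mD mf mg; apply: measurable_funM => //.
exact: measurableT_comp (@measurable_invr R) mg.
Qed.

Definition kernel_den (R : realType) (x y xi : R) : R := (1 - x * xi) ^+ 2 + (y * xi) ^+ 2.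
(** Real and imaginary parts of (z xi) / (1 - z xi) for z = x + i y. *)
Definition kernel_re (R : realType) (x y xi : R) : R :=
  (x * xi * (1 - x * xi) - (y * xi) ^+ 2) / kernel_den x y xi.
Definition kernel_im (R : realType) (x y xi : R) : R := y * xi / kernel_den x y xi.

Lemma psi_kernelE (R : realType) (x y xi : R) :
  ((x +i* y) * xi%:C) / (1 - (x +i* y) * xi%:C) = kernel_re x y xi +i* kernel_im x y xi.
Proof.
rewrite /kernel_re /kernel_im /kernel_den /real_complex_def; simpc; rewrite sqrrN.
by congr (_ +i* _); ring.
Qed.

Lemma psiE (R : realType) (nu : probability (measurableTypeR R) R) (x y : R) :
  psi nu (x +i* y) = (\int[nu]_(xi in `[0, +oo[) kernel_re x y xi)
                     +i* (\int[nu]_(xi in `[0, +oo[) kernel_im x y xi).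
Proof.
rewrite /psi /Cintegral; congr (_ +i* _); apply: eq_Rintegral => xi _;
by rewrite psi_kernelE.
Qed.

Lemma measurable_kernel_den (R : realType) (D : set (measurableTypeR R)) (x y : R) :
  measurable D -> measurable_fun D (kernel_den x y).
Proof.
move=> mD; apply: measurable_funD; apply: measurable_funX.
  apply: measurable_funB; first exact: measurable_cst.
  by apply: measurable_funM; [exact: measurable_cst|exact: measurable_id].
by apply: measurable_funM; [exact: measurable_cst|exact: measurable_id].
Qed.

Lemma measurable_kernel_im (R : realType) (D : set (measurableTypeR R)) (x y : R) :
  measurable D -> measurable_fun D (kernel_im x y).
Proof.
by move=> mD; apply: measurable_fun_div => //; exact: measurable_kernel_den.
Qed.

Lemma measurable_kernel_re (R : realType) (D : set (measurableTypeR R)) (x y : R) :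
  measurable D -> measurable_fun D (kernel_re x y).
Proof.
move=> mD; have mx c : measurable_fun D (fun xi : R => c * xi).
  by apply: measurable_funM; [exact: measurable_cst|exact: measurable_id].
apply: measurable_fun_div => //; last exact: measurable_kernel_den.
apply: measurable_funB; last by apply: measurable_funX; exact: mx.
apply: measurable_funM; first exact: mx.
by apply: measurable_funB; [exact: measurable_cst|exact: mx].
Qed.

Lemma bounded_integrable (R : realType) (nu : probability (measurableTypeR R) R)
    (D : set (measurableTypeR R)) (f : R -> R) (B : R) :
  measurable D -> measurable_fun D f -> (forall xi, D xi -> `|f xi| <= B) ->
  nu.-integrable D (EFin \o f).
Proof.
move=> mD mf fB; apply: measurable_bounded_integrable => //.
  by rewrite (le_lt_trans (probability_le1 nu mD))// ltry.
exists B; split; first exact: num_real.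
by move=> r Br xi /fB /le_trans; apply; exact: ltW.
Qed.

(** |1 - z xi| >= Im z / |z|, because |z| |1 - z xi| = |z^* - |z|^2 xi|. *)
Lemma kernel_den_ge (R : realType) (x y xi : R) :
  y ^+ 2 <= (x ^+ 2 + y ^+ 2) * kernel_den x y xi.
Proof.
have -> : (x ^+ 2 + y ^+ 2) * kernel_den x y xi =
  (x - (x ^+ 2 + y ^+ 2) * xi) ^+ 2 + y ^+ 2 by rewrite /kernel_den; ring.
by rewrite lerDr sqr_ge0.
Qed.

Lemma kernel_den_gt0 (R : realType) (x y xi : R) : 0 < y -> 0 < kernel_den x y xi.
Proof.
move=> y0; have := kernel_den_ge x y xi; have y2 : 0 < y ^+ 2 by rewrite exprn_gt0.
have := sqr_ge0 x => x2 h.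
by rewrite -(@pmulr_rgt0 _ (x ^+ 2 + y ^+ 2)) ?ltr_wpDl// (lt_le_trans y2).
Qed.

Lemma kernel_den_bound (R : realType) (x y xi : R) : 0 < y ->
  1 <= (1 + x ^+ 2 / y ^+ 2) * kernel_den x y xi.
Proof.
move=> y0; have := kernel_den_ge x y xi; have y2 : 0 < y ^+ 2 by rewrite exprn_gt0.
rewrite -[X in _ -> X <= _](@mulVf _ (y ^+ 2)) ?gt_eqF//.
rewrite -[X in _ -> _ <= (X + _) * _](@mulVf _ (y ^+ 2)) ?gt_eqF//.
move=> h; rewrite (_ : _ * kernel_den x y xi =
    (y ^+ 2)^-1 * ((x ^+ 2 + y ^+ 2) * kernel_den x y xi)).
  by rewrite ler_pM2l ?invr_gt0.
by ring.
Qed.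

Lemma kernel_im_bound (R : realType) (x y xi : R) : 0 < y ->
  `|kernel_im x y xi| <= 2 + x ^+ 2 / y ^+ 2.
Proof.
move=> y0; have d0 := kernel_den_gt0 x xi y0; have d1 := kernel_den_bound x xi y0.
rewrite /kernel_im normrM normfV (gtr0_norm d0) ler_pdivrMr//.
rewrite (_ : 2 + _ = 1 + (1 + x ^+ 2 / y ^+ 2)); last by ring.
rewrite mulrDl mul1r.
have : `|y * xi| ^+ 2 <= kernel_den x y xi.
  by rewrite real_normK ?num_real// /kernel_den lerDr sqr_ge0.
have := sqr_ge0 (`|y * xi| - 1); rewrite sqrrB1; nra.
Qed.

Lemma kernel_re_bound (R : realType) (x y xi : R) : 0 < y ->
  `|kernel_re x y xi| <= 3 + x ^+ 2 / y ^+ 2.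
Proof.
move=> y0; have d0 := kernel_den_gt0 x xi y0; have d1 := kernel_den_bound x xi y0.
have -> : kernel_re x y xi = (1 - x * xi) / kernel_den x y xi - 1.
  by rewrite /kernel_re /kernel_den; field; rewrite -/(kernel_den x y xi) gt_eqF.
rewrite (le_trans (ler_normB _ _))// normr1 (_ : 3 + _ = 2 + x ^+ 2 / y ^+ 2 + 1); last by ring.
rewrite lerD2r normrM normfV (gtr0_norm d0) ler_pdivrMr//.
rewrite (_ : 2 + _ = 1 + (1 + x ^+ 2 / y ^+ 2)); last by ring.
rewrite mulrDl mul1r.
have : `|1 - x * xi| ^+ 2 <= kernel_den x y xi.
  by rewrite real_normK ?num_real// /kernel_den lerDl sqr_ge0.
have := sqr_ge0 (`|1 - x * xi| - 1); rewrite sqrrB1; nra.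
Qed.

Lemma integrable_kernel_im (R : realType) (nu : probability (measurableTypeR R) R)
    (D : set (measurableTypeR R)) (x y : R) :
  measurable D -> 0 < y -> nu.-integrable D (EFin \o kernel_im x y).
Proof.
move=> mD y0; apply: bounded_integrable => //; first exact: measurable_kernel_im.
by move=> xi _; exact: kernel_im_bound.
Qed.

Lemma kernel_im_ge0 (R : realType) (x y xi : R) : 0 < y -> 0 <= xi -> 0 <= kernel_im x y xi.
Proof.
by move=> y0 xi0; rewrite divr_ge0 ?mulr_ge0 ?(ltW y0) ?(ltW (kernel_den_gt0 _ _ y0)).
Qed.

Lemma Im_psi_ge (R : realType) (nu : probability (measurableTypeR R) R)
    (A : set (measurableTypeR R)) (c x y : R) :
  measurable A -> A `<=` `[0, +oo[%classic -> 0 < y ->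
  (forall xi, A xi -> c <= kernel_im x y xi) ->
  c * fine (nu A) <= complex.Im (psi nu (x +i* y)).
Proof.
move=> mA AD y0 cA; rewrite psiE /= -(Rintegral_cst nu mA).
apply: (@le_trans _ _ (\int[nu]_(xi in A) kernel_im x y xi)).
  apply: le_Rintegral => //; last exact: integrable_kernel_im.
  by apply: (@bounded_integrable _ _ _ _ `|c|) => //; exact: measurable_cst.
rewrite /Rintegral fine_le//.
- exact: integrable_fin_num (integrable_kernel_im _ _ _ _).
- exact: integrable_fin_num (integrable_kernel_im _ _ _ _).
- apply: ge0_subset_integral => //.
    by apply/measurable_EFinP; exact: measurable_kernel_im.
  by move=> xi; rewrite /= in_itv /= andbT => xi0; rewrite lee_fin kernel_im_ge0.
Qed.

(** The imaginary part of the kernel is positive on ]0, +oo[, so a zero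
integral would leave nu with no mass outside 0. *)
Lemma Im_psi_gt0 (R : realType) (nu : probability (measurableTypeR R) R) (z : R[i]) :
  Mplus nu -> upper_half z -> 0 < complex.Im (psi nu z).
Proof.
case: z => x y [nu1 nu0] y00; have {y00}y0 : 0 < y by exact: y00.
have mD : measurable (`[0, +oo[%classic : set (measurableTypeR R)) by [].
have i0 : 0 <= complex.Im (psi nu (x +i* y)).
  have := @Im_psi_ge _ nu set0 0 x y measurable0 (@sub0set _ _) y0.
  by rewrite mul0r; apply.
rewrite psiE /= /Rintegral in i0 *; rewrite lt_neqAle i0 andbT; apply/eqP => E.
have ifin := integrable_fin_num mD (integrable_kernel_im nu x mD y0).
have E0 : (\int[nu]_(xi in `[0%R, +oo[) `|(kernel_im x y xi)%:E| = 0)%E.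
  rewrite [RHS](_ : 0 = \int[nu]_(xi in `[0%R, +oo[) (kernel_im x y xi)%:E)%E; last first.
    by rewrite -[RHS]fineK// -E.
  apply: eq_integral => xi; rewrite inE /= in_itv /= andbT => xi0.
  by rewrite ger0_norm// kernel_im_ge0.
have mf : measurable_fun (`[0, +oo[%classic : set (measurableTypeR R)) (EFin \o kernel_im x y).
  by apply/measurable_EFinP; exact: measurable_kernel_im.
have [/(_ E0) [N [mN N0 HN]] _] := ae_eq_integral_abs nu mD mf.
have sub : `]0, +oo[%classic `<=` N.
  move=> xi; rewrite /= in_itv /= andbT => xi0; apply: HN => /=.
  rewrite in_itv /= (ltW xi0) /= => /(_ isT) [] /eqP.
  by rewrite /kernel_im gt_eqF// divr_gt0 ?mulr_gt0// kernel_den_gt0.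
have n0 : nu `]0, +oo[%classic = 0%E.
  by apply: (subset_measure0 _ mN sub N0).
have e : nu `[0%R, +oo[%classic = (nu [set 0%R] + nu `]0%R, +oo[%classic)%E.
  rewrite -(@setU1itv _ _ _ _ false) ?bnd_simp//; apply: measureU => //.
  by apply/seteqP; split => // xi [/= ->]; rewrite in_itv /= ltxx.
by move: nu0; rewrite -nu1 e n0 adde0 ltxx.
Qed.

Lemma psi_real (R : realType) (nu : probability (measurableTypeR R) R) (x : R) :
  complex.Im (psi nu x%:C) = 0.
Proof.
rewrite -[x%:C]/(x +i* 0) psiE /= (_ : kernel_im x 0 = fun=> 0).
  by rewrite Rintegral_cst// mul0r.
by apply/funext => xi; rewrite /kernel_im !mul0r.
Qed.

Lemma mobius_Im (R : realType) (p : R[i]) :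
  complex.Im (p / (1 + p)) = complex.Im p / normc (1 + p) ^+ 2.
Proof.
by rewrite normc_sqr; case: p => x y; simpc => /=; ring.
Qed.

Lemma onep_neq0 (R : realType) (p : R[i]) : 0 < complex.Im p -> 1 + p != 0.
Proof.
by case: p => x y /= y0; rewrite eq_complex /= add0r (gt_eqF y0) andbF.
Qed.

Lemma mobius_inj (R : realType) (p q : R[i]) : 0 < complex.Im p -> 0 < complex.Im q ->
  p / (1 + p) = q / (1 + q) -> p = q.
Proof.
move=> /onep_neq0 p0 /onep_neq0 q0 /eqP; rewrite eqr_div// => /eqP h.
have -> : p = p * (1 + q) - p * q by ring.
by rewrite h; ring.
Qed.

Lemma Im_K_gt0 (R : realType) (nu : probability (measurableTypeR R) R) (z : R[i]) :
  Mplus nu -> upper_half z -> 0 < complex.Im (Kfun nu z).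
Proof.
move=> nuP z0; rewrite /Kfun mobius_Im divr_gt0 ?Im_psi_gt0//.
by rewrite exprn_gt0// normc_gt0 onep_neq0// Im_psi_gt0.
Qed.

Lemma Im_K_real (R : realType) (nu : probability (measurableTypeR R) R) (z : R[i]) :
  complex.Im z = 0 -> complex.Im (Kfun nu z) = 0.
Proof.
case: z => x y yy; have {yy}-> : y = 0 by exact: yy.
by rewrite /Kfun mobius_Im (psi_real nu x) mul0r.
Qed.

(** At distance at most h from 1/s and at height eta = h s^2, one has
|1 - w xi| = O(h s) while Im (w xi) is of order h s. *)
Lemma kernel_im_near (R : realType) (s h xi : R) : 0 < s -> 0 < h -> h * s <= 2^-1 ->
  `|xi - s^-1| <= h -> (10 * (h * s))^-1 <= kernel_im s (h * s ^+ 2) xi.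
Proof.
move=> s0 h0 hs; rewrite ler_norml => /andP[l u].
set k := h * s in hs *; have k0 : 0 < k by rewrite mulr_gt0.
have st : s * s^-1 = 1 by rewrite mulfV ?gt_eqF.
have l' : 1 - k <= s * xi.
  have : s * (- h) <= s * (xi - s^-1) by rewrite ler_pM2l.
  by rewrite mulrBr st /k; lra.
have u' : s * xi <= 1 + k.
  have : s * (xi - s^-1) <= s * h by rewrite ler_pM2l.
  by rewrite mulrBr st /k; lra.
rewrite /kernel_im /kernel_den (_ : h * s ^+ 2 * xi = k * (s * xi)); last by rewrite /k; ring.
set q := s * xi in l' u' *.
have d0 : 0 < (1 - q) ^+ 2 + (k * q) ^+ 2.
  by rewrite ltr_wpDl ?sqr_ge0// exprn_gt0// mulr_gt0//; lra.
rewrite ler_pdivlMr// mulrC ler_pdivrMr ?mulr_gt0//.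
have h1 : (1 - q) ^+ 2 <= k ^+ 2.
  by rewrite -ler_sqrt ?sqr_ge0// !sqrtr_sqr (gtr0_norm k0) ler_norml; lra.
have q2 : 0 <= q <= 3 / 2 by lra.
have h2 : (k * q) ^+ 2 <= k ^+ 2 * (9 / 4).
  by rewrite exprMn ler_pM2l ?exprn_gt0//; nra.
have h3 : k * 2^-1 <= k * q by rewrite ler_pM2l//; lra.
have h4 : k * (k * 2^-1) <= k * (k * q) by rewrite ler_pM2l.
have : 0 <= k ^+ 2 by rewrite sqr_ge0.
rewrite !expr2 in h1 h2 *; nra.
Qed.

(** Stieltjes inversion at height h s^2: the kernel is at least 1 / (10 h s) on
the interval, by [kernel_im_near]. *)
Lemma mass_near (R : realType) (nu : probability (measurableTypeR R) R) (s h : R) :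
  0 < s -> 0 < h -> h * s <= 2^-1 ->
  fine (nu `[s^-1 - h, s^-1 + h]%classic)
    <= 10 * (h * s) * complex.Im (psi nu (s +i* (h * s ^+ 2))).
Proof.
move=> s0 h0 hs; have k0 : 0 < 10 * (h * s) by rewrite !mulr_gt0.
have := @Im_psi_ge _ nu `[s^-1 - h, s^-1 + h]%classic (10 * (h * s))^-1 s (h * s ^+ 2).
move=> H; rewrite -ler_pdivrMl//; apply: H => //.
- move=> xi; rewrite /= !in_itv /= andbT => /andP[+ _]; apply: le_trans.
  rewrite subr_ge0 -(@ler_pM2r _ s)// mulVf ?gt_eqF//; lra.
- by rewrite mulr_gt0// exprn_gt0.
- move=> xi; rewrite /= in_itv /= => /andP[l u]; apply: kernel_im_near => //.
  by rewrite ler_norml; lra.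
Qed.

Lemma Rintegral_null_part (R : realType) (nu : probability (measurableTypeR R) R)
    (D A : set (measurableTypeR R)) (f : R -> R) :
  measurable D -> measurable A -> A `<=` D -> nu (D `\` A) = 0%E ->
  measurable_fun D f -> \int[nu]_(xi in D) f xi = \int[nu]_(xi in A) f xi.
Proof.
move=> mD mA AD N0 mf; rewrite /Rintegral; congr fine.
have mN : measurable (D `\` A) by exact: measurableD.
rewrite -{1}(setDUK AD) integral_setU//; last 2 first.
- by rewrite setDUK//; exact/measurable_EFinP.
- by apply/disj_setPS => xi [? []].
rewrite [X in (_ + X)%E](_ : _ = 0%E) ?adde0//.
apply: null_set_integral => //; apply/measurable_EFinP.
by apply: measurable_funS mf => //; exact: subDsetl.
Qed.

Lemma Rintegral_atom (R : realType) (nu : probability (measurableTypeR R) R)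
    (A : set (measurableTypeR R)) (u : R) (f : R -> R) (B : R) :
  measurable A -> A `<=` `[0, +oo[%classic -> 0 <= u -> ~ A u ->
  (nu A + nu [set u] = 1)%E -> nu `[0%R, +oo[%classic = 1%E ->
  measurable_fun (`[0, +oo[%classic : set (measurableTypeR R)) f ->
  (forall xi, A xi -> `|f xi| <= B) ->
  \int[nu]_(xi in `[0, +oo[) f xi
    = \int[nu]_(xi in A) f xi + f u * fine (nu [set u]).
Proof.
move=> mA AD u0 Au nuA nuD mf fB.
have uD : [set u] `<=` (`[0, +oo[%classic : set R).
  by move=> _ ->; rewrite /= in_itv /= u0.
have mAu : measurable (A `|` [set u] : set (measurableTypeR R)) by exact: measurableU.
have AuD : A `|` [set u] `<=` (`[0, +oo[%classic : set R) by rewrite subUset.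
have dis : A `&` [set u] = set0.
  by apply/seteqP; split => // xi [Axi E]; apply: Au; rewrite -E.
rewrite (@Rintegral_null_part _ _ _ (A `|` [set u]))//; last first.
  rewrite measureD//; last by rewrite [X in (X < _)%E](_ : _ = 1%E) ?ltry//; exact: nuD.
  rewrite setIC (setIidl AuD) measureU// nuA [X in (X - _)%E](_ : _ = 1%E) ?subee//.
rewrite Rintegral_setU//; last first.
- by apply/disj_setPS; rewrite dis.
- apply: (@bounded_integrable _ _ _ _ (Num.max B `|f u|)) => //.
    exact: measurable_funS mf.
  by move=> xi [/fB h|->]; rewrite le_max ?h ?lexx ?orbT.
congr (_ + _); rewrite -Rintegral_cst//.
by apply: eq_Rintegral => xi; rewrite inE => ->.
Qed.

Lemma Rintegral_le_bound (R : realType) (nu : probability (measurableTypeR R) R)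
    (A : set (measurableTypeR R)) (f : R -> R) (c : R) :
  measurable A -> measurable_fun A f -> 0 <= c ->
  (forall xi, A xi -> `|f xi| <= c) -> `|\int[nu]_(xi in A) f xi| <= c.
Proof.
move=> mA mf c0 fc; have fi := bounded_integrable nu mA mf fc.
rewrite (le_trans (le_normr_Rintegral mA fi))//.
apply: (@le_trans _ _ (\int[nu]_(xi in A) c)).
  apply: le_Rintegral => //.
    apply: (@bounded_integrable _ _ _ _ c) => //; last by move=> xi /fc; rewrite normr_id.
    by apply: measurableT_comp => //; exact: normr_measurable.
  by apply: (@bounded_integrable _ _ _ _ `|c|) => //; exact: measurable_cst.
rewrite Rintegral_cst// ler_piMr// -lee_fin fineK ?fin_num_measure//.
exact: probability_le1.
Qed.

(** On a bounded support the kernel itself is O(w) for small w. *)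
Lemma Kfun_bounded_support (R : realType) (nu : probability (measurableTypeR R) R)
    (B : R) (w : R[i]) :
  0 < B -> nu `]B, +oo[%classic = 0%E -> upper_half w -> normc w * B <= 8^-1 ->
  normc (Kfun nu w) <= 8 * B * normc w.
Proof.
move=> B0 nuB w0 wB.
have mA : measurable (`[0, B]%classic : set (measurableTypeR R)) by [].
have AD : `[0, B]%classic `<=` (`[0, +oo[%classic : set R).
  by move=> xi; rewrite /= !in_itv /= andbT => /andP[].
have nA : nu (`[0%R, +oo[%classic `\` `[0%R, B]%classic) = 0%E.
  apply: (subset_measure0 _ _ _ nuB) => //; first exact: measurableD.
  by move=> xi [/=]; rewrite !in_itv /= !andbT => ->/= /negP; rewrite -ltNge.
have kb xi : `[0, B]%classic xi ->
    normc ((w * xi%:C) / (1 - w * xi%:C)) <= 2 * (normc w * B).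
  rewrite /= in_itv /= => /andP[xi0 xiB].
  have h1 : normc (w * xi%:C) <= normc w * B.
    by rewrite normcM normc_real ger0_norm// ler_wpM2l// normc_ge0.
  have h2 : 2^-1 <= normc (1 - w * xi%:C).
    have := le_normcB 1 (w * xi%:C); rewrite Normc.normc1; lra.
  rewrite normcM normcV ler_pdivrMr; last by lra.
  have := normc_ge0 (w * xi%:C); nra.
have pc : 0 <= 2 * (normc w * B) by rewrite !mulr_ge0 ?normc_ge0// ltW.
have psiB : normc (psi nu w) <= 4 * (normc w * B).
  case: w w0 {wB} kb pc => x y w0 kb pc; rewrite psiE.
  have mD : measurable (`[0, +oo[%classic : set (measurableTypeR R)) by [].
  rewrite (Rintegral_null_part mD mA AD nA (measurable_kernel_re x y mD)).
  rewrite (Rintegral_null_part mD mA AD nA (measurable_kernel_im x y mD)).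
  rewrite (le_trans (normc_ReIm _))//=.
  have kb' xi : `[0, B]%classic xi ->
      normc (kernel_re x y xi +i* kernel_im x y xi) <= 2 * (normc (x +i* y) * B).
    by move=> /kb; rewrite psi_kernelE.
  have h1 := Rintegral_le_bound nu mA (measurable_kernel_re x y mA) pc
    (fun xi Axi => le_trans (normc_Re (_ +i* _)) (kb' xi Axi)).
  have h2 := Rintegral_le_bound nu mA (measurable_kernel_im x y mA) pc
    (fun xi Axi => le_trans (normc_Im (_ +i* _)) (kb' xi Axi)).
  by move: h1 h2 => /=; lra.
have h2 : 2^-1 <= normc (1 + psi nu w).
  have := le_normcB 1 (- psi nu w); rewrite Normc.normc1 opprK normcN; lra.
rewrite /Kfun normcM normcV ler_pdivrMr; last by lra.
have : 0 <= normc w * B by rewrite mulr_ge0 ?normc_ge0// ltW.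
nra.
Qed.

(** The transform q u w / (1 - (1 - q) u w) of a measure carried by 0 and u,
written without division. *)
Lemma Kfun_two_atoms (R : realType) (nu : probability (measurableTypeR R) R)
    (u : R) (w : R[i]) :
  Mplus nu -> 0 < u -> (nu [set 0%R] + nu [set u] = 1)%E -> upper_half w ->
  let q := fine (nu [set u]) in
  Kfun nu w * (1 - ((1 - q) * u)%:C * w) = (q * u)%:C * w.
Proof.
move=> nuP u0 nu1 w0 q; have := onep_neq0 (Im_psi_gt0 nuP w0).
have X1 : 1 - w * u%:C != 0.
  case: (w) w0 => x y w0; have {}w0 : 0 < y by exact: w0.
  rewrite eq_complex negb_and; apply/orP; right; simpc => /=.
  by rewrite oppr_eq0 gt_eqF// mulr_gt0.
have psiq : psi nu w = q%:C * ((w * u%:C) / (1 - w * u%:C)).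
  case: w w0 {X1} => x y w0; have {}w0 : 0 < y by exact: w0.
  have key (f : R -> R) :
      measurable_fun (`[0, +oo[%classic : set (measurableTypeR R)) f -> f 0 = 0 ->
      \int[nu]_(xi in `[0, +oo[) f xi = f u * q.
    move=> mf f0.
    rewrite (@Rintegral_atom _ nu [set 0] u f 0)//.
    - rewrite (@eq_Rintegral _ _ _ _ _ (fun=> 0)); last by move=> xi; rewrite inE => ->.
      by rewrite Rintegral_cst// mul0r add0r.
    - by move=> _ ->; rewrite /= in_itv /= lexx.
    - exact: ltW.
    - by apply/eqP; rewrite gt_eqF.
    - by case: nuP.
    - by move=> _ ->; rewrite f0 normr0.
  rewrite psi_kernelE psiE !key//.
  - by rewrite /real_complex_def; simpc; rewrite !(mulrC q).
  - exact: measurable_kernel_im.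
  - by rewrite /kernel_im !mulr0 mul0r.
  - exact: measurable_kernel_re.
  - by rewrite /kernel_re !mulr0 mul0r expr0n subr0 mul0r.
move=> S0; apply: (mulIf S0); rewrite mulrAC /Kfun divfK// psiq.
by rewrite !rmorphM rmorphB rmorph1; field; exact: X1.
Qed.

(** * A measure whose top atom is isolated *)

Definition gap_measure (R : realType) (mu : probability (measurableTypeR R) R) (a b : R) :=
  [/\ mu `[0%R, +oo[%classic = 1%E, 0 < a, a < b &
      (mu `[0%R, a]%classic + mu [set b])%E = 1%E].

(** The contribution to 1 + psi x of the part of the measure below a, for real x
in ]0, 1/a[. *)
Definition bulk_part (R : realType) (mu : probability (measurableTypeR R) R) (a x : R) : R :=
  \int[mu]_(xi in `[0, a]) (1 - x * xi)^-1.

(** This is (1 - b x) (1 + psi x), which has no pole at 1/b. *)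
Definition cleared_psi (R : realType) (mu : probability (measurableTypeR R) R) (a b x : R) : R :=
  fine (mu [set b]) + (1 - b * x) * bulk_part mu a x.

(** K = 1 - 1 / (1 + psi) on the real interval ]0, 1/a[, continued through
x = 1/b. *)
Definition real_K (R : realType) (mu : probability (measurableTypeR R) R) (a b x : R) : R :=
  1 - (1 - b * x) / cleared_psi mu a b x.

Lemma gap_den (R : realType) (a x xi : R) : 0 < a -> 0 < x -> x * a < 1 ->
  `[0, a]%classic xi -> 0 < 1 - x * a /\ 1 - x * a <= 1 - x * xi.
Proof.
move=> a0 x0 xa; rewrite /= in_itv /= => /andP[xi0 xia].
split; first by rewrite subr_gt0.
by rewrite lerB// ler_pM2l.
Qed.

(** 1 / (1 - z xi) differs from its value at x = Re z by
i y xi / ((1 - z xi) (1 - x xi)). *)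
Lemma gap_kernel (R : realType) (a x y xi : R) : 0 < a -> 0 < x -> x * a < 1 -> 0 <= y ->
  `[0, a]%classic xi ->
  normc ((kernel_re x y xi + 1 - (1 - x * xi)^-1) +i* kernel_im x y xi) <= y * a / (1 - x * a) ^+ 2.
Proof.
move=> a0 x0 xa y0 Axi; have [d0 d1] := gap_den a0 x0 xa Axi.
have [xi0 xia] : 0 <= xi /\ xi <= a by move: Axi; rewrite /= in_itv /= => /andP[].
have r0 : 0 < 1 - x * xi by exact: lt_le_trans d1.
set w := 1 - (x +i* y) * xi%:C.
have wd : 1 - x * xi <= normc w.
  apply: le_trans (normc_Re _); rewrite /w /real_complex_def; simpc => /=.
  by rewrite ?mulr0 ?subr0 ler_norm.
have w0 : w != 0 by rewrite -normc_gt0 (lt_le_trans r0).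
have -> : (kernel_re x y xi + 1 - (1 - x * xi)^-1) +i* kernel_im x y xi
   = (0 +i* (y * xi)) / (w * (1 - x * xi)%:C).
  have -> : (kernel_re x y xi + 1 - (1 - x * xi)^-1) +i* kernel_im x y xi =
    (kernel_re x y xi +i* kernel_im x y xi) + 1 - ((1 - x * xi)^-1)%:C.
    by rewrite /real_complex_def; simpc.
  rewrite -psi_kernelE -/w fmorphV.
  have rc : (1 - x * xi)%:C = 1 - x%:C * xi%:C by rewrite rmorphB rmorphM rmorph1.
  have rn : (1 - x * xi)%:C != 0 by rewrite -normc_gt0 normc_real gtr0_norm.
  have wE : w = (1 - x * xi)%:C - (0 +i* (y * xi)).
    by rewrite /w /real_complex_def; simpc; rewrite ?mulr0 ?subr0 ?add0r.
  have -> : (x +i* y) * xi%:C = 1 - w by rewrite /w; ring.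
  have -> : 0 +i* (y * xi) = (1 - x * xi)%:C - w by rewrite wE; ring.
  by field; rewrite w0 andbT; move: rn; rewrite rc.
rewrite normcM normcV normcM normc_real (gtr0_norm r0) /= expr0n/= add0r sqrtr_sqr.
rewrite (ger0_norm (mulr_ge0 y0 xi0)).
rewrite ler_pM// ?mulr_ge0 ?invr_ge0 ?mulr_ge0 ?normc_ge0 ?(ltW r0)//.
  by rewrite ler_wpM2l.
rewrite lef_pV2 ?posrE ?exprn_gt0 ?mulr_gt0 ?(lt_le_trans r0 wd)// expr2.
by rewrite ler_pM ?(ltW d0)// (le_trans d1).
Qed.

Lemma gap_integrable (R : realType) (mu : probability (measurableTypeR R) R) (a x : R) :
  0 < a -> 0 < x -> x * a < 1 ->
  mu.-integrable `[0, a] (EFin \o (fun xi : R => (1 - x * xi)^-1)).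
Proof.
move=> a0 x0 xa; apply: (@bounded_integrable _ _ _ _ (1 - x * a)^-1) => //.
  apply: measurableT_comp; first exact: measurable_invr.
  apply: measurable_funB; first exact: measurable_cst.
  by apply: measurable_funM; [exact: measurable_cst|exact: measurable_id].
move=> xi /(gap_den a0 x0 xa)[d0 d1].
by rewrite normfV gtr0_norm ?lef_pV2 ?posrE// (lt_le_trans d0).
Qed.

Lemma psi_gap (R : realType) (mu : probability (measurableTypeR R) R) (a b x y : R) :
  gap_measure mu a b -> 0 < x -> x * a < 1 -> 0 <= y ->
  normc (1 + psi mu (x +i* y) - (bulk_part mu a x)%:C -
   (fine (mu [set b]))%:C * ((kernel_re x y b + 1) +i* kernel_im x y b))
   <= 2 * (y * a / (1 - x * a) ^+ 2).
Proof.
move=> [muD a0 ab muab] x0 xa y0.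
have mA : measurable (`[0, a]%classic : set (measurableTypeR R)) by [].
have mD : measurable (`[0, +oo[%classic : set (measurableTypeR R)) by [].
have AD : `[0, a]%classic `<=` (`[0, +oo[%classic : set R).
  by move=> xi; rewrite /= !in_itv /= andbT => /andP[].
have C0 : 0 <= y * a / (1 - x * a) ^+ 2.
  by rewrite divr_ge0 ?mulr_ge0 ?exprn_ge0 ?(ltW a0)// subr_ge0 ltW.
pose C := y * a / (1 - x * a) ^+ 2; rewrite -/C in C0 *.
have kI xi : `[0, a]%classic xi -> `|kernel_im x y xi| <= C.
  by move=> Axi; apply: le_trans (gap_kernel a0 x0 xa y0 Axi); apply: (normc_Im (_ +i* _)).
have kR xi : `[0, a]%classic xi -> `|kernel_re x y xi + 1 - (1 - x * xi)^-1| <= C.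
  by move=> Axi; apply: le_trans (gap_kernel a0 x0 xa y0 Axi); apply: (normc_Re (_ +i* _)).
have kR' xi : `[0, a]%classic xi -> `|kernel_re x y xi| <= C + 1 + (1 - x * a)^-1.
  move=> Axi; have := kR _ Axi; have [d0 d1] := gap_den a0 x0 xa Axi.
  have : (1 - x * xi)^-1 <= (1 - x * a)^-1 by rewrite lef_pV2 ?posrE// (lt_le_trans d0).
  have : 0 <= (1 - x * xi)^-1 by rewrite invr_ge0 (le_trans (ltW d0)).
  by rewrite !ler_norml; lra.
have nAb : ~ `[0, a]%classic b by rewrite /= in_itv /= (lt_geF ab) andbF.
have b0 : 0 <= b by rewrite ltW// (lt_trans a0).
rewrite psiE.
rewrite (Rintegral_atom mA AD b0 nAb muab muD (measurable_kernel_re x y mD) kR').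
rewrite (Rintegral_atom mA AD b0 nAb muab muD (measurable_kernel_im x y mD) kI).
have ipre : mu.-integrable `[0, a] (EFin \o kernel_re x y).
  by apply: (bounded_integrable _ mA _ kR'); exact: measurable_kernel_re.
have ic (c : R) : mu.-integrable `[0, a] (EFin \o (fun=> c)).
  by apply: (@bounded_integrable _ _ _ _ `|c|) => //; exact: measurable_cst.
have ig := gap_integrable mu a0 x0 xa.
have mpre1 : measurable_fun (`[0, a]%classic : set (measurableTypeR R))
    (fun xi => kernel_re x y xi + 1).
  by apply: measurable_funD; [exact: measurable_kernel_re|exact: measurable_cst].
have ipre1 : mu.-integrable `[0, a] (EFin \o (fun xi => kernel_re x y xi + 1)).
  apply: (@bounded_integrable _ _ _ _ (C + 1 + (1 - x * a)^-1 + 1)) => //.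
  by move=> xi /kR' h; rewrite (le_trans (ler_normD _ _))// normr1 lerD2r.
have mdiff : measurable_fun (`[0, a]%classic : set (measurableTypeR R))
    (fun xi => kernel_re x y xi + 1 - (1 - x * xi)^-1).
  by apply: measurable_funB => //; apply/measurable_EFinP; case/integrableP: ig.
have E : \int[mu]_(xi in `[0, a]) (kernel_re x y xi + 1 - (1 - x * xi)^-1)
  = \int[mu]_(xi in `[0, a]) kernel_re x y xi + fine (mu `[0, a]%classic) - bulk_part mu a x.
  rewrite RintegralB//.
  by rewrite RintegralD// Rintegral_cst// mul1r.
have m1 : fine (mu `[0, a]%classic) + fine (mu [set b]) = 1.
  by rewrite -fineD ?fin_num_measure// muab.
have bR := Rintegral_le_bound mu mA mdiff C0 kR.
have bI := Rintegral_le_bound mu mA (measurable_kernel_im x y mA) C0 kI.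
rewrite E in bR.
set P := (\int[mu]_(xi in `[0, a]) kernel_re x y xi) in bR *.
set Q := (\int[mu]_(xi in `[0, a]) kernel_im x y xi) in bI *.
set m := fine (mu [set b]) in m1 *.
have -> : 1 + ((P + kernel_re x y b * m) +i* (Q + kernel_im x y b * m)) - (bulk_part mu a x)%:C
    - m%:C * ((kernel_re x y b + 1) +i* kernel_im x y b)
  = (P + fine (mu `[0, a]%classic) - bulk_part mu a x) +i* Q.
  have -> : fine (mu `[0, a]%classic) = 1 - m by rewrite -m1 addrK.
  by rewrite /real_complex_def; simpc; congr (_ +i* _); ring.
rewrite (le_trans (normc_ReIm _))//=; lra.
Qed.

Lemma bulk_part_bounds (R : realType) (mu : probability (measurableTypeR R) R) (a x : R) :
  0 < a -> 0 < x -> x * a < 1 ->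
  fine (mu `[0%R, a]%classic) <= bulk_part mu a x <= (1 - x * a)^-1.
Proof.
move=> a0 x0 xa; rewrite /bulk_part; have ig := gap_integrable mu a0 x0 xa.
have mA : measurable (`[0, a]%classic : set (measurableTypeR R)) by [].
have d0 : 0 < 1 - x * a by rewrite subr_gt0.
have ic (c : R) : mu.-integrable `[0, a] (EFin \o (fun=> c)).
  by apply: (@bounded_integrable _ _ _ _ `|c|) => //; exact: measurable_cst.
apply/andP; split.
  rewrite -[X in X <= _]mul1r -Rintegral_cst//; apply: le_Rintegral => // xi Axi.
  have [_ d1] := gap_den a0 x0 xa Axi.
  have r0 : 0 < 1 - x * xi by exact: lt_le_trans d1.
  rewrite -[X in X <= _]invr1 lef_pV2 ?posrE//.
  by rewrite gerBl mulr_ge0 ?(ltW x0)//; move: Axi; rewrite /= in_itv => /andP[].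
apply: (@le_trans _ _ (\int[mu]_(xi in `[0, a]) (1 - x * a)^-1)).
  apply: le_Rintegral => // xi Axi; have [_ d1] := gap_den a0 x0 xa Axi.
  by rewrite lef_pV2 ?posrE// (lt_le_trans d0).
rewrite Rintegral_cst// ler_piMr ?invr_ge0 ?(ltW d0)// -lee_fin fineK ?fin_num_measure//.
exact: probability_le1.
Qed.

(** Multiplying 1 + psi by 1 - b z clears the pole at 1/b; the resulting function
m + (1 - b z) (g + E) is bounded below near [x1, x2], where m is the mass of b,
g the bulk part at x = Re z, and E = O(y) the error of [psi_gap]. *)
Lemma K_boundary (R : realType) (mu : probability (measurableTypeR R) R)
    (a b x1 x2 d0 : R) :
  gap_measure mu a b -> Mplus mu -> 0 < x1 -> x2 * a < 1 -> 0 < d0 ->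
  (forall x, x1 <= x <= x2 -> d0 <= cleared_psi mu a b x) ->
  exists2 y0 : R, 0 < y0 & exists2 C : R, 0 <= C &
    forall x y, x1 <= x <= x2 -> 0 < y -> y <= y0 ->
      normc (Kfun mu (x +i* y) - (real_K mu a b x)%:C) <= C * y.
Proof.
move=> gm muP x10 x2a d00 dD; have [_ a0 ab _] := gm.
have b0 : 0 < b by exact: lt_trans ab.
have [x21|x12] := ltP x2 x1.
  exists 1 => //; exists 0 => // x y /andP[l u].
  by have := le_lt_trans (le_trans l u) x21; rewrite ltxx.
have x20 : 0 < x2 by exact: lt_le_trans x12.
pose dl := 1 - x2 * a; have dl0 : 0 < dl by rewrite subr_gt0.
pose CE := 2 * (a / dl ^+ 2).
have CE0 : 0 <= CE by rewrite mulr_ge0// divr_ge0 ?exprn_ge0// ltW.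
pose BT := 1 + b * (x2 + 1).
have BT0 : 0 <= BT by rewrite addr_ge0// mulr_ge0 ?addr_ge0// ltW.
pose CN := b + BT * BT * CE.
have CN0 : 0 <= CN.
  by apply: addr_ge0; [exact: ltW|apply: mulr_ge0 => //; exact: mulr_ge0].
pose CD := b / dl + BT * CE.
have CD0 : 0 <= CD.
  by apply: addr_ge0; [exact/ltW/divr_gt0|exact: mulr_ge0].
exists (Num.min 1 (d0 / 2 / (CD + 1))).
  by rewrite lt_min ltr01 !divr_gt0// ltr_wpDl.
exists (CN / (d0 * (d0 / 2))).
  by rewrite divr_ge0// mulr_ge0 ?divr_ge0// ltW.
move=> x y xx y0; rewrite le_min => /andP[y1 yd].
have [xl xu] : x1 <= x /\ x <= x2 by move/andP: xx.
have x0 : 0 < x by exact: lt_le_trans xl.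
have xdl : dl <= 1 - x * a by rewrite lerB// ler_pM2r.
have xa : x * a < 1 by rewrite -subr_gt0 (lt_le_trans dl0).
have {}yd : CD * y <= d0 / 2.
  move: yd; rewrite ler_pdivlMr ?ltr_wpDl//; nra.
pose z := x +i* y; pose g := (bulk_part mu a x)%:C; pose m := (fine (mu [set b]))%:C.
pose T := 1 - z * b%:C; pose S := 1 + psi mu z.
have z0 : upper_half z by exact: y0.
have T0 : T != 0.
  rewrite /T /z eq_complex negb_and; apply/orP; right.
  rewrite /real_complex_def; simpc => /=.
  by rewrite ?mulr0 ?add0r ?sub0r ?oppr_eq0 gt_eqF ?mulr_gt0.
have S0 : S != 0 by exact: onep_neq0 (Im_psi_gt0 muP z0).
pose E := S - g - m / T.
have EE : normc E <= CE * y.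
  have := psi_gap gm x0 xa (ltW y0).
  have -> : (kernel_re x y b + 1) +i* kernel_im x y b = T^-1.
    have -> : (kernel_re x y b + 1) +i* kernel_im x y b =
      (kernel_re x y b +i* kernel_im x y b) + 1 by simpc.
    rewrite -psi_kernelE -/z -/T; have -> : z * b%:C = 1 - T by rewrite /T; ring.
    by field; exact: T0.
  rewrite -/z -/S -/g -/m -/E => /le_trans; apply.
  rewrite (_ : CE * y = 2 * (y * a / dl ^+ 2)); last by rewrite /CE; ring.
  rewrite ler_pM2l// ler_pM2l ?mulr_gt0// lef_pV2 ?posrE ?exprn_gt0//.
    by rewrite ler_pXn2r ?nnegrE ?(ltW dl0)// (le_trans (ltW dl0)).
  exact: lt_le_trans xdl.
have TB : normc T <= BT.
  rewrite (le_trans (le_normcD _ _))// Normc.normc1 normcN /BT lerD2l.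
  rewrite normcM normc_real (gtr0_norm b0) mulrC ler_pM2l//.
  by rewrite (le_trans (normc_ReIm _))//= (gtr0_norm x0) (gtr0_norm y0) lerD.
have xb : normc (1 - b * x)%:C <= BT.
  rewrite normc_real (le_trans (ler_normB _ _))// normr1 /BT lerD2l.
  by rewrite gtr0_norm ?mulr_gt0// ler_pM2l//; lra.
have gB : normc g <= dl^-1.
  have /andP[h1 h2] := bulk_part_bounds mu a0 x0 xa.
  rewrite normc_real ger0_norm; last first.
    by apply: le_trans h1; rewrite fine_ge0.
  by apply: (le_trans h2); rewrite lef_pV2 ?posrE// (lt_le_trans dl0).
have mB : normc m <= 1.
  rewrite normc_real ger0_norm ?fine_ge0// -lee_fin fineK ?fin_num_measure//.
  exact: probability_le1.
pose D := (cleared_psi mu a b x)%:C.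
have Dge : d0 <= normc D by rewrite normc_real (le_trans (dD _ xx))// ler_norm.
have D0 : D != 0 by rewrite -normc_gt0 (lt_le_trans d00).
pose xb' := (1 - b * x)%:C.
have DE : D = m + xb' * g by rewrite /D /cleared_psi rmorphD rmorphM.
have TE : T = xb' - (0 +i* (b * y)).
  by rewrite /T /z /xb' /real_complex_def; simpc; congr (_ +i* _); ring.
have nby : normc (0 +i* (b * y)) = b * y.
  by rewrite /= expr0n/= add0r sqrtr_sqr gtr0_norm// mulr_gt0.
have SE : S * T = m + T * (g + E).
  by rewrite /E; field.
have STd : normc (S * T - D) <= CD * y.
  rewrite SE DE (_ : _ - _ = - ((0 +i* (b * y)) * g) + T * E); last by rewrite TE; ring.
  rewrite [leRHS](_ : _ = b * y * dl^-1 + BT * (CE * y)); last by rewrite /CD; ring.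
  apply: normc_leD.
    by apply: normc_leN; rewrite normcM nby ler_pM2l// mulr_gt0.
  exact: normc_leM.
have STge : d0 / 2 <= normc (S * T).
  have := le_normcB D (S * T); rewrite normcB; lra.
have -> : Kfun mu z - (real_K mu a b x)%:C
   = (m * (0 +i* (b * y)) + xb' * T * E) / (D * (S * T)).
  have -> : (real_K mu a b x)%:C = 1 - xb' / D.
    by rewrite /real_K rmorphB rmorph1 fmorph_div.
  rewrite /Kfun -/S; have -> : psi mu z = S - 1 by rewrite /S; ring.
  have -> : m * (0 +i* (b * y)) + xb' * T * E = xb' * (S * T) - T * D.
    rewrite SE DE (_ : 0 +i* (b * y) = xb' - T); last by rewrite TE; ring.
    by ring.
  by field; rewrite D0 S0 T0.
rewrite normcM normcV normcM.
rewrite [leRHS]mulrAC; apply: ler_pM; rewrite ?normc_ge0 ?invr_ge0 ?mulr_ge0 ?normc_ge0//.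
  rewrite [leRHS](_ : _ = b * y + BT * BT * (CE * y)); last by rewrite /CN; ring.
  apply: normc_leD.
    by rewrite normcM nby ler_piMl// mulr_ge0// ltW.
  by apply: normc_leM => //; exact: normc_leM.
rewrite lef_pV2 ?posrE ?mulr_gt0 ?(lt_le_trans d00 Dge) ?divr_gt0//.
  by apply: ler_pM => //; rewrite ?divr_ge0// ltW.
by apply: lt_le_trans STge; rewrite divr_gt0.
Qed.

Lemma bulk_part_le (R : realType) (mu : probability (measurableTypeR R) R) (a x1 x2 : R) :
  0 < a -> 0 < x1 -> x1 <= x2 -> x2 * a < 1 -> bulk_part mu a x1 <= bulk_part mu a x2.
Proof.
move=> a0 x10 x12 x2a; have x20 := lt_le_trans x10 x12.
have x1a : x1 * a < 1 by apply: le_lt_trans x2a; rewrite ler_pM2r.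
apply: le_Rintegral => //; [exact: gap_integrable|exact: gap_integrable|].
move=> xi Axi; have [d1 d1'] := gap_den a0 x10 x1a Axi.
have [d2 d2'] := gap_den a0 x20 x2a Axi.
have e1 : 0 < 1 - x1 * xi by exact: lt_le_trans d1'.
have e2 : 0 < 1 - x2 * xi by exact: lt_le_trans d2'.
rewrite lef_pV2 ?posrE//.
by rewrite lerB// ler_wpM2r//; move: Axi; rewrite /= in_itv => /andP[].
Qed.

Lemma bulk_part_lipschitz (R : realType) (mu : probability (measurableTypeR R) R) (a x1 x2 xm : R) :
  0 < a -> 0 < x1 -> x1 <= xm -> 0 < x2 -> x2 <= xm -> xm * a < 1 ->
  `|bulk_part mu a x1 - bulk_part mu a x2| <= a / (1 - xm * a) ^+ 2 * `|x1 - x2|.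
Proof.
move=> a0 x10 x1m x20 x2m xma.
have x1a : x1 * a < 1 by apply: le_lt_trans xma; rewrite ler_pM2r.
have x2a : x2 * a < 1 by apply: le_lt_trans xma; rewrite ler_pM2r.
have mA : measurable (`[0, a]%classic : set (measurableTypeR R)) by [].
have i1 := gap_integrable mu a0 x10 x1a; have i2 := gap_integrable mu a0 x20 x2a.
have dm : 0 < 1 - xm * a by rewrite subr_gt0.
rewrite /bulk_part -RintegralB//; apply: Rintegral_le_bound => //.
- by apply: measurable_funB; apply/measurable_EFinP;
    [case/integrableP: i1|case/integrableP: i2].
- by rewrite mulr_ge0 ?divr_ge0 ?exprn_ge0 ?(ltW a0) ?(ltW dm).
move=> xi Axi; have [d1 d1'] := gap_den a0 x10 x1a Axi.
have [d2 d2'] := gap_den a0 x20 x2a Axi.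
have [xi0 xia] : 0 <= xi /\ xi <= a by move: Axi; rewrite /= in_itv /= => /andP[].
have e1 : 0 < 1 - x1 * xi by exact: lt_le_trans d1'.
have e2 : 0 < 1 - x2 * xi by exact: lt_le_trans d2'.
have m1 : 1 - xm * a <= 1 - x1 * xi by apply: le_trans d1'; rewrite lerB// ler_pM2r.
have m2 : 1 - xm * a <= 1 - x2 * xi by apply: le_trans d2'; rewrite lerB// ler_pM2r.
have -> : (1 - x1 * xi)^-1 - (1 - x2 * xi)^-1 =
  xi * ((1 - x1 * xi) * (1 - x2 * xi))^-1 * (x1 - x2).
  by field; rewrite !gt_eqF.
rewrite normrM ler_wpM2r// normrM normfV (ger0_norm xi0).
rewrite (gtr0_norm (mulr_gt0 e1 e2)) ler_pM// ?invr_ge0 ?mulr_ge0 ?(ltW e1) ?(ltW e2)//.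
rewrite lef_pV2 ?posrE ?exprn_gt0 ?mulr_gt0// expr2 ler_pM// ltW//.
Qed.

(** To the left of 1/b the function is at least the mass of b, to the right it
decreases. *)
Lemma cleared_psi_lower (R : realType) (mu : probability (measurableTypeR R) R) (a b x1 x2 : R) :
  0 < a -> 0 < b -> 0 < fine (mu [set b]) -> 0 < x1 -> x2 * a < 1 -> 0 < cleared_psi mu a b x2 ->
  exists2 d0 : R, 0 < d0 & forall x, x1 <= x <= x2 -> d0 <= cleared_psi mu a b x.
Proof.
move=> a0 b0 m0 x10 x2a D2.
exists (Num.min (fine (mu [set b])) (cleared_psi mu a b x2)); first by rewrite lt_min m0.
move=> x /andP[x1x xx2]; have x0 := lt_le_trans x10 x1x.
have xa : x * a < 1 by apply: le_lt_trans x2a; rewrite ler_pM2r.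
have g0 : 0 <= bulk_part mu a x.
  have /andP[h _] := bulk_part_bounds mu a0 x0 xa; apply: le_trans h.
  by rewrite fine_ge0.
rewrite ge_min; have [bx|bx] := leP (b * x) 1; apply/orP; [left|right].
  by rewrite /cleared_psi lerDl mulr_ge0// subr_ge0.
rewrite /cleared_psi lerD2l.
have gg := bulk_part_le mu a0 x0 xx2 x2a.
have : (b * x - 1) * bulk_part mu a x <= (b * x2 - 1) * bulk_part mu a x2.
  by apply: ler_pM => //; [rewrite subr_ge0 ltW|rewrite lerB// ler_pM2l].
lra.
Qed.

Lemma gap_mass (R : realType) (mu : probability (measurableTypeR R) R) (a b : R) :
  gap_measure mu a b -> fine (mu `[0%R, a]%classic) = 1 - fine (mu [set b]).
Proof.
move=> [_ _ _ muab].
by apply/eqP; rewrite eq_sym subr_eq -fineD ?fin_num_measure// muab.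
Qed.

(** Let m be the mass of b and D the function [cleared_psi]. To the right of 1/b the
value exceeds 1. To the left, 1 - m is a lower bound of the bulk part, so the
numerator D - (1 - b x) is at least m b x. *)
Lemma real_K_bounds (R : realType) (mu : probability (measurableTypeR R) R) (a b x1 x2 : R) :
  gap_measure mu a b -> 0 < fine (mu [set b]) -> 0 < x1 -> x2 * a < 1 ->
  0 < cleared_psi mu a b x2 ->
  exists2 k0 : R, 0 < k0 & exists k1 : R,
    forall x, x1 <= x <= x2 -> k0 <= real_K mu a b x <= k1.
Proof.
move=> gm m0 x10 x2a D2; have [muD a0 ab muab] := gm.
have b0 : 0 < b by exact: lt_trans ab.
have [d0 d00 dD] := cleared_psi_lower a0 b0 m0 x10 x2a D2.
set m := fine (mu [set b]) in m0 *.
have dl0 : 0 < 1 - x2 * a by rewrite subr_gt0.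
have den0 : 0 < m + (1 - x2 * a)^-1 by rewrite addr_gt0// invr_gt0.
exists (Num.min 1 (m * b * x1 / (m + (1 - x2 * a)^-1))).
  by rewrite lt_min ltr01 divr_gt0// !mulr_gt0.
exists (1 + b * x2 / d0) => x /[dup] xx /andP[x1x xx2].
have x0 := lt_le_trans x10 x1x.
have x20 := lt_le_trans x0 xx2.
have xa : x * a < 1 by apply: le_lt_trans x2a; rewrite ler_pM2r.
have Dd := dD _ xx; have D0 := lt_le_trans d00 Dd.
have /andP[g1 g2] := bulk_part_bounds mu a0 x0 xa.
have g2' : bulk_part mu a x <= (1 - x2 * a)^-1.
  apply: (le_trans g2); rewrite lef_pV2 ?posrE// ?lerB ?ler_pM2r//.
  by rewrite subr_gt0.
have g0 : 0 <= bulk_part mu a x by apply: le_trans g1; rewrite fine_ge0.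
rewrite (gap_mass gm) -/m in g1.
have bx0 : 0 < b * x by rewrite mulr_gt0.
apply/andP; split.
  rewrite ge_min; have [bx|bx] := leP (b * x) 1; apply/orP; [right|left]; last first.
    rewrite /real_K lerDl oppr_ge0 mulr_le0_ge0 ?invr_ge0 ?(ltW D0)//.
    by rewrite subr_le0 ltW.
  have -> : real_K mu a b x = (cleared_psi mu a b x - (1 - b * x)) / cleared_psi mu a b x.
    by rewrite /real_K; field; rewrite gt_eqF.
  have Du : cleared_psi mu a b x <= m + (1 - x2 * a)^-1.
    rewrite /cleared_psi lerD2l; apply: le_trans g2'; rewrite ler_piMl//; lra.
  have num : m * b * x1 <= cleared_psi mu a b x - (1 - b * x).
    apply: (@le_trans _ _ (m * (b * x))).
      by rewrite -mulrA ler_pM2l// ler_pM2l.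
    rewrite /cleared_psi -/m.
    have : (1 - b * x) * (1 - m) <= (1 - b * x) * bulk_part mu a x.
      by rewrite ler_wpM2l// subr_ge0.
    lra.
  apply: ler_pM => //; first by rewrite !mulr_ge0// ltW.
    by rewrite invr_ge0 ltW.
  by rewrite lef_pV2 ?posrE.
rewrite /real_K lerD2l -mulNr opprB.
apply: (@le_trans _ _ (b * x / cleared_psi mu a b x)).
  by rewrite ler_pM2r ?invr_gt0//; lra.
apply: ler_pM; rewrite ?invr_ge0 ?(ltW D0) ?(ltW bx0)//.
  by rewrite ler_pM2l.
by rewrite lef_pV2 ?posrE.
Qed.

Lemma real_K_le1 (R : realType) (mu : probability (measurableTypeR R) R) (a b x : R) :
  0 < cleared_psi mu a b x -> b * x <= 1 -> real_K mu a b x <= 1.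
Proof.
by move=> D0 bx; rewrite /real_K gerBl divr_ge0 ?subr_ge0// ltW.
Qed.

Lemma bulk_part_continuous (R : realType) (mu : probability (measurableTypeR R) R) (a x : R) :
  0 < a -> 0 < x -> x * a < 1 -> bulk_part mu a t @[t --> x] --> bulk_part mu a x.
Proof.
move=> a0 x0 xa; pose xm := (x + a^-1) / 2.
have xai : x < a^-1 by rewrite -[a^-1]mul1r ltr_pdivlMr.
have xm1 : x < xm by rewrite /xm; lra.
have xma : xm * a < 1 by rewrite -ltr_pdivlMr// mul1r /xm; lra.
pose L := a / (1 - xm * a) ^+ 2.
have L0 : 0 <= L by rewrite divr_ge0 ?exprn_ge0 ?(ltW a0)// subr_ge0 ltW.
apply/cvgrPdist_lt => e e0.
near=> t.
have t0 : 0 < t by near: t; exact: lt_nbhsr.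
have tm : t <= xm by near: t; exact: lt_le_nbhsl.
apply: le_lt_trans (bulk_part_lipschitz mu a0 x0 (ltW xm1) t0 tm xma) _.
rewrite -/L; apply: (@le_lt_trans _ _ ((L + 1) * `|x - t|)).
  by rewrite ler_wpM2r// lerDl.
rewrite mulrC -ltr_pdivlMr; last by rewrite ltr_wpDl.
near: t; apply: cvgr_dist_lt; [exact: cvg_id|].
by rewrite divr_gt0// ltr_wpDl.
Unshelve. all: by end_near. Qed.

Lemma cleared_psi_continuous (R : realType) (mu : probability (measurableTypeR R) R) (a b x : R) :
  0 < a -> 0 < x -> x * a < 1 -> cleared_psi mu a b t @[t --> x] --> cleared_psi mu a b x.
Proof.
move=> a0 x0 xa; apply: cvgD; first exact: cvg_cst.
apply: cvgM; last exact: bulk_part_continuous.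
by apply: cvgB; [exact: cvg_cst|apply: cvgMr; exact: cvg_id].
Qed.

Lemma cleared_psi_le (R : realType) (mu : probability (measurableTypeR R) R) (a b x1 x2 : R) :
  0 < a -> 0 < b -> 0 < x1 -> x1 <= x2 -> x2 * a < 1 -> 1 <= b * x1 ->
  cleared_psi mu a b x2 <= cleared_psi mu a b x1.
Proof.
move=> a0 b0 x10 x12 x2a bx; rewrite /cleared_psi lerD2l.
have x1a : x1 * a < 1 by apply: le_lt_trans x2a; rewrite ler_pM2r.
have gg := bulk_part_le mu a0 x10 x12 x2a.
have g0 : 0 <= bulk_part mu a x1.
  have /andP[h _] := bulk_part_bounds mu a0 x10 x1a; apply: le_trans h.
  by rewrite fine_ge0.
have : (b * x1 - 1) * bulk_part mu a x1 <= (b * x2 - 1) * bulk_part mu a x2.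
  by apply: ler_pM => //; [rewrite subr_ge0|rewrite lerB// ler_pM2l].
lra.
Qed.

Lemma psi_gap_real (R : realType) (mu : probability (measurableTypeR R) R) (a b x : R) :
  gap_measure mu a b -> 0 < x -> x * a < 1 -> 1 - b * x != 0 ->
  complex.Re (psi mu x%:C) = cleared_psi mu a b x / (1 - b * x) - 1.
Proof.
move=> gm x0 xa bx; have := psi_gap gm x0 xa (lexx 0).
rewrite !mul0r mulr0 => h.
have /eqP : normc (1 + psi mu (x +i* 0) - (bulk_part mu a x)%:C -
         (fine (mu [set b]))%:C * ((kernel_re x 0 b + 1) +i* kernel_im x 0 b)) == 0.
  by rewrite eq_le h normc_ge0.
move/eqP; rewrite normc_eq0 => /eqP.
move/(congr1 (@complex.Re R)); rewrite -[x%:C]/(x +i* 0).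
case: (psi mu _) => p q; rewrite /real_complex_def; simpc => /= E.
have pE : kernel_re x 0 b + 1 = (1 - b * x)^-1.
  by rewrite /kernel_re /kernel_den mul0r expr0n /=; field.
move: E; rewrite pE /cleared_psi => E.
apply/eqP; rewrite -subr_eq0 -E; apply/eqP; field; exact: bx.
Qed.

(** If D = (1 - b x) (1 + psi x) stayed above dl, then 1 + psi would stay below
- dl / (b / a - 1), against the hypothesis on the limit at 1/a. *)
Lemma cleared_psi_small (R : realType) (mu : probability (measurableTypeR R) R) (a b dl : R) :
  gap_measure mu a b -> 0 < dl ->
  (exists2 l : \bar R,
       (complex.Re (psi mu x%:C))%:E @[x --> (a^-1 : R)^'-] --> l &
       (-1%:E <= l)%E) ->
  exists x, [/\ 1 < b * x, x * a < 1 & cleared_psi mu a b x < dl].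
Proof.
move=> gm dl0 [l lim l1]; have [_ a0 ab _] := gm.
have b0 := lt_trans a0 ab.
apply: contrapT => nex.
have {}nex x : 1 < b * x -> x * a < 1 -> dl <= cleared_psi mu a b x.
  by move=> h1 h2; rewrite leNgt; apply/negP => h3; apply: nex; exists x.
have q0 : 0 < b / a - 1 by rewrite subr_gt0 ltr_pdivlMr// mul1r.
pose c := dl / (b / a - 1); have c0 : 0 < c by rewrite divr_gt0.
have : (l <= (- 1 - c)%:E)%E.
  apply: cvge_le lim; near=> x; rewrite lee_fin.
  have xa : x < a^-1 by near: x; exact: nbhs_left_lt.
  have xb : b^-1 < x.
    by near: x; apply: nbhs_left_gt; rewrite ltf_pV2 ?posrE.
  have xa1 : x * a < 1 by rewrite -ltr_pdivlMr// mul1r.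
  have bx1 : 1 < b * x by rewrite mulrC -ltr_pdivrMr// mul1r.
  have x0 : 0 < x by apply: lt_trans xb; rewrite invr_gt0.
  rewrite (psi_gap_real gm)//; last by rewrite lt_eqF// subr_lt0.
  rewrite addrC lerD2l -lerN2 opprK -mulrN -invrN opprB.
  apply: ler_pM; rewrite ?invr_ge0 ?(ltW dl0) ?(ltW q0)//; first exact: nex.
  have q1 : 0 < b * x - 1 by rewrite subr_gt0.
  by rewrite lef_pV2 ?posrE// lerD2r ler_pM2l// ltW.
move=> /(le_trans l1); rewrite -EFinN lee_fin; lra.
Unshelve. all: by end_near. Qed.

Lemma cleared_psi_value (R : realType) (mu : probability (measurableTypeR R) R) (a b v : R) :
  gap_measure mu a b ->
  (exists2 l : \bar R,
       (complex.Re (psi mu x%:C))%:E @[x --> (a^-1 : R)^'-] --> l &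
       (-1%:E <= l)%E) ->
  0 < v -> v < fine (mu [set b]) ->
  exists x, [/\ 1 < b * x, x * a < 1 & cleared_psi mu a b x = v].
Proof.
move=> gm hpsi v0 vm; have [x' [bx' x'a Dx']] := cleared_psi_small gm v0 hpsi.
have [_ a0 ab _] := gm; have b0 := lt_trans a0 ab.
have bix : b^-1 <= x' by rewrite -[b^-1]mul1r ler_pdivrMr// mulrC ltW.
have Db : cleared_psi mu a b b^-1 = fine (mu [set b]).
  by rewrite /cleared_psi mulfV ?gt_eqF// subrr mul0r addr0.
have cont : {within `[b^-1, x'], continuous (cleared_psi mu a b)}.
  apply: continuous_in_subspaceT => x; rewrite inE /= in_itv /= => /andP[l u].
  apply: cleared_psi_continuous => //; first by apply: lt_le_trans l; rewrite invr_gt0.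
  by apply: le_lt_trans x'a; rewrite ler_pM2r.
have [|x xi Dx] := IVT (v := v) bix cont.
  by rewrite Db ge_min le_max (ltW vm) (ltW Dx') orbT.
move: xi; rewrite in_itv /= => /andP[l u].
exists x; split => //; last by apply: le_lt_trans x'a; rewrite ler_pM2r.
rewrite lt_neqAle; apply/andP; split; last by rewrite mulrC -ler_pdivrMr// mul1r.
apply/eqP => E; move: vm; rewrite -Dx -Db (_ : x = b^-1) ?ltxx//.
by apply: (mulfI (lt0r_neq0 b0)); rewrite -E mulfV// gt_eqF.
Qed.

(** The function D = (1 - b x) (1 + psi x) takes all small positive values to the
right of the point xm where it is half the mass of b, and there b x - 1 is
bounded away from 0 while K = 1 + (b x - 1) / D. *)
Lemma real_K_unbounded (R : realType) (mu : probability (measurableTypeR R) R) (a b M : R) :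
  gap_measure mu a b -> 0 < fine (mu [set b]) ->
  (exists2 l : \bar R,
       (complex.Re (psi mu x%:C))%:E @[x --> (a^-1 : R)^'-] --> l &
       (-1%:E <= l)%E) ->
  exists x, [/\ 1 < b * x, x * a < 1, 0 < cleared_psi mu a b x & M < x * real_K mu a b x].
Proof.
move=> gm m0 hpsi; have [_ a0 ab _] := gm; have b0 := lt_trans a0 ab.
set m := fine (mu [set b]) in m0.
have [||xm [bxm xma Dxm]] := cleared_psi_value (v := m / 2) gm hpsi; rewrite -/m; [lra|lra|].
pose eta := b * xm - 1; have eta0 : 0 < eta by rewrite subr_gt0.
(* v below m / 2 puts x to the right of xm; the other bound makes
   x (b x - 1) / v exceed M *)
pose v := Num.min (m / 4) (eta / (b * (`|M| + 1))).
have M1 : 0 < b * (`|M| + 1) by rewrite mulr_gt0// ltr_wpDl.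
have v0 : 0 < v by rewrite lt_min !divr_gt0.
have [v1 v2] : v <= m / 4 /\ v <= eta / (b * (`|M| + 1)).
  by rewrite /v !ge_min !lexx orbT.
have [||x [bx xa Dx]] := cleared_psi_value (v := v) gm hpsi; rewrite -/m //; first lra.
have x0 : 0 < x by rewrite -(@pmulr_rgt0 _ b)// (lt_trans ltr01).
exists x; split; rewrite ?Dx//.
have xmx : xm <= x.
  rewrite leNgt; apply/negP => /ltW xxm.
  by have := cleared_psi_le mu a0 b0 x0 xxm xma (ltW bx); lra.
have h1 : eta <= b * x - 1 by rewrite lerB// ler_pM2l.
have h2 : b * (`|M| + 1) <= (b * x - 1) / v.
  rewrite ler_pdivlMr//; apply: le_trans h1.
  by rewrite mulrC -ler_pdivlMr.
have h3 : real_K mu a b x = 1 + (b * x - 1) / v by rewrite /real_K Dx; ring.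
rewrite h3; have : x * (b * (`|M| + 1)) <= x * ((b * x - 1) / v) by rewrite ler_pM2l.
have : 1 * (`|M| + 1) <= (b * x) * (`|M| + 1).
  by rewrite ler_wpM2r ?addr_ge0// ltW.
have := ler_norm M; lra.
Qed.

(** * Boundary values of the subordination functions *)

(** If two arguments in ]0, pi[ add up to an angle in ]0, pi/2[, then each of
them is smaller than that angle, and so are their sines. *)
Lemma angle_le (R : realType) (w1 w2 : R[i]) :
  upper_half w1 -> upper_half w2 ->
  0 < complex.Re (w1 * w2) -> 0 < complex.Im (w1 * w2) ->
  0 < complex.Re w1 /\
  complex.Im w1 * normc (w1 * w2) <= normc w1 * complex.Im (w1 * w2).
Proof.
case: w1 w2 => [a p] [c q]; rewrite /upper_half /= => p0 q0 re im.
have pq : 0 < p * q by rewrite mulr_gt0.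
have a0 : 0 < a.
  rewrite ltNge; apply/negP => a0.
  have c0 : c < 0.
    rewrite ltNge; apply/negP => c0.
    have : a * c <= 0 by rewrite mulr_le0_ge0.
    lra.
  have : a * q <= 0 by rewrite mulr_le0_ge0// ltW.
  have : p * c <= 0 by rewrite mulr_ge0_le0 ?ltW.
  lra.
split=> //.
rewrite -(@ler_pXn2r _ 2) ?nnegrE ?mulr_ge0 ?sqrtr_ge0 ?(ltW p0) ?(ltW im)//.
rewrite !exprMn !sqr_sqrtr ?addr_ge0 ?sqr_ge0//.
rewrite -subr_ge0.
(* |w1|^2 factors out; the other factor uses a c > p q > 0 *)
have -> : (a ^+ 2 + p ^+ 2) * (a * q + p * c) ^+ 2 -
   p ^+ 2 * ((a * c - p * q) ^+ 2 + (a * q + p * c) ^+ 2)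
  = (a ^+ 2 + p ^+ 2) *
    ((a * q) ^+ 2 + 2 * (p * q) * (a * c - p * q) + (p * q) ^+ 2) by ring.
by rewrite mulr_ge0 ?addr_ge0 ?sqr_ge0// mulr_ge0 ?mulr_ge0 ?ltW.
Qed.

(** The argument of z K z is O(y), and it is the sum of the arguments of Z1 and
Z2, which are both positive. *)
Lemma Im_le_near_real (R : realType) (Z1 Z2 K : R[i] -> R[i]) (kp : R -> R)
    (x1 x2 k0 k1 y0 C : R) :
  (forall z, upper_half z ->
     [/\ upper_half (Z1 z), upper_half (Z2 z), 0 < complex.Im (K z) & Z1 z * Z2 z = z * K z]) ->
  0 < x1 -> 0 < k0 -> 0 < y0 -> 0 <= C ->
  (forall x, x1 <= x <= x2 -> k0 <= kp x <= k1) ->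
  (forall x y, x1 <= x <= x2 -> 0 < y -> y <= y0 ->
     normc (K (x +i* y) - (kp x)%:C) <= C * y) ->
  exists2 y1 : R, 0 < y1 & exists2 L : R, 0 <= L &
    forall x y, x1 <= x <= x2 -> 0 < y -> y <= y1 ->
      0 < complex.Re (Z1 (x +i* y)) /\
      complex.Im (Z1 (x +i* y)) <= L * y * normc (Z1 (x +i* y)).
Proof.
move=> HZ x10 k00 y00 C0 kb Kb.
have [x21|x12] := ltP x2 x1.
  exists 1 => //; exists 0 => // x y /andP[l u].
  by have := le_lt_trans (le_trans l u) x21; rewrite ltxx.
have x20 : 0 < x2 by exact: lt_le_trans x12.
have k10 : 0 < k1.
  by have /andP[? ?] := kb x1 (introT andP (conj (lexx _) x12)); lra.
pose C' := k1 + (x2 + 1) * C.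
have C'0 : 0 < C' by rewrite ltr_pwDl// mulr_ge0// addr_ge0// ltW.
have p0 : 0 < x1 * k0 by rewrite mulr_gt0.
exists (Num.min (Num.min y0 1) (Num.min (x1 * k0 / 2 / C') (k0 / 2 / (C + 1)))).
  by rewrite !lt_min y00 ltr01 !divr_gt0// ltr_wpDl.
exists (2 * C' / (x1 * k0)); first by rewrite divr_ge0 ?mulr_ge0 ?ltW.
move=> x y xx yp; rewrite !le_min => /andP[/andP[yy0 y1] /andP[yC yk]].
have [xl xu] : x1 <= x /\ x <= x2 by move/andP: xx.
have x0 : 0 < x by exact: lt_le_trans xl.
have C1 : 0 < C + 1 by rewrite ltr_wpDl.
move: yC yk; rewrite (ler_pdivlMr _ _ C'0) (ler_pdivlMr _ _ C1) => yC yk.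
set z := x +i* y; have z0 : upper_half z by exact: yp.
have [Z10 Z20 K0 E] := HZ z z0.
have /andP[kk0 kk1] := kb _ xx; have Kz := Kb _ _ xx yp yy0; rewrite -/z in Kz.
have kp0 : 0 < kp x by exact: lt_le_trans kk0.
have Pd : normc (z * K z - (x * kp x)%:C) <= C' * y.
  have -> : z * K z - (x * kp x)%:C = (0 +i* y) * (kp x)%:C + z * (K z - (kp x)%:C).
    have -> : (x * kp x)%:C = x%:C * (kp x)%:C by rewrite rmorphM.
    have -> : x%:C = z - 0 +i* y by rewrite /z /real_complex_def; simpc; rewrite ?subr0 ?subrr.
    by ring.
  have -> : C' * y = y * k1 + (x2 + 1) * (C * y) by rewrite /C'; ring.
  apply: normc_leD; apply: normc_leM => //.
  - by rewrite /= expr0n/= add0r sqrtr_sqr gtr0_norm.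
  - by rewrite normc_real gtr0_norm.
  - by rewrite (le_trans (normc_ReIm _))//= (gtr0_norm x0) (gtr0_norm yp) lerD.
have xk : x1 * k0 <= x * kp x by apply: ler_pM => //; exact: ltW.
have ReP : x1 * k0 / 2 <= complex.Re (z * K z).
  have := le_trans (normc_Re _) Pd; rewrite ler_norml => /andP[+ _].
  by case: (z * K z) => u v; rewrite /real_complex_def; simpc => /=; lra.
have ImP : complex.Im (z * K z) <= C' * y.
  have := le_trans (normc_Im _) Pd; rewrite ler_norml => /andP[_].
  by case: (z * K z) => u v; rewrite /real_complex_def; simpc => /=; rewrite ?subr0.
have ReK : 0 < complex.Re (K z).
  have := le_trans (normc_Re _) Kz; rewrite ler_norml => /andP[+ _].
  by case: (K z) => u v; rewrite /real_complex_def; simpc => /=; lra.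
have ImP0 : 0 < complex.Im (z * K z).
  move: ReK K0; rewrite /z; case: (K z) => u v /= u0 v0.
  by rewrite addr_gt0// mulr_gt0.
have nP : x1 * k0 / 2 <= normc (z * K z).
  by apply: (le_trans ReP); apply: le_trans (normc_Re _); exact: ler_norm.
have [||r1 r2] := angle_le Z10 Z20; rewrite ?E//.
  by apply: lt_le_trans ReP; rewrite divr_gt0.
split=> //; rewrite E in r2.
have h1 : complex.Im (Z1 z) * (x1 * k0 / 2) <= complex.Im (Z1 z) * normc (z * K z).
  by rewrite ler_pM2l.
have h2 : normc (Z1 z) * complex.Im (z * K z) <= normc (Z1 z) * (C' * y).
  by rewrite ler_wpM2l ?normc_ge0.
rewrite (_ : _ * normc _ = normc (Z1 z) * (C' * y) / (x1 * k0 / 2)); last first.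
  by field; rewrite !gt_eqF.
by rewrite ler_pdivlMr ?divr_gt0//; lra.
Qed.

(** Expanding the square gives A^2 <= (2 + d2) A B. *)
Lemma ratio_bound (R : realType) (A B d2 : R) : 0 <= A -> 0 <= B -> 0 <= d2 ->
  (A - B) ^+ 2 <= d2 * (A * B) -> A <= (2 + d2) * B.
Proof.
move=> A0 B0 d0 h; have [->|Ane] := eqVneq A 0.
  by rewrite mulr_ge0// addr_ge0.
have Ap : 0 < A by rewrite lt_def Ane.
rewrite -(ler_pM2l Ap); have := sqr_ge0 B; rewrite !expr2 in h *; nra.
Qed.

(** Schwarz-Pick and the bound on Im f give
|f w - f z|^2 <= L^2 |w - z|^2 |f w| |f z|. This bounds the ratio |f w| / |f z|
over the rectangle, hence |f| itself, and then it is a Lipschitz bound. *)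
Lemma schwarz_pick_lipschitz (R : realType) (f : R[i] -> R[i]) (x1 x2 y1 L : R) :
  (forall z, upper_half z -> analytic_at f z /\ 0 < complex.Im (f z)) ->
  x1 <= x2 -> 0 < y1 -> 0 <= L ->
  (forall x y, x1 <= x <= x2 -> 0 < y -> y <= y1 ->
    complex.Im (f (x +i* y)) <= L * y * normc (f (x +i* y))) ->
  exists2 M : R, 0 < M & forall x y x' y', x1 <= x <= x2 -> 0 < y -> y <= y1 ->
    x1 <= x' <= x2 -> 0 < y' -> y' <= y1 ->
    [/\ normc (f (x +i* y)) <= M, M^-1 <= normc (f (x +i* y)) &
      normc (f (x +i* y) - f (x' +i* y')) <= M * normc ((x +i* y) - (x' +i* y'))].
Proof.
move=> Hf x12 y10 L0 HL.
pose Q z := x1 <= complex.Re z <= x2 /\ 0 < complex.Im z <= y1.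
have f0 z : Q z -> 0 < normc (f z).
  move=> [_ /andP[z0 _]]; have [_ fz] := Hf z z0.
  by apply: lt_le_trans (normc_Im _); rewrite gtr0_norm.
have SP z w : Q z -> Q w ->
    normc (f w - f z) ^+ 2 <= L ^+ 2 * normc (w - z) ^+ 2 * (normc (f w) * normc (f z)).
  move=> Qz Qw; have [xz /andP[z0 zy]] := Qz; have [xw /andP[w0 wy]] := Qw.
  have := schwarz_pick Hf z0 w0.
  have hz : complex.Im (f z) <= L * complex.Im z * normc (f z).
    by move: xz z0 zy; case: (z) => ? ? /=; exact: HL.
  have hw : complex.Im (f w) <= L * complex.Im w * normc (f w).
    by move: xw w0 wy; case: (w) => ? ? /=; exact: HL.
  have [_ fz] := Hf z z0; have [_ fw] := Hf w w0.
  have zw : 0 < complex.Im w * complex.Im z by rewrite mulr_gt0.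
  have := ler_pM (ltW fw) (ltW fz) hw hz.
  move=> h1 h2; rewrite -(ler_pM2r zw); apply: (le_trans h2).
  apply: (@le_trans _ _ (normc (w - z) ^+ 2 *
     (L * complex.Im w * normc (f w) * (L * complex.Im z * normc (f z))))).
    by rewrite ler_wpM2l ?sqr_ge0.
  by rewrite le_eqVlt; apply/orP; left; apply/eqP; ring.
pose dd := (x2 - x1) + y1; have dd0 : 0 <= dd by rewrite addr_ge0 ?subr_ge0// ltW.
have diam z w : Q z -> Q w -> normc (w - z) <= dd.
  move=> Qz Qw; rewrite (le_trans (normc_ReIm _))// /dd.
  case: z w Qz Qw => [p q] [r t] [/= /andP[? ?] /andP[? ?]] [/= /andP[? ?] /andP[? ?]].
  by apply: lerD; rewrite ler_norml; lra.
pose d2 := L ^+ 2 * dd ^+ 2.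
have d20 : 0 <= d2 by rewrite mulr_ge0 ?sqr_ge0.
have rat z w : Q z -> Q w -> normc (f w) <= (2 + d2) * normc (f z).
  move=> Qz Qw; apply: ratio_bound; rewrite ?normc_ge0//.
  apply: (@le_trans _ _ (normc (f w - f z) ^+ 2)).
    have := le_normcB (f w) (f z); have := le_normcB (f z) (f w); rewrite (normcB (f z)).
    move=> h1 h2; rewrite -[X in X <= _]real_normK ?num_real//.
    by rewrite ler_pXn2r ?nnegrE ?normc_ge0// ler_norml; lra.
  apply: (le_trans (SP _ _ Qz Qw)).
  rewrite ler_wpM2r ?mulr_ge0 ?normc_ge0// ler_wpM2l ?sqr_ge0//.
  by rewrite ler_pXn2r ?nnegrE ?normc_ge0//; exact: diam.
(* all values of |f| are compared with the one at the corner zs *)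
pose zs := x1 +i* y1.
have Qs : Q zs by rewrite /Q /= lexx x12 y10 lexx.
have fs0 := f0 _ Qs.
pose M0 := (2 + d2) * (normc (f zs) + (normc (f zs))^-1).
have d2p : 0 < 2 + d2 by rewrite ltr_pwDl.
have M00 : 0 < M0 by rewrite mulr_gt0// addr_gt0// invr_gt0.
exists (M0 * (1 + L)); first by rewrite mulr_gt0// ltr_pwDl.
move=> x y x' y' xx yp yy xx' yp' yy'.
set z := x +i* y; set z' := x' +i* y'.
have Qz : Q z by rewrite /Q /= xx yp.
have Qz' : Q z' by rewrite /Q /= xx' yp'.
have up w : Q w -> normc (f w) <= M0.
  move=> Qw; apply: (le_trans (rat _ _ Qs Qw)); rewrite ler_pM2l// lerDl.
  by rewrite invr_ge0 ltW.
have lo w : Q w -> M0^-1 <= normc (f w).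
  move=> Qw; rewrite -(ler_pM2l M00) mulfV ?gt_eqF//.
  have := rat _ _ Qw Qs; have fw0 := f0 _ Qw => h.
  apply: (@le_trans _ _ ((2 + d2) * (normc (f zs))^-1 * normc (f w))).
    rewrite -(ler_pM2r fs0) mul1r [leRHS](_ : _ = (2 + d2) * normc (f w))//.
    by field; rewrite gt_eqF.
  by rewrite ler_pM2r// ler_pM2l// lerDr ltW.
have M0L : M0 <= M0 * (1 + L) by rewrite -{1}[M0]mulr1 (ler_pM2l M00) lerDl.
have ML0 : 0 < M0 * (1 + L) by exact: lt_le_trans M0L.
split.
- exact: le_trans (up _ Qz) M0L.
- by apply: le_trans (lo _ Qz); rewrite lef_pV2.
- have Y0 : 0 <= M0 * (1 + L) * normc (z - z').
    apply: mulr_ge0; last exact: normc_ge0.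
    by apply: mulr_ge0; [exact: ltW|exact: addr_ge0].
  rewrite -(@ler_pXn2r _ 2)// ?nnegrE ?normc_ge0//.
  apply: (le_trans (SP _ _ Qz' Qz)); rewrite (exprMn _ (M0 * (1 + L))) (exprMn _ M0).
  rewrite [leLHS]mulrAC ler_wpM2r ?sqr_ge0//.
  rewrite [leLHS]mulrC; apply: ler_pM; rewrite ?mulr_ge0 ?sqr_ge0 ?normc_ge0//.
    by rewrite [leRHS]expr2; apply: ler_pM; rewrite ?normc_ge0//; exact: up.
  by rewrite ler_pXn2r ?nnegrE ?addr_ge0// lerDr.
Qed.

(** Vertical convergence at a linear rate, which makes products and sums of
boundary values immediate. *)
Definition boundary_value (R : realType) (f : R[i] -> R[i]) (x s : R) :=
  exists L : R, exists2 y1 : R, 0 < y1 &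
    forall y, 0 < y -> y <= y1 -> normc (f (x +i* y) - s%:C) <= L * y.

Definition boundary_fun (R : realType) (f : R[i] -> R[i]) (x : R) : R :=
  xget 0 (boundary_value f x).

Lemma le_small (R : realType) (u v L y1 : R) : 0 < y1 ->
  (forall y, 0 < y -> y <= y1 -> u <= v + L * y) -> u <= v.
Proof.
move=> y10 H; rewrite leNgt; apply/negP => vu.
pose y := Num.min y1 ((u - v) / 2 / (`|L| + 1)).
have L1 : 0 < `|L| + 1 by rewrite ltr_wpDl.
have y0 : 0 < y by rewrite lt_min y10 !divr_gt0// subr_gt0.
have [yy1 yy2] : y <= y1 /\ y <= (u - v) / 2 / (`|L| + 1).
  by rewrite /y !ge_min !lexx orbT.
have := H y y0 yy1; move: yy2; rewrite ler_pdivlMr// => h.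
have : L * y <= `|L| * y by rewrite ler_pM2r// ler_norm.
nra.
Qed.

Lemma boundary_value_uniq (R : realType) (f : R[i] -> R[i]) (x s s' : R) :
  boundary_value f x s -> boundary_value f x s' -> s = s'.
Proof.
move=> [L [y1 y10 H]] [L' [y2 y20 H']]; apply/eqP; rewrite -subr_eq0 -normr_eq0.
rewrite eq_le normr_ge0 andbT.
apply: (@le_small _ _ _ (L + L') (Num.min y1 y2)); first by rewrite lt_min y10.
move=> y y0; rewrite le_min => /andP[/(H _ y0) h1 /(H' _ y0) h2].
rewrite add0r -normc_real.
have -> : (s - s')%:C = - (f (x +i* y) - s%:C) + (f (x +i* y) - s'%:C).
  by rewrite rmorphB; ring.
by rewrite mulrDl; apply: normc_leD => //; exact: normc_leN.
Qed.

Lemma boundary_funE (R : realType) (f : R[i] -> R[i]) (x s : R) :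
  boundary_value f x s -> boundary_fun f x = s.
Proof.
move=> bs; apply: (boundary_value_uniq _ bs); rewrite /boundary_fun.
by case: xgetP => [y _ //|/(_ s)/(_ bs)].
Qed.

(** g y - L y is nonincreasing, so its supremum is its limit at 0. *)
Lemma lipschitz_limit (R : realType) (g : R -> R) (y1 L : R) : 0 < y1 -> 0 <= L ->
  (forall y y', 0 < y -> y <= y1 -> 0 < y' -> y' <= y1 -> `|g y - g y'| <= L * `|y - y'|) ->
  exists s, forall y, 0 < y -> y <= y1 -> `|g y - s| <= L * y.
Proof.
move=> y10 L0 H.
pose E := [set g y - L * y | y in [set y | 0 < y /\ y <= y1]].
have ubE y : 0 < y -> y <= y1 -> ubound E (g y + L * y).
  move=> y0 yy _ [t /= [t0 tt] <-].
  have := H t y t0 tt y0 yy; rewrite ler_norml => /andP[_].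
  have : `|t - y| <= t + y by rewrite ler_norml; lra.
  move=> /(ler_wpM2l L0); lra.
have E0 : E (g y1 - L * y1) by exists y1.
have supE : has_sup E by split; [exists (g y1 - L * y1)|exists (g y1 + L * y1); exact: ubE].
exists (sup E) => y y0 yy; rewrite ler_distlC; apply/andP; split.
  by apply: ub_le_sup; [case: supE|exists y].
by apply: ge_sup; [case: supE|exact: ubE].
Qed.

Definition regular_boundary (R : realType) (f : R[i] -> R[i]) (x1 x2 : R) :=
  exists y1 L m : R, [/\ 0 < y1, 0 <= L & 0 < m] /\
   [/\ forall x, x1 <= x <= x2 -> m <= boundary_fun f x,
     forall x y, x1 <= x <= x2 -> 0 < y -> y <= y1 ->
       normc (f (x +i* y) - (boundary_fun f x)%:C) <= L * y &
     forall x x', x1 <= x <= x2 -> x1 <= x' <= x2 ->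
       `|boundary_fun f x - boundary_fun f x'| <= L * `|x - x'|].

Lemma regular_boundaryP (R : realType) (f : R[i] -> R[i]) (x1 x2 y1 L M : R) :
  0 < y1 -> 0 <= L -> 0 < M ->
  (forall x y, x1 <= x <= x2 -> 0 < y -> y <= y1 ->
     0 < complex.Re (f (x +i* y)) /\
     `|complex.Im (f (x +i* y))| <= L * y * normc (f (x +i* y))) ->
  (forall x y x' y', x1 <= x <= x2 -> 0 < y -> y <= y1 ->
    x1 <= x' <= x2 -> 0 < y' -> y' <= y1 ->
    [/\ normc (f (x +i* y)) <= M, M^-1 <= normc (f (x +i* y)) &
      normc (f (x +i* y) - f (x' +i* y')) <= M * normc ((x +i* y) - (x' +i* y'))]) ->
  regular_boundary f x1 x2.
Proof.
move=> y10 L0 M0 HI HM.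
pose L' := M + L * M.
have LM0 : 0 <= L * M by rewrite mulr_ge0// ltW.
have ML' : M <= L' by rewrite lerDl.
have L'0 : 0 <= L' by rewrite addr_ge0// ltW.
have key x : x1 <= x <= x2 -> exists s, forall y, 0 < y -> y <= y1 ->
    normc (f (x +i* y) - s%:C) <= L' * y.
  move=> xx.
  have [|s Hs] := @lipschitz_limit _ (fun y => complex.Re (f (x +i* y))) y1 M y10 (ltW M0).
    move=> y y' y0 yy y'0 yy'; have [_ _] := HM x y x y' xx y0 yy xx y'0 yy'.
    have -> : (x +i* y) - (x +i* y') = 0 +i* (y - y') by simpc; rewrite ?subrr.
    rewrite [X in _ <= M * X](_ : _ = `|y - y'|); last first.
      by rewrite /= expr0n/= add0r sqrtr_sqr.
    apply: le_trans; apply: le_trans (normc_Re _).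
    by case: (f _) => ? ?; case: (f _).
  exists s => y y0 yy; rewrite (le_trans (normc_ReIm _))// /L' mulrDl.
  have [_ h1] := HI _ _ xx y0 yy; have [h2 _ _] := HM x y x y xx y0 yy xx y0 yy.
  have := Hs y y0 yy; move: h1 h2; case: (f (x +i* y)) => u v.
  rewrite /real_complex_def; simpc => h1 h2 h3; rewrite ?subr0; apply: lerD => //.
  apply: (le_trans h1); rewrite [leLHS]mulrAC ler_wpM2r ?(ltW y0)//.
  by rewrite ler_wpM2l.
have zk x y : x1 <= x <= x2 -> 0 < y -> y <= y1 ->
    normc (f (x +i* y) - (boundary_fun f x)%:C) <= L' * y.
  move=> xx y0 yy; have [s Hs] := key x xx.
  rewrite (@boundary_funE _ _ _ s); first exact: Hs.
  by exists L', y1.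
exists y1, L', M^-1; split; first by rewrite invr_gt0.
split=> //.
- move=> x xx.
  have z0 : 0 <= boundary_fun f x.
    apply: (@le_small _ _ _ L' y1) => // y y0 yy.
    have [r0 _] := HI _ _ xx y0 yy.
    have := le_trans (normc_Re _) (zk _ _ xx y0 yy); rewrite ler_norml => /andP[_].
    by move: r0; case: (f _) => u v /=; lra.
  apply: (@le_small _ _ _ L' y1) => // y y0 yy.
  have [_ h _] := HM x y x y xx y0 yy xx y0 yy.
  have := le_normcB (f (x +i* y)) (boundary_fun f x)%:C; rewrite normc_real ger0_norm//.
  have := zk _ _ xx y0 yy; lra.
- move=> x x' xx xx'; apply: (@le_small _ _ _ (L' + L') y1) => // y y0 yy.
  have [_ _] := HM x y x' y xx y0 yy xx' y0 yy.
  have -> : (x +i* y) - (x' +i* y) = (x - x')%:C.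
    by rewrite /real_complex_def; simpc; rewrite ?subrr.
  rewrite normc_real => h1.
  rewrite -normc_real.
  have -> : (boundary_fun f x - boundary_fun f x')%:C = (f (x +i* y) - f (x' +i* y))
     + (- (f (x +i* y) - (boundary_fun f x)%:C) + (f (x' +i* y) - (boundary_fun f x')%:C)).
    by rewrite rmorphB; ring.
  apply: normc_leD; first by apply: (le_trans h1); rewrite ler_wpM2r.
  by rewrite mulrDl; apply: normc_leD; [apply: normc_leN|]; exact: zk.
Qed.

Lemma boundary_value_bounded (R : realType) (f : R[i] -> R[i]) (x s : R) :
  boundary_value f x s -> exists M : R, exists2 y1 : R, 0 < y1 &
    forall y, 0 < y -> y <= y1 -> normc (f (x +i* y)) <= M.
Proof.
move=> [L [y1 y10 H]]; exists (`|L| * y1 + `|s|), y1 => // y y0 yy.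
rewrite -[f _](subrK s%:C); apply: normc_leD; last by rewrite normc_real.
apply: (le_trans (H _ y0 yy)); apply: (@le_trans _ _ (`|L| * y)).
  by rewrite ler_pM2r// ler_norm.
by rewrite ler_wpM2l.
Qed.

Lemma boundary_valueM (R : realType) (f g : R[i] -> R[i]) (x s t : R) :
  boundary_value f x s -> boundary_value g x t ->
  boundary_value (fun z => f z * g z) x (s * t).
Proof.
move=> bf [L' [y2 y20 H']]; have [M [y3 y30 HM]] := boundary_value_bounded bf.
move: bf => [L [y1 y10 H]].
exists (M * L' + `|t| * L), (Num.min y1 (Num.min y2 y3)); first by rewrite !lt_min y10 y20.
move=> y y0; rewrite !le_min => /and3P[yy1 yy2 yy3].
rewrite rmorphM /=.
have -> : f (x +i* y) * g (x +i* y) - s%:C * t%:C =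
  f (x +i* y) * (g (x +i* y) - t%:C) + t%:C * (f (x +i* y) - s%:C) by ring.
rewrite mulrDl -!mulrA; apply: normc_leD; apply: normc_leM.
- exact: HM.
- exact: H'.
- by rewrite normc_real.
- exact: H.
Qed.

Lemma boundary_valueD (R : realType) (f g : R[i] -> R[i]) (x s t : R) :
  boundary_value f x s -> boundary_value g x t ->
  boundary_value (fun z => f z + g z) x (s + t).
Proof.
move=> [L [y1 y10 H]] [L' [y2 y20 H']].
exists (L + L'), (Num.min y1 y2); first by rewrite lt_min y10.
move=> y y0; rewrite le_min => /andP[yy1 yy2].
rewrite rmorphD /= opprD addrACA mulrDl; apply: normc_leD; [exact: H|exact: H'].
Qed.

Lemma boundary_value_cst (R : realType) (c x : R) : boundary_value (fun=> c%:C) x c.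
Proof.
by exists 0, 1 => // y _ _; rewrite subrr Normc.normc0 mul0r.
Qed.

Lemma boundary_value_id (R : realType) (x : R) : boundary_value id x x.
Proof.
exists 1, 1 => // y y0 _; rewrite mul1r.
have -> : (x +i* y) - x%:C = 0 +i* y by rewrite /real_complex_def; simpc; rewrite ?subrr.
by rewrite /= expr0n/= add0r sqrtr_sqr gtr0_norm.
Qed.

Lemma boundary_value_ext (R : realType) (f g : R[i] -> R[i]) (x s : R) :
  (forall z, upper_half z -> f z = g z) -> boundary_value f x s -> boundary_value g x s.
Proof.
move=> fg [L [y1 y10 H]]; exists L, y1 => // y y0 yy.
by rewrite -fg; [exact: H|exact: y0].
Qed.

Lemma regular_boundary_value (R : realType) (f : R[i] -> R[i]) (x1 x2 x : R) :
  regular_boundary f x1 x2 -> x1 <= x <= x2 -> boundary_value f x (boundary_fun f x).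
Proof.
move=> [y1 [L [m [[y10 _ _] [_ H _]]]]] xx; exists L, y1 => // y y0 yy.
exact: H.
Qed.

(** * Null intervals *)

(** Let ts be the supremum of the t such that [c, t] has mass at most
k (t - c) + k^2; the k^2 absorbs a possible atom at c. The interval of
radius h around ts pushes this bound to ts + h at no extra cost, so ts + h is
beyond d. Then k tends to 0. *)
Lemma null_closed_interval (R : realType) (nu : probability (measurableTypeR R) R) (c d : R) :
  c <= d ->
  (forall t k : R, c <= t <= d -> 0 < k ->
     exists h : R, [/\ 0 < h, h < k & fine (nu `[t - h, t + h]%classic) <= k * h]) ->
  nu `[c, d]%classic = 0%E.
Proof.
move=> cd H.
have mono (A B : set (measurableTypeR R)) : measurable A -> measurable B -> A `<=` B ->
    fine (nu A) <= fine (nu B).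
  move=> mA mB AB; rewrite fine_le ?fin_num_measure//.
  by apply: le_measure; rewrite ?inE.
have sub (A B C : set (measurableTypeR R)) : measurable A -> measurable B -> measurable C ->
    C `<=` A `|` B -> fine (nu C) <= fine (nu A) + fine (nu B).
  move=> mA mB mC CAB; rewrite -fineD ?fin_num_measure//.
  rewrite fine_le ?fin_num_measure ?fin_numD ?fin_num_measure//.
  apply: le_trans (measureU2 _ mA mB); apply: le_measure; rewrite ?inE//.
  exact: measurableU.
suff key k : 0 < k -> fine (nu `[c, d]%classic) <= k * (d - c) + 2 * k ^+ 2.
  have z : fine (nu `[c, d]%classic) <= 0.
    rewrite leNgt; apply/negP => p0.
    pose p := fine (nu `[c, d]%classic); rewrite -/p in p0 key.
    pose k := Num.min 1 (p / (2 * (d - c + 2))).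
    have e0 : 0 < 2 * (d - c + 2) by lra.
    have k0 : 0 < k by rewrite lt_min ltr01 divr_gt0.
    have [k1 k2] : k <= 1 /\ k <= p / (2 * (d - c + 2)).
      by rewrite /k !ge_min !lexx orbT.
    move: k2; rewrite ler_pdivlMr// => k2; have := key k k0; nra.
  rewrite -[LHS]fineK ?fin_num_measure//; congr EFin.
  by apply/eqP; rewrite eq_le z fine_ge0.
move=> k0.
pose A := [set t | c <= t <= d /\ fine (nu `[c, t]%classic) <= k * (t - c) + k ^+ 2].
have Ac : A c.
  split; first by rewrite lexx.
  have [|h [h0 hk hm]] := H c k _ k0; first by rewrite lexx.
  apply: le_trans (mono _ _ _ _ _) (le_trans hm _) => //.
    move=> x; rewrite /= !in_itv /= => /andP[? ?]; apply/andP; split; lra.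
  by rewrite subrr mulr0 add0r expr2 ler_pM2l// ltW.
have supA : has_sup A.
  by split; [exists c|exists d => t [/andP[]]].
pose ts := sup A.
have cts : c <= ts by apply: ub_le_sup => //; case: supA.
have tsd : ts <= d by apply: ge_sup; [exists c|move=> t [/andP[]]].
have [|h [h0 hk hm]] := H ts k _ k0; first by rewrite cts.
have [t' [/andP[ct' t'd] mt'] tt'] := sup_adherent h0 supA.
have t'ts : t' <= ts by apply: ub_le_sup; [case: supA|split; rewrite ?ct'].
have main e : e <= ts + h -> fine (nu `[c, e]%classic) <= k * (t' - c) + k ^+ 2 + k * h.
  move=> ets.
  apply: le_trans (sub `[c, t']%classic `[ts - h, ts + h]%classic _ _ _ _ _)
    (lerD mt' hm) => //.
  move=> x; rewrite /= !in_itv /= => /andP[cx xe].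
  have [xt|tx] := leP x t'; [left|right]; rewrite ?cx//.
  by apply/andP; split; [move: tt'; rewrite -/ts; lra|lra].
have kk : k * (t' - c) <= k * (ts - c) by rewrite ler_pM2l// lerB.
have [dh|dh] := leP (ts + h) d.
  have /(ub_le_sup (proj2 supA)) : A (ts + h).
    split; first by apply/andP; split; lra.
    apply: le_trans (main _ (lexx _)) _; lra.
  rewrite -/ts; lra.
apply: le_trans (main _ (ltW dh)) _.
have : k * (ts - c) <= k * (d - c) by rewrite ler_pM2l// lerB.
have : k * h <= k ^+ 2 by rewrite expr2 ler_pM2l// ltW.
lra.
Qed.

Lemma null_bigcup (R : realType) (nu : probability (measurableTypeR R) R)
    (A : set (measurableTypeR R)) (F : nat -> set (measurableTypeR R)) :
  measurable A -> (forall n, measurable (F n)) -> (forall n, nu (F n) = 0%E) ->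
  A `<=` \bigcup_n F n -> nu A = 0%E.
Proof.
move=> mA mF F0 AF; apply/negligibleP => //.
apply: negligibleS AF _; apply: negligible_bigcup => n.
by apply/negligibleP; [exact: mF|exact: F0].
Qed.

Lemma null_oc (R : realType) (nu : probability (measurableTypeR R) R) (c d : R) :
  (forall c', c < c' -> c' <= d -> nu `[c', d]%classic = 0%E) ->
  nu `]c, d]%classic = 0%E.
Proof.
move=> H; apply: (@null_bigcup _ _ _ (fun n => `[c + n.+1%:R^-1, d]%classic)) => //.
  move=> n; have [h|h] := leP (c + n.+1%:R^-1) d.
    by apply: H; rewrite // ltrDl.
  by rewrite set_itv_ge ?measure0// bnd_simp -ltNge.
move=> x; rewrite /= in_itv /= => /andP[cx xd].
have [k kx] := ltr_add_invr cx.
by exists k => //=; rewrite in_itv /= xd (ltW kx).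
Qed.

Lemma null_oo (R : realType) (nu : probability (measurableTypeR R) R) (c d : R) :
  (forall c' d', c < c' -> c' <= d' -> d' < d -> nu `[c', d']%classic = 0%E) ->
  nu `]c, d[%classic = 0%E.
Proof.
move=> H; apply: (@null_bigcup _ _ _ (fun n => `]c, d - n.+1%:R^-1]%classic)) => //.
  by move=> n; apply: null_oc => c' cc' c'd; apply: H; rewrite // gtrBl.
move=> x; rewrite /= in_itv /= => /andP[cx xd].
have [k kx] := ltr_add_invr xd.
by exists k => //=; rewrite in_itv /= cx lerBrDr ltW.
Qed.

Lemma null_oy (R : realType) (nu : probability (measurableTypeR R) R) (c : R) :
  (forall c' d', c < c' -> c' <= d' -> nu `[c', d']%classic = 0%E) ->
  nu `]c, +oo[%classic = 0%E.
Proof.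
move=> H; apply: (@null_bigcup _ _ _ (fun n => `]c, n%:R]%classic)) => //.
  by move=> n; apply: null_oc => c' cc' c'd; apply: H.
move=> x; rewrite /= in_itv /= andbT => cx.
exists (Num.truncn `|x|).+1 => //=; rewrite in_itv /= cx /=.
by rewrite (le_trans (ler_norm x))// ltW// truncnS_gt.
Qed.

(** * Locating the mass of a factor *)

Lemma horizontal_continuous (R : realType) (f : R[i] -> R[i]) (x y : R) :
  analytic_at f (x +i* y) ->
  complex.Re (f (t +i* y)) @[t --> x] --> complex.Re (f (x +i* y)).
Proof.
move=> /analytic_jet2/jet2_continuous H; apply/cvgrPdist_lt => e e0.
have [d d0 Hd] := H e e0; near=> t.
have td : normc (t - x)%:C < d.
  rewrite normc_real distrC; near: t; apply: cvgr_dist_lt; [exact: cvg_id|exact: d0].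
have := Hd _ td; have -> : (x +i* y) + (t - x)%:C = t +i* y.
  by rewrite /real_complex_def; simpc; rewrite subrKC.
move=> h; apply: le_lt_trans h; rewrite distrC; apply: le_trans (normc_Re _).
by case: (f _) => ? ?; case: (f _).
Unshelve. all: by end_near. Qed.

(** On the horizontal line at a small height y, Re f passes through s. At that
point w = s + i eta one has eta = O(y) and Im psi_nu w = O(y), so [mass_near]
applies with h = eta / s^2. *)
Lemma sweep_small_mass (R : realType) (nu : probability (measurableTypeR R) R) (f : R[i] -> R[i])
    (x1 x2 C s k : R) :
  (forall z, upper_half z -> analytic_at f z /\ upper_half (f z)) ->
  regular_boundary f x1 x2 -> x1 <= x2 -> 0 <= C ->
  (forall x y, x1 <= x <= x2 -> 0 < y -> y <= 1 ->
     complex.Im (psi nu (f (x +i* y))) <= C * y) ->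
  0 < s ->
  (boundary_fun f x1 < s < boundary_fun f x2) ||
    (boundary_fun f x2 < s < boundary_fun f x1) ->
  0 < k ->
  exists h : R, [/\ 0 < h, h < k & fine (nu `[s^-1 - h, s^-1 + h]%classic) <= k * h].
Proof.
move=> Hf [y1 [L [m [[y10 L0 m0] [zm H zl]]]]] x12 C0 HC s0 sb k0.
have i1 : x1 <= x1 <= x2 by rewrite lexx.
have i2 : x1 <= x2 <= x2 by rewrite lexx andbT.
pose e := Num.min `|boundary_fun f x1 - s| `|boundary_fun f x2 - s|.
have e0 : 0 < e.
  rewrite lt_min !normr_gt0 !subr_eq0.
  by case/orP: sb => /andP[h1 h2];
    rewrite ?(lt_eqF h1) ?(gt_eqF h1) ?(lt_eqF h2) ?(gt_eqF h2).
pose y := Num.min (Num.min y1 1) (Num.min (Num.min (e / 2 / (L + 1)) (s / 2 / (L + 1)))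
   (Num.min (k * s ^+ 2 / 2 / (L + 1)) (k / (10 * s * (C + 1))))).
have L1 : 0 < L + 1 by rewrite ltr_wpDl.
have C1 : 0 < C + 1 by rewrite ltr_wpDl.
have sC : 0 < 10 * s * (C + 1) by rewrite !mulr_gt0.
have s2 : 0 < s ^+ 2 by rewrite exprn_gt0.
have ks2 : 0 < k * s ^+ 2 by rewrite mulr_gt0.
have y0 : 0 < y by rewrite !lt_min y10 ltr01 !divr_gt0.
have [yy1 [yo [ye [ys [yk yC]]]]] : y <= y1 /\ y <= 1 /\ y <= e / 2 / (L + 1)
   /\ y <= s / 2 / (L + 1) /\ y <= k * s ^+ 2 / 2 / (L + 1) /\ y <= k / (10 * s * (C + 1)).
  by rewrite /y !ge_min !lexx ?orbT.
move: ye ys yk yC; rewrite !(ler_pdivlMr _ _ L1) (ler_pdivlMr _ _ sC) => ye ys yk yC.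
have Ly : L * y < (L + 1) * y by rewrite ltr_pM2r// ltrDl.
have [e1 e2] : e <= `|boundary_fun f x1 - s| /\ e <= `|boundary_fun f x2 - s|.
  by rewrite /e !ge_min !lexx orbT.
pose g t := complex.Re (f (t +i* y)).
have gz x : x1 <= x <= x2 -> `|g x - boundary_fun f x| <= L * y.
  move=> xx; apply: le_trans (H _ _ xx y0 yy1); apply: le_trans (normc_Re _).
  by rewrite /g; case: (f _) => u v.
have gc : {within `[x1, x2], continuous g}.
  apply: continuous_in_subspaceT => x _.
  by apply: horizontal_continuous; have [] := Hf (x +i* y) y0.
have [|x xi gx] := IVT (v := s) x12 gc.
  have := gz _ i1; have := gz _ i2; rewrite !ler_norml ge_min le_max.
  move=> /andP[? ?] /andP[? ?]; case/orP: sb => /andP[? ?].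
  - rewrite ltr0_norm ?subr_lt0// in e1; rewrite gtr0_norm ?subr_gt0// in e2.
    apply/andP; split; apply/orP; [left|right]; lra.
  - rewrite gtr0_norm ?subr_gt0// in e1; rewrite ltr0_norm ?subr_lt0// in e2.
    apply/andP; split; apply/orP; [right|left]; lra.
have xx : x1 <= x <= x2 by move: xi; rewrite in_itv.
have [_ fu] := Hf (x +i* y) y0.
have fI : complex.Im (f (x +i* y)) <= L * y.
  have := le_trans (normc_Im _) (H _ _ xx y0 yy1); rewrite ler_norml => /andP[_].
  by case: (f _) => u v; rewrite /real_complex_def; simpc => /=; rewrite ?subr0.
have psiC := HC _ _ xx y0 yo.
move: gx fu fI psiC; rewrite /g; case: (f _) => u eta /= -> eta0 fI psiC.
have {}eta0 : 0 < eta by exact: eta0.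
pose h := eta / s ^+ 2; have h0 : 0 < h by rewrite divr_gt0.
have he : h * s ^+ 2 = eta by rewrite /h divfK// gt_eqF.
exists h; split=> //.
  by rewrite /h ltr_pdivrMr//; lra.
have hs : h * s <= 2^-1.
  by rewrite -(ler_pM2r s0) -mulrA -expr2 he; lra.
apply: (le_trans (mass_near nu s0 h0 hs)); rewrite he.
apply: (@le_trans _ _ (10 * (h * s) * (C * y))).
  by rewrite ler_wpM2l//; apply: mulr_ge0 => //; apply: ltW; exact: mulr_gt0.
have : h * (10 * s * (C * y)) <= h * k.
  rewrite ler_pM2l//; apply: le_trans yC.
  rewrite [leRHS](_ : _ = 10 * s * ((C + 1) * y)); last by ring.
  by rewrite ler_pM2l ?mulr_gt0// ler_pM2r// lerDl.
lra.
Qed.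

(** What is known of a subordination function f of the factor nu: on the interval
dom it has regular boundary values, and off the pole bt the imaginary part of
psi_nu (f z) vanishes at the axis. *)
Definition boundary_control (R : realType) (nu : probability (measurableTypeR R) R)
    (f : R[i] -> R[i]) (dom : R -> Prop) (bt : R) :=
  [/\ forall z, upper_half z -> analytic_at f z /\ upper_half (f z),
      forall x, dom x -> 0 < x,
      forall x1 x2, 0 < x1 -> x1 <= x2 -> dom x2 -> regular_boundary f x1 x2,
      forall x1 x2, 0 < x1 -> x1 <= x2 -> dom x2 -> x2 < bt \/ bt < x1 ->
        exists2 C : R, 0 <= C & forall x y, x1 <= x <= x2 -> 0 < y -> y <= 1 ->
          complex.Im (psi nu (f (x +i* y))) <= C * y &
      (forall x1 x2, 0 < x1 -> x1 <= x2 -> dom x2 -> dom x1) /\ dom bt].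

(** The pole bt is excluded from the interval swept: by continuity at bt,
a point close enough to bt still has its boundary value on the same side of s. *)
Lemma small_mass_in_range (R : realType) (nu : probability (measurableTypeR R) R)
    (f : R[i] -> R[i]) (dom : R -> Prop) (bt x s k : R) :
  boundary_control nu f dom bt -> dom x -> 0 < s ->
  (boundary_fun f x < s < boundary_fun f bt) || (boundary_fun f bt < s < boundary_fun f x) ->
  0 < k ->
  exists h : R, [/\ 0 < h, h < k & fine (nu `[s^-1 - h, s^-1 + h]%classic) <= k * h].
Proof.
move=> H; have [Hf dom0 F1 F2 [domS dbt]] := H; move=> dx s0 sb k0.
have bt0 := dom0 _ dbt; have x0 := dom0 _ dx.
have e0 : 0 < `|boundary_fun f bt - s|.
  rewrite normr_gt0 subr_eq0.
  by case/orP: sb => /andP[h1 h2]; rewrite ?(lt_eqF h1) ?(gt_eqF h1) ?(lt_eqF h2) ?(gt_eqF h2).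
have near_bt (L : R) (x' : R) : 0 <= L ->
    `|boundary_fun f x' - boundary_fun f bt| <= L * `|x' - bt| ->
    (L + 1) * `|x' - bt| <= `|boundary_fun f bt - s| / 2 ->
    (boundary_fun f bt < s -> boundary_fun f x' < s) /\
    (s < boundary_fun f bt -> s < boundary_fun f x').
  move=> L0 h1 h2.
  have h3 : `|boundary_fun f x' - boundary_fun f bt| <= `|boundary_fun f bt - s| / 2.
    apply: (le_trans h1); apply: le_trans h2; rewrite ler_wpM2r// lerDl//.
  split=> h; move: h3.
    by rewrite (ltr0_norm (_ : boundary_fun f bt - s < 0)) ?subr_lt0// ler_norml; lra.
  by rewrite (gtr0_norm (_ : 0 < boundary_fun f bt - s)) ?subr_gt0// ler_norml; lra.
have [xb|bx|xb] := ltgtP x bt.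
- have [y1 [L [m [[_ L0 _] [_ _ zl]]]]] := F1 _ _ x0 (ltW xb) dbt.
  have L1 : 0 < L + 1 by rewrite ltr_wpDl.
  pose d := Num.min ((bt - x) / 2) (`|boundary_fun f bt - s| / 2 / (L + 1)).
  have d0 : 0 < d by rewrite lt_min !divr_gt0// subr_gt0.
  have [d1 d2] : d <= (bt - x) / 2 /\ d <= `|boundary_fun f bt - s| / 2 / (L + 1).
    by rewrite /d !ge_min !lexx orbT.
  move: d2; rewrite (ler_pdivlMr _ _ L1) mulrC => d2.
  have i1 : x <= bt - d <= bt by apply/andP; split; lra.
  have i2 : x <= bt <= bt by rewrite lexx (ltW xb).
  have nd : `|bt - d - bt| = d.
    by rewrite addrAC subrr add0r normrN gtr0_norm.
  have [|n1 n2] := near_bt L (bt - d) L0 (zl _ _ i1 i2); first by rewrite nd.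
  have i3 : x <= bt - d by case/andP: i1.
  have d3 : dom (bt - d) by apply: (domS _ bt) => //; [lra|case/andP: i1].
  have [|C C0 HC] := F2 x (bt - d) x0 i3 d3; first by left; lra.
  apply: (sweep_small_mass Hf (F1 _ _ x0 i3 d3) i3 C0 HC s0) => //.
  by case/orP: sb => /andP[h1 h2]; [rewrite h1 (n2 h2)|rewrite (n1 h1) h2 orbT].
- have [y1 [L [m [[_ L0 _] [_ _ zl]]]]] := F1 _ _ bt0 (ltW bx) dx.
  have L1 : 0 < L + 1 by rewrite ltr_wpDl.
  pose d := Num.min ((x - bt) / 2) (`|boundary_fun f bt - s| / 2 / (L + 1)).
  have d0 : 0 < d by rewrite lt_min !divr_gt0// subr_gt0.
  have [d1 d2] : d <= (x - bt) / 2 /\ d <= `|boundary_fun f bt - s| / 2 / (L + 1).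
    by rewrite /d !ge_min !lexx orbT.
  move: d2; rewrite (ler_pdivlMr _ _ L1) mulrC => d2.
  have i1 : bt <= bt + d <= x by apply/andP; split; lra.
  have i2 : bt <= bt <= x by rewrite lexx (ltW bx).
  have nd : `|bt + d - bt| = d.
    by rewrite addrAC subrr add0r gtr0_norm.
  have [|n1 n2] := near_bt L (bt + d) L0 (zl _ _ i1 i2); first by rewrite nd.
  have i3 : bt + d <= x by case/andP: i1.
  have d3 : 0 < bt + d by rewrite addr_gt0.
  have [|C C0 HC] := F2 (bt + d) x d3 i3 dx; first by right; lra.
  apply: (sweep_small_mass Hf (F1 _ _ d3 i3 dx) i3 C0 HC s0) => //.
  by case/orP: sb => /andP[h1 h2]; [rewrite h1 (n2 h2) orbT|rewrite (n1 h1) h2].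
- by move: sb; rewrite xb orbb => /andP[h1 h2]; have := lt_trans h1 h2; rewrite ltxx.
Qed.

Lemma null_above_atom (R : realType) (nu : probability (measurableTypeR R) R)
    (f : R[i] -> R[i]) (dom : R -> Prop) (bt : R) :
  boundary_control nu f dom bt -> 0 < boundary_fun f bt ->
  (forall e, 0 < e -> exists2 x, dom x & boundary_fun f x < e) ->
  nu `](boundary_fun f bt)^-1, +oo[%classic = 0%E.
Proof.
move=> H; have [Hf dom0 F1 F2 [domS dbt]] := H; move=> zb inf; apply: null_oy => c' d' c1 cd.
have ub0 : 0 < (boundary_fun f bt)^-1 by rewrite invr_gt0.
apply: null_closed_interval => // t k /andP[ct td] k0.
have t0 : 0 < t by apply: lt_le_trans ct; exact: lt_trans c1.
have [x dx zx] := inf t^-1 (ltac:(by rewrite invr_gt0)).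
have := small_mass_in_range H dx (s := t^-1) (k := k).
rewrite invr_gt0 invrK => /(_ t0); rewrite zx /=; apply => //.
by rewrite invf_plt ?posrE// (lt_le_trans c1).
Qed.

Lemma null_below_atom (R : realType) (nu : probability (measurableTypeR R) R)
    (f : R[i] -> R[i]) (dom : R -> Prop) (bt : R) :
  boundary_control nu f dom bt -> 0 < boundary_fun f bt ->
  (forall M, exists2 x, dom x & M < boundary_fun f x) ->
  nu `]0, (boundary_fun f bt)^-1[%classic = 0%E.
Proof.
move=> H; have [Hf dom0 F1 F2 [domS dbt]] := H; move=> zb unb; apply: null_oo => c' d' c1 cd d1.
apply: null_closed_interval => // t k /andP[ct td] k0.
have t0 : 0 < t by exact: lt_le_trans ct.
have [x dx zx] := unb t^-1.
have := small_mass_in_range H dx (s := t^-1) (k := k).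
rewrite invr_gt0 invrK => /(_ t0); rewrite zx andbT; apply => //.
apply/orP; right; rewrite -[boundary_fun f bt]invrK ltf_pV2 ?posrE ?invr_gt0//.
exact: le_lt_trans d1.
Qed.

(** By [null_above_atom] and [null_below_atom], nu is carried by 0 and
u = 1 / boundary_fun f bt. If the mass 1 - q at 0 were positive, the boundary form of
[Kfun_two_atoms] at a point where boundary_fun f is large would equate a nonpositive
and a positive number. *)
Lemma dirac_of_unbounded (R : realType) (nu : probability (measurableTypeR R) R)
    (f K : R[i] -> R[i]) (kp : R -> R) (dom : R -> Prop) (bt : R) :
  boundary_control nu f dom bt ->
  Mplus nu ->
  (forall z, upper_half z -> Kfun nu (f z) = K z) ->
  (forall x, dom x -> 0 < kp x /\ boundary_value K x (kp x)) ->
  (forall M, exists2 x, dom x & M < boundary_fun f x) ->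
  (forall e, 0 < e -> exists2 x, dom x & boundary_fun f x < e) ->
  exists2 u : R, 0 < u & nu [set u] = 1%E.
Proof.
move=> H; have [Hf dom0 F1 F2 [domS dbt]] := H; move=> nuP HK Hkp unb inf.
have zpos x : dom x -> 0 < boundary_fun f x.
  move=> dx; have [y1 [L [m [[_ _ m0] [Hm _ _]]]]] := F1 _ _ (dom0 _ dx) (lexx x) dx.
  by apply: (lt_le_trans m0); apply: Hm; rewrite lexx.
have zb := zpos _ dbt.
pose u := (boundary_fun f bt)^-1; have u0 : 0 < u by rewrite invr_gt0.
exists u => //.
have na := null_above_atom H zb inf.
have nb := null_below_atom H zb unb.
rewrite -/u in na nb.
have nu01 : (nu [set 0%R] + nu [set u] = 1)%E.
  have [nuD _] := nuP.
  apply/eqP; rewrite eq_le; apply/andP; split.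
    rewrite -measureU//; first by apply: probability_le1; exact: measurableU.
    by apply/seteqP; split => // t [/= ->] E; move: u0; rewrite -E ltxx.
  rewrite -nuD.
  have h1 : (`[0%R, +oo[%classic : set R) `<=` ([set 0%R] `|` [set u]) `|`
     (`]0%R, u[%classic `|` `]u, +oo[%classic).
    move=> t; rewrite /= !in_itv /= !andbT => t0.
    have [tu|ut|->] := ltgtP t u; [|by right; right|by left; right].
    move: t0; rewrite le_eqVlt => /predU1P[<-|t0]; first by left; left.
    by right; left; rewrite t0.
  apply: (@le_trans _ _ (nu (([set 0%R] `|` [set u]) `|`
     (`]0%R, u[%classic `|` `]u, +oo[%classic)))).
    by apply: le_measure; rewrite ?inE//; do ?apply: measurableU.
  rewrite measureU0//; [exact: measureU2|exact: measurableU|exact: measurableU|].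
  rewrite measureU0//.
pose q := fine (nu [set u]).
have q1 : q <= 1.
  rewrite -lee_fin fineK ?fin_num_measure//; exact: probability_le1.
have n0 : nu [set 0%R] = (1 - q)%:E.
  rewrite EFinB fineK ?fin_num_measure// -nu01 addeK ?fin_num_measure//.
have q0 : 0 < q.
  by have [_] := nuP; rewrite n0 lte_fin; lra.
suff qq : q = 1 by rewrite -[LHS]fineK ?fin_num_measure// -/q qq.
apply/eqP; rewrite eq_le q1 /= leNgt; apply/negP => ql1.
have pu : 0 < (1 - q) * u by rewrite mulr_gt0// subr_gt0.
have [x dx zx] := unb ((1 - q) * u)^-1.
have [k0 bk] := Hkp _ dx.
have xx : x <= x <= x by rewrite lexx.
have bf := regular_boundary_value (F1 _ _ (dom0 _ dx) (lexx x) dx) xx.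
have b1 := boundary_valueM bk (boundary_valueD (boundary_value_cst 1 x)
   (boundary_valueM (boundary_value_cst (- ((1 - q) * u)) x) bf)).
have b2 := boundary_valueM (boundary_value_cst (q * u) x) bf.
have E := boundary_value_uniq (boundary_value_ext _ b1) b2.
have {E} : kp x * (1 + - ((1 - q) * u) * boundary_fun f x) = q * u * boundary_fun f x.
  apply: E => z z0; have [_ fu] := Hf z z0.
  rewrite -(Kfun_two_atoms nuP u0 nu01 fu) HK// rmorphN rmorph1 /=.
  by rewrite mulNr.
have z0 := zpos _ dx.
have h1 : 0 < q * u * boundary_fun f x by rewrite !mulr_gt0.
have h2 : 1 < (1 - q) * u * boundary_fun f x by rewrite mulrC -ltr_pdivrMr// mul1r.
have : kp x * (1 + - ((1 - q) * u) * boundary_fun f x) <= 0.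
  by rewrite pmulr_rle0// mulNr subr_le0 ltW.
lra.
Qed.

(** If the boundary values of f stay above e, those of g are at most x / e, so
nu has bounded support by [null_above_atom]. Then K_nu (w) = O(w), and
f = z K_nu (g) / g = O(z) contradicts the bound e. *)
Lemma boundary_fun_inf0 (R : realType) (nu : probability (measurableTypeR R) R)
    (f g K : R[i] -> R[i]) (kp : R -> R) (dom : R -> Prop) (bt : R) :
  boundary_control nu g dom bt ->
  (forall x1 x2, 0 < x1 -> x1 <= x2 -> dom x2 -> regular_boundary f x1 x2) ->
  (forall z, upper_half z -> Kfun nu (g z) = K z) ->
  (forall z, upper_half z -> f z * g z = z * K z) ->
  (forall x, dom x -> boundary_value K x (kp x)) ->
  (forall x, dom x -> x <= bt -> kp x <= 1) ->
  forall e, 0 < e -> exists2 x, dom x & boundary_fun f x < e.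
Proof.
move=> H; have [Hg dom0 G1 G2 [domS dbt]] := H; move=> F1 HK Hfg Hkp kp1 e e0.
apply: contrapT => nex.
have {}nex x : dom x -> e <= boundary_fun f x.
  by move=> dx; rewrite leNgt; apply/negP => h; apply: nex; exists x.
have xx (x : R) : x <= x <= x by rewrite lexx.
have bf x : dom x -> boundary_value f x (boundary_fun f x).
  by move=> dx; exact: regular_boundary_value (F1 _ _ (dom0 _ dx) (lexx x) dx) (xx x).
have bg x : dom x -> boundary_value g x (boundary_fun g x).
  by move=> dx; exact: regular_boundary_value (G1 _ _ (dom0 _ dx) (lexx x) dx) (xx x).
have gpos x : dom x -> 0 < boundary_fun g x.
  move=> dx; have [y1 [L [m [[_ _ m0] [Hm _ _]]]]] := G1 _ _ (dom0 _ dx) (lexx x) dx.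
  by apply: (lt_le_trans m0); apply: Hm; rewrite lexx.
have prod x : dom x -> boundary_fun f x * boundary_fun g x = x * kp x.
  move=> dx; apply: (boundary_value_uniq (boundary_valueM (bf _ dx) (bg _ dx))).
  apply: boundary_value_ext (boundary_valueM (boundary_value_id x) (Hkp _ dx)).
  by move=> z z0; rewrite Hfg.
have gle x : dom x -> x <= bt -> boundary_fun g x <= x / e.
  move=> dx xb; rewrite ler_pdivlMr// mulrC.
  apply: (@le_trans _ _ (boundary_fun f x * boundary_fun g x)).
    by rewrite ler_pM2r ?gpos// nex.
  by rewrite prod// ger_pMr ?(dom0 _ dx)// kp1.
have bt0 := dom0 _ dbt.
have small x : 0 < x -> x <= bt -> dom x by move=> x0 xb; exact: domS dbt.
have inf e' : 0 < e' -> exists2 x, dom x & boundary_fun g x < e'.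
  move=> e'0; pose x := Num.min bt (e * e' / 2).
  have x0 : 0 < x by rewrite lt_min bt0 !divr_gt0// mulr_gt0.
  have [xb xe] : x <= bt /\ x <= e * e' / 2 by rewrite /x !ge_min !lexx orbT.
  exists x; first exact: small.
  apply: (le_lt_trans (gle _ (small _ x0 xb) xb)); rewrite ltr_pdivrMr//.
  by have := mulr_gt0 e0 e'0; lra.
have na := null_above_atom H (gpos _ dbt) inf.
set B := (boundary_fun g bt)^-1 in na.
have B0 : 0 < B by rewrite invr_gt0 gpos.
pose x := Num.min bt (e / (16 * B)).
have B16 : 0 < 16 * B by rewrite mulr_gt0.
have x0 : 0 < x by rewrite lt_min bt0; exact: divr_gt0.
have [xb xe] : x <= bt /\ x <= e / (16 * B) by rewrite /x !ge_min !lexx orbT.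
rewrite (ler_pdivlMr _ _ B16) in xe.
have dx := small _ x0 xb.
have gx : boundary_fun g x * (16 * B) <= 1.
  apply: (@le_trans _ _ (x / e * (16 * B))).
    by rewrite ler_pM2r// gle.
  by rewrite mulrAC ler_pdivrMr// mul1r.
have [L [y1 y10 Hf]] := bf _ dx; have [L' [y2 y20 H']] := bg _ dx.
have L'1 : 0 < 16 * B * (`|L'| + 1) by rewrite mulr_gt0// ltr_wpDl.
have : boundary_fun f x <= 8 * B * x.
  apply: (@le_small _ _ _ (8 * B + L)
    (Num.min (Num.min y1 y2) (1 / (16 * B * (`|L'| + 1))))).
    by rewrite !lt_min y10 y20 divr_gt0.
  move=> y y0; rewrite !le_min => /andP[/andP[yy1 yy2]].
  rewrite (ler_pdivlMr _ _ L'1) => y3.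
  have z0 : upper_half (x +i* y) by exact: y0.
  have [_ gu] := Hg _ z0.
  have h1 : normc (g (x +i* y)) <= boundary_fun g x + `|L'| * y.
    rewrite -[g _](subrK (boundary_fun g x)%:C) addrC; apply: normc_leD.
      by rewrite normc_real gtr0_norm// gpos.
    apply: (le_trans (H' _ y0 yy2)); rewrite ler_pM2r//; exact: ler_norm.
  have h2 : normc (g (x +i* y)) * B <= 8^-1.
    apply: (@le_trans _ _ ((boundary_fun g x + `|L'| * y) * B)); first by rewrite ler_pM2r.
    have := mulr_gt0 y0 B0; lra.
  have := Kfun_bounded_support B0 na gu h2; rewrite HK// => h3.
  have ng : 0 < normc (g (x +i* y)).
    by rewrite normc_gt0; apply: contraTneq gu => ->; rewrite /upper_half /= ltxx.
  have h4 : normc (f (x +i* y)) <= 8 * B * normc (x +i* y).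
    rewrite -(ler_pM2r ng) -normcM Hfg// normcM mulrAC [leRHS]mulrC ler_wpM2l ?normc_ge0//.
  have h5 : normc (x +i* y) <= x + y.
    by rewrite (le_trans (normc_ReIm _))//= !gtr0_norm.
  have h6 : boundary_fun f x <= normc (f (x +i* y)) + L * y.
    have := le_normcB (boundary_fun f x)%:C (f (x +i* y)); rewrite normcB.
    have := Hf _ y0 yy1; rewrite normc_real.
    have := ler_norm (boundary_fun f x); lra.
  have : 8 * B * normc (x +i* y) <= 8 * B * (x + y) by rewrite ler_pM2l// mulr_gt0.
  lra.
have := nex _ dx; lra.
Qed.

(** Away from the pole 1/b the transform is real and smooth on the axis. *)
Lemma Im_psi_gap (R : realType) (mu : probability (measurableTypeR R) R) (a b x1 x2 : R) :
  gap_measure mu a b -> 0 < x1 -> x2 * a < 1 -> x2 < b^-1 \/ b^-1 < x1 ->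
  exists2 C : R, 0 <= C & forall x y, x1 <= x <= x2 -> 0 < y ->
    complex.Im (psi mu (x +i* y)) <= C * y.
Proof.
move=> gm x10 x2a hb; have [_ a0 ab _] := gm; have b0 := lt_trans a0 ab.
have [e e0 He] : exists2 e : R, 0 < e & forall x, x1 <= x <= x2 -> e <= (1 - x * b) ^+ 2.
  case: hb => hb.
    have h : 0 < 1 - x2 * b by rewrite subr_gt0 -ltr_pdivlMr// mul1r.
    exists ((1 - x2 * b) ^+ 2); first by rewrite exprn_gt0.
    move=> x /andP[_ xx2]; have : x * b <= x2 * b by rewrite ler_pM2r.
    by move=> h'; rewrite ler_pXn2r// ?nnegrE; lra.
  have h : 0 < x1 * b - 1 by rewrite subr_gt0 -ltr_pdivrMr// mul1r.
  exists ((x1 * b - 1) ^+ 2); first by rewrite exprn_gt0.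
  move=> x /andP[x1x _]; have : x1 * b <= x * b by rewrite ler_pM2r.
  by move=> h'; rewrite -[leRHS]sqrrN opprB ler_pXn2r// ?nnegrE; lra.
have d0 : 0 < 1 - x2 * a by rewrite subr_gt0.
have C1 : 0 <= a / (1 - x2 * a) ^+ 2 by rewrite divr_ge0 ?exprn_ge0// ltW.
exists (b / e + 2 * (a / (1 - x2 * a) ^+ 2)).
  by apply: addr_ge0; [exact/ltW/divr_gt0|exact: mulr_ge0].
move=> x y /[dup] xx /andP[x1x xx2] y0.
have x0 : 0 < x by exact: lt_le_trans x1x.
have xd : 1 - x2 * a <= 1 - x * a by rewrite lerB// ler_pM2r.
have xa : x * a < 1 by rewrite -subr_gt0 (lt_le_trans d0).
have := le_trans (normc_Im _) (psi_gap gm x0 xa (ltW y0)).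
have h1 : y * a / (1 - x * a) ^+ 2 <= a / (1 - x2 * a) ^+ 2 * y.
  rewrite (mulrC y) mulrAC ler_pM2r// ler_pM2l// lef_pV2 ?posrE ?exprn_gt0//.
    by rewrite ler_pXn2r ?nnegrE ?(ltW d0)// (le_trans (ltW d0)).
  exact: lt_le_trans xd.
have h2 : kernel_im x y b <= b / e * y.
  rewrite /kernel_im [leRHS](_ : _ = y * b * e^-1); last by ring.
  rewrite (ler_pM2l (mulr_gt0 y0 b0)).
  rewrite lef_pV2 ?posrE ?kernel_den_gt0//; apply: (le_trans (He _ xx)).
  by rewrite /kernel_den lerDl sqr_ge0.
have p0 : 0 <= kernel_im x y b by apply: kernel_im_ge0 => //; exact: ltW.
have m1 : fine (mu [set b]) <= 1.
  rewrite -lee_fin fineK ?fin_num_measure//; exact: probability_le1.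
have m0 : 0 <= fine (mu [set b]) by rewrite fine_ge0.
have h3 : fine (mu [set b]) * kernel_im x y b <= kernel_im x y b by rewrite ler_piMl.
rewrite ler_norml => /andP[_].
case: (psi mu _) => u v; rewrite /real_complex_def; simpc => /=.
rewrite ?mul0r ?addr0 ?add0r ?subr0; lra.
Qed.

(** * Indecomposability *)

(** The interval ]0, x0[, where x0 is the first zero of [cleared_psi] in ]0, 1/a[, or 1/a if
there is none; see [real_domainS]. *)
Definition real_domain (R : realType) (mu : probability (measurableTypeR R) R) (a b x : R) :=
  [/\ 0 < x, x * a < 1 & 0 < cleared_psi mu a b x].

Lemma real_domainS (R : realType) (mu : probability (measurableTypeR R) R) (a b x1 x2 : R) :
  gap_measure mu a b -> 0 < fine (mu [set b]) ->
  0 < x1 -> x1 <= x2 -> real_domain mu a b x2 -> real_domain mu a b x1.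
Proof.
move=> [_ a0 ab _] m0 x10 x12 [x20 x2a D2]; split=> //.
  by apply: le_lt_trans x2a; rewrite ler_pM2r.
have [d0 d00 dD] := cleared_psi_lower a0 (lt_trans a0 ab) m0 x10 x2a D2.
by apply: (lt_le_trans d00); apply: dD; rewrite lexx.
Qed.

Lemma subordination_regular (R : realType) (mu : probability (measurableTypeR R) R)
    (a b x1 x2 : R) (f g : R[i] -> R[i]) :
  gap_measure mu a b -> Mplus mu -> 0 < fine (mu [set b]) ->
  (forall z, upper_half z -> analytic_at f z /\ upper_half (f z)) ->
  (forall z, upper_half z -> upper_half (g z)) ->
  (forall z, upper_half z -> f z * g z = z * Kfun mu z) ->
  0 < x1 -> x1 <= x2 -> real_domain mu a b x2 -> regular_boundary f x1 x2.
Proof.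
move=> gm muP m0 Hf Hg Hfg x10 x12 [x20 x2a D2]; have [_ a0 ab _] := gm.
have [d0 d00 dD] := cleared_psi_lower a0 (lt_trans a0 ab) m0 x10 x2a D2.
have [y0 y00 [C C0 HK]] := K_boundary gm muP x10 x2a d00 dD.
have [k0 k00 [k1 Hk]] := real_K_bounds gm m0 x10 x2a D2.
have HZ z : upper_half z ->
    [/\ upper_half (f z), upper_half (g z), 0 < complex.Im (Kfun mu z) & f z * g z = z * Kfun mu z].
  move=> z0; split; [by case: (Hf z z0)|exact: Hg|exact: Im_K_gt0|exact: Hfg].
have [y1 y10 [L L0 HL]] := Im_le_near_real HZ x10 k00 y00 C0 Hk HK.
have [M M0 HM] := schwarz_pick_lipschitz Hf x12 y10 L0
  (fun x y xx yp yy => proj2 (HL x y xx yp yy)).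
apply: (regular_boundaryP y10 L0 M0 _ HM) => x y xx yp yy.
have [h1 h2] := HL x y xx yp yy; split=> //.
have zu : upper_half (x +i* y) by exact: yp.
by have [_ fu] := Hf _ zu; rewrite gtr0_norm.
Qed.

(** The product of the boundary values of Z1 and Z2 is x K x, which is unbounded;
so one of the two is unbounded and [dirac_of_unbounded] applies to it. *)
Lemma factor_dirac (R : realType) (mu mu1 mu2 : probability (measurableTypeR R) R)
    (a b : R) (Z1 Z2 : R[i] -> R[i]) :
  gap_measure mu a b -> Mplus mu -> Mplus mu1 -> Mplus mu2 -> 0 < fine (mu [set b]) ->
  (exists2 l : \bar R,
       (complex.Re (psi mu x%:C))%:E @[x --> (a^-1 : R)^'-] --> l &
       (-1%:E <= l)%E) ->
  (forall z, upper_half z -> analytic_at Z1 z /\ upper_half (Z1 z)) ->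
  (forall z, upper_half z -> analytic_at Z2 z /\ upper_half (Z2 z)) ->
  (forall z, upper_half z ->
     [/\ Z1 z * Z2 z = z * Kfun mu z, Kfun mu1 (Z1 z) = Kfun mu z &
         Kfun mu2 (Z2 z) = Kfun mu z]) ->
  exists2 u : R, 0 < u & mu1 [set u] = 1%E \/ mu2 [set u] = 1%E.
Proof.
move=> gm muP mu1P mu2P m0 hpsi H1 H2 HZ; have [_ a0 ab _] := gm.
have b0 := lt_trans a0 ab.
have F1 x1 x2 : 0 < x1 -> x1 <= x2 -> real_domain mu a b x2 -> regular_boundary Z1 x1 x2.
  apply: (subordination_regular gm muP m0 H1 (g := Z2)).
    by move=> z /H2[].
  by move=> z /HZ[].
have G1 x1 x2 : 0 < x1 -> x1 <= x2 -> real_domain mu a b x2 -> regular_boundary Z2 x1 x2.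
  apply: (subordination_regular gm muP m0 H2 (g := Z1)).
    by move=> z /H1[].
  by move=> z /HZ[h _ _]; rewrite mulrC.
have psiC (nu : probability (measurableTypeR R) R) f x1 x2 :
    (forall z, upper_half z -> psi nu (f z) = psi mu z) ->
    0 < x1 -> x1 <= x2 -> real_domain mu a b x2 -> x2 < b^-1 \/ b^-1 < x1 ->
    exists2 C : R, 0 <= C & forall x y, x1 <= x <= x2 -> 0 < y -> y <= 1 ->
     complex.Im (psi nu (f (x +i* y))) <= C * y.
  move=> Hpsi x10 x12 [_ x2a _] hb; have [C C0 HC] := Im_psi_gap gm x10 x2a hb.
  exists C => // x y xx y0 _; rewrite Hpsi; [exact: HC|exact: y0].
have psi1 z : upper_half z -> psi mu1 (Z1 z) = psi mu z.
  move=> z0; have [_ h _] := HZ z z0; have [_ Z10] := H1 z z0.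
  by apply: mobius_inj; [exact: Im_psi_gt0|exact: Im_psi_gt0|exact: h].
have psi2 z : upper_half z -> psi mu2 (Z2 z) = psi mu z.
  move=> z0; have [_ _ h] := HZ z z0; have [_ Z20] := H2 z z0.
  by apply: mobius_inj; [exact: Im_psi_gt0|exact: Im_psi_gt0|exact: h].
have F2 x1 x2 := psiC mu1 Z1 x1 x2 psi1.
have G2 x1 x2 := psiC mu2 Z2 x1 x2 psi2.
have dom0 x : real_domain mu a b x -> 0 < x by case.
have dS x1 x2 := @real_domainS R mu a b x1 x2 gm m0.
have dbt : real_domain mu a b b^-1.
  split; rewrite ?invr_gt0//; first by rewrite mulrC ltr_pdivrMr// mul1r.
  by rewrite /cleared_psi mulfV ?gt_eqF// subrr mul0r addr0.
have BC1 : boundary_control mu1 Z1 (real_domain mu a b) b^-1 by split.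
have BC2 : boundary_control mu2 Z2 (real_domain mu a b) b^-1 by split.
have Hkp x : real_domain mu a b x ->
    0 < real_K mu a b x /\ boundary_value (Kfun mu) x (real_K mu a b x).
  move=> [x0 xa Dx]; have xx : x <= x <= x by rewrite lexx.
  have [k0 k00 [k1 Hk]] := real_K_bounds gm m0 x0 xa Dx.
  split; first by have /andP[h _] := Hk _ xx; exact: lt_le_trans h.
  have [d0 d00 dD] := cleared_psi_lower a0 b0 m0 x0 xa Dx.
  have [y0 y00 [C C0 HK]] := K_boundary gm muP x0 xa d00 dD.
  by exists C, y0 => // y yp yy; exact: HK.
have kp1 x : real_domain mu a b x -> x <= b^-1 -> real_K mu a b x <= 1.
  move=> [_ _ Dx] xb; apply: real_K_le1 => //.
  by rewrite mulrC -ler_pdivlMr// mul1r.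
have HK1 z : upper_half z -> Kfun mu1 (Z1 z) = Kfun mu z by move=> /HZ[].
have HK2 z : upper_half z -> Kfun mu2 (Z2 z) = Kfun mu z by move=> /HZ[].
have prod12 z : upper_half z -> Z1 z * Z2 z = z * Kfun mu z by move=> /HZ[].
have inf1 := boundary_fun_inf0 BC2 F1 HK2 prod12
   (fun x dx => proj2 (Hkp x dx)) kp1.
have prod21 z : upper_half z -> Z2 z * Z1 z = z * Kfun mu z.
  by move=> /HZ[h _ _]; rewrite mulrC.
have inf2 := boundary_fun_inf0 BC1 G1 HK1 prod21
   (fun x dx => proj2 (Hkp x dx)) kp1.
have xx (x : R) : x <= x <= x by rewrite lexx.
have zprod x : real_domain mu a b x -> boundary_fun Z1 x * boundary_fun Z2 x = x * real_K mu a b x.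
  move=> dx.
  have b1 := regular_boundary_value (F1 _ _ (dom0 _ dx) (lexx x) dx) (xx x).
  have b2 := regular_boundary_value (G1 _ _ (dom0 _ dx) (lexx x) dx) (xx x).
  apply: (boundary_value_uniq (boundary_valueM b1 b2)).
  apply: boundary_value_ext (boundary_valueM (boundary_value_id x) (proj2 (Hkp _ dx))).
  by move=> z /HZ[].
have pos f x : regular_boundary f x x -> 0 < boundary_fun f x.
  move=> [y1 [L [m [[_ _ m00] [H _ _]]]]].
  by apply: (lt_le_trans m00); apply: H; rewrite lexx.
have [unb|] := pselect (forall M, exists2 x, real_domain mu a b x & M < boundary_fun Z1 x).
  have [u u0 hu] := dirac_of_unbounded BC1 mu1P HK1 Hkp unb inf1.
  by exists u => //; left.
move=> /existsNP[M1 nM1].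
have [unb|] := pselect (forall M, exists2 x, real_domain mu a b x & M < boundary_fun Z2 x).
  have [u u0 hu] := dirac_of_unbounded BC2 mu2P HK2 Hkp unb inf2.
  by exists u => //; right.
move=> /existsNP[M2 nM2].
have [x [bx xa Dx]] := real_K_unbounded (M1 * M2) gm m0 hpsi.
have x0 : 0 < x by rewrite -(@pmulr_rgt0 _ b)// (lt_trans ltr01).
have dx : real_domain mu a b x by split.
rewrite -zprod// ltNge => /negP[].
have h1 : boundary_fun Z1 x <= M1 by rewrite leNgt; apply/negP => h; apply: nM1; exists x.
have h2 : boundary_fun Z2 x <= M2 by rewrite leNgt; apply/negP => h; apply: nM2; exists x.
by apply: ler_pM => //; apply/ltW/pos; [exact: F1|exact: G1].
Qed.

Lemma DiracE (R : realType) (u : R) (A : set (measurableTypeR R)) :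
  Dirac u A = ((u \in A)%:R : R)%:E.
Proof. exact: diracE. Qed.

Lemma atom1_eq_dirac (R : realType) (nu : probability (measurableTypeR R) R) (u : R) :
  nu [set u] = 1%E -> Defs.eq_measure nu (Dirac u).
Proof.
move=> nu1 A mA; rewrite DiracE; case: (boolP (u \in A)) => [|] uA.
  have h : (nu [set u] <= nu A)%E.
    by apply: le_measure; rewrite ?inE//; move: uA; rewrite inE => uA _ ->.
  by apply/eqP; rewrite eq_le probability_le1//= -nu1.
apply/eqP; rewrite eq_le measure_ge0 andbT.
apply: (@le_trans _ _ (nu (~` [set u]))); last first.
  by rewrite probability_setC// nu1 subee.
apply: le_measure; rewrite ?inE//; first exact: measurableC.
by move=> x Ax xu; move/negP: uA; apply; rewrite inE -xu.
Qed.

Lemma Kfun_atom1 (R : realType) (nu : probability (measurableTypeR R) R) (u : R) (w : R[i]) :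
  Mplus nu -> 0 < u -> nu [set u] = 1%E -> upper_half w -> Kfun nu w = u%:C * w.
Proof.
move=> nuP u0 nu1 w0.
have n0 : nu [set 0%R] = 0%E.
  by rewrite (atom1_eq_dirac nu1)// DiracE memNset//= => E; move: u0; rewrite E ltxx.
have := @Kfun_two_atoms _ nu u w nuP u0; rewrite n0 nu1 add0e /= => /(_ erefl w0).
by rewrite subrr mul0r mul1r mul0r subr0 mulr1.
Qed.

Lemma analytic_at_scale (R : realType) (f : R[i] -> R[i]) (c k : R) (z : R[i]) :
  0 < c -> analytic_at f (c%:C * z) -> analytic_at (fun w => k%:C * f (c%:C * w)) z.
Proof.
move=> c0 [d /nearP_normc[e e0 H]].
exists (fun n => k%:C * (d n * c%:C ^+ n)); apply/nearP_normc.
exists (e / c) => [|v ve]; first by rewrite divr_gt0.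
have {}ve : normc (c%:C * v) < e.
  by rewrite normcM normc_real gtr0_norm// mulrC -ltr_pdivlMr.
have := H _ ve; rewrite -mulrDr => h.
have -> : [series k%:C * (d n * c%:C ^+ n) * (z + v - z) ^+ n]_n =
    (fun m => k%:C * [series d n * (c%:C * (z + v) - c%:C * z) ^+ n]_n m).
  apply/funext => m; rewrite /series /= big_distrr /=; apply: eq_bigr => i _.
  by rewrite -mulrBr exprMn !mulrA.
exact: cvgMr.
Qed.

Lemma classK_scale (R : realType) (f : R[i] -> R[i]) (c k : R) :
  0 < c -> 0 < k -> classK f -> classK (fun w => k%:C * f (c%:C * w)).
Proof.
move=> c0 k0 [f1 f2 f3]; split.
- move=> z z0; have cz0 : upper_half (c%:C * z).
    move: z0; case: (z) => x y y0; have {}y0 : 0 < y by exact: y0.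
    by rewrite /upper_half /= mul0r addr0 mulr_gt0.
  have [fa f0] := f1 _ cz0; split; first exact: analytic_at_scale.
  by move: f0; case: (f _) => u v /= v0; rewrite ?mul0r ?addr0 mulr_ge0// ltW.
- move=> x x0; have cx0 : c * x < 0 by rewrite pmulr_rlt0.
  have E : c%:C * x%:C = (c * x)%:C by rewrite rmorphM.
  have [fa f0] := f2 _ cx0; split; first by apply: analytic_at_scale; rewrite // E.
  rewrite E; apply: mulr_ge0_le0 => //; by rewrite lecR ltW.
- apply/cvgrPdist_lt => e e0; move/cvgrPdist_lt: f3.
  have ke0 : 0 < e / k%:C by rewrite divr_gt0// ltcR.
  move=> /(_ _ ke0); rewrite !near_withinE => /nbhs_ballP[d /= d0 H].
  apply/nbhs_ballP; exists (d / c); first by rewrite /= divr_gt0.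
  move=> x; rewrite -ball_normE /= sub0r normrN => xd x0.
  have cx0 : 0 < c * x by rewrite mulr_gt0.
  have := H (c * x); rewrite -ball_normE /= sub0r normrN.
  rewrite gtr0_norm// mulrC -ltr_pdivlMr// -(gtr0_norm x0) => /(_ xd).
  rewrite (gtr0_norm x0) mulr_gt0// => /(_ isT).
  rewrite !sub0r !normrN normrM => h.
  have -> : c%:C * (- x)%:C = (- (x * c))%:C by rewrite -rmorphM mulrN mulrC.
  have kk : `|k%:C| = k%:C by rewrite ger0_norm// lecR ltW.
  by rewrite kk mulrC -ltr_pdivlMr// ltcR.
Qed.

Lemma classK_id (R : realType) : classK (@id R[i]).
Proof.
have an (z : R[i]) : analytic_at id z.
  exists (fun n => if n == 0%N then z else if n == 1%N then 1 else 0).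
  apply/nearP_normc; exists 1 => // v _; rewrite addrAC subrr add0r.
  apply: cvg_near_cst; exists 2%N => // n /= n2.
  rewrite /series /= -(subnKC n2) big_mkord big_split_ord /=.
  rewrite [X in _ + X]big1 ?addr0; last by move=> i _; rewrite mul0r.
  by rewrite !big_ord_recl big_ord0 /=; ring.
split.
- by move=> z z0; split => //; exact: ltW.
- by move=> x x0; split => //; rewrite lecR ltW.
- apply/cvgrPdist_lt => e e0.
  have [e1 e2] : complex.Im e = 0 /\ 0 < complex.Re e.
    by move: e0; rewrite ltcE /= => /andP[/eqP ? ?].
  have eE : e = (complex.Re e)%:C by case: (e) e1 => ? ? /= ->.
  near=> x; rewrite sub0r normrN normcE normc_real normrN eE ltcR.
  rewrite gtr0_norm; last by near: x; exact: nbhs_right_gt.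
  by near: x; exact: nbhs_right_lt.
Unshelve. all: by end_near. Qed.

Lemma Dirac_Mplus (R : realType) (c : R) : 0 < c -> Mplus (Dirac c).
Proof.
move=> c0; split.
  by rewrite DiracE mem_set// /= in_itv /= ltW.
by rewrite DiracE memNset/= ?lte01// => E; move: c0; rewrite E ltxx.
Qed.

(** When mu2 is the Dirac measure at u, the defining equations give Z1 z = u z
and K_mu z = u Z2 z. The subordination functions for mu and the Dirac measure
at 1/u are then z / u and u^2 Z2 (z / u). *)
Lemma dirac_cofactor_improper (R : realType)
    (mu mu1 mu2 : probability (measurableTypeR R) R) (u : R) (Z1 Z2 : R[i] -> R[i]) :
  Mplus mu -> Mplus mu1 -> Mplus mu2 -> 0 < u -> mu2 [set u] = 1%E ->
  classK Z2 ->
  (forall z, upper_half z -> upper_half (Z2 z)) ->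
  (forall z, upper_half z ->
     [/\ Z1 z * Z2 z = z * Kfun mu z, Kfun mu1 (Z1 z) = Kfun mu z &
         Kfun mu2 (Z2 z) = Kfun mu z]) ->
  free_mconv mu (Dirac u^-1) mu1.
Proof.
move=> muP mu1P mu2P u0 mu2u Z2K Z2u HZ.
have ui0 : 0 < u^-1 by rewrite invr_gt0.
have un0 : u%:C != 0 by rewrite -normc_gt0 normc_real gtr0_norm.
have uiE : (u^-1)%:C = u%:C^-1 by rewrite fmorphV.
have KZ2 z : upper_half z -> Kfun mu z = u%:C * Z2 z.
  move=> z0; have [_ _ <-] := HZ z z0; exact: (Kfun_atom1 mu2P u0 mu2u (Z2u z z0)).
have Z1E z : upper_half z -> Z1 z = u%:C * z.
  move=> z0; have [E _ _] := HZ z z0.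
  have Z20 : Z2 z != 0.
    by apply/eqP => E0; have := Z2u z z0; rewrite E0 /upper_half /= ltxx.
  by apply: (mulIf Z20); rewrite E KZ2//; ring.
have K1 z : upper_half z -> Kfun mu1 (u%:C * z) = Kfun mu z.
  by move=> z0; rewrite -Z1E//; case: (HZ z z0).
have scale_up (c : R) (z : R[i]) : 0 < c -> upper_half z -> upper_half (c%:C * z).
  case: z => x y c0 y0; have {}y0 : 0 < y by exact: y0.
  by rewrite /upper_half /= mul0r addr0 mulr_gt0.
pose W1 z : R[i] := 1%:C * id ((u^-1)%:C * z).
pose W2 z := (u ^+ 2)%:C * Z2 ((u^-1)%:C * z).
have W1u z : upper_half z -> upper_half (W1 z).
  by move=> z0; exact: (scale_up 1 _ ltr01 (scale_up _ _ ui0 z0)).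
have W2u z : upper_half z -> upper_half (W2 z).
  move=> z0; have u2 : 0 < u ^+ 2 by rewrite exprn_gt0.
  exact: (scale_up _ _ u2 (Z2u _ (scale_up _ _ ui0 z0))).
have i0 : upper_half ('i : R[i]) by rewrite /upper_half /=.
have up0 (w : R[i]) : upper_half w -> w != 0.
  by move=> w0; apply/eqP => E; move: w0; rewrite E /upper_half /= ltxx.
have DP := Dirac_Mplus ui0.
have Du : Dirac u^-1 [set u^-1] = 1%E by rewrite DiracE mem_set.
split => //; exists W1, W2; split.
- split; first by apply: classK_scale => //; exact: classK_id.
  by exists 'i => //; apply: up0; exact: W1u.
- split; first by apply: classK_scale => //; rewrite exprn_gt0.
  by exists 'i => //; apply: up0; exact: W2u.
- move=> z z0; have z'0 := W1u z z0.
  have W1E : W1 z = (u^-1)%:C * z by rewrite /W1 mul1r.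
  have KW : Kfun mu (W1 z) = u%:C * Z2 ((u^-1)%:C * z) by rewrite KZ2// W1E.
  split.
  + by rewrite KW W1E /W2 rmorphXn /= uiE; field.
  + rewrite KW (Kfun_atom1 DP ui0 Du (W2u z z0)) /W2 rmorphXn /= uiE.
    by field.
  + by rewrite -(K1 _ z'0) W1E uiE mulrA mulfV// mul1r.
Qed.

Theorem theorem8p2 (R : realType) (mu : probability (measurableTypeR R) R)
    (a b : R) (hmu : Mplus mu) (ha : 0 < a) (hab : a < b)
    (hmua : (0 < mu `]0%R, a]%classic)%E)
    (hmub : (0 < mu [set b])%E)
    (hmuab : (mu `[0%R, a]%classic + mu [set b])%E = 1%E)
    (hpsi : exists2 l : \bar R,
       (complex.Re (psi mu x%:C))%:E @[x --> (a^-1 : R)^'-] --> l &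
       (-1%:E <= l)%E) :
  indecomposable mu.
Proof.
split.
  move=> c E; move: hmub; rewrite E// DiracE lte_fin ltr0n lt0b inE => bc.
  move: hmua; rewrite E// DiracE lte_fin ltr0n lt0b inE /= in_itv /= => /andP[_].
  by rewrite bc leNgt hab.
move=> mu1 [mu1P [mu2 mu2P [_ _ _ [Z1 [Z2 [[Z1K _] [Z2K _] HZ]]]]]].
have gm : gap_measure mu a b by split => //; case: hmu.
have m0 : 0 < fine (mu [set b]).
  by rewrite -lte_fin fineK ?fin_num_measure.
have HZ' z : upper_half z -> [/\ Z1 z * Z2 z = z * Kfun mu z,
    Kfun mu1 (Z1 z) = Kfun mu z & Kfun mu2 (Z2 z) = Kfun mu z].
  by move=> /HZ[h1 h2 h3]; split; rewrite ?h1 -?h2 h3.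
have up nu f z : Mplus nu -> classK f -> Kfun nu (f z) = Kfun mu z -> upper_half z ->
    analytic_at f z /\ upper_half (f z).
  move=> nuP [fK _ _] E z0; have [fa f0] := fK z z0; split=> //.
  rewrite /upper_half /= lt_neqAle f0 andbT; apply/eqP => f00.
  by have := Im_K_gt0 hmu z0; rewrite -E Im_K_real ?ltxx.
have H1 z : upper_half z -> analytic_at Z1 z /\ upper_half (Z1 z).
  by move=> z0; have [_ h _] := HZ' z z0; exact: (up mu1).
have H2 z : upper_half z -> analytic_at Z2 z /\ upper_half (Z2 z).
  by move=> z0; have [_ _ h] := HZ' z z0; exact: (up mu2).
have [u u0 [hu|hu]] := factor_dirac gm hmu mu1P mu2P m0 hpsi H1 H2 HZ'.
  by exists u => //; left; exact: atom1_eq_dirac.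
exists u^-1; first by rewrite invr_gt0.
by right; apply: dirac_cofactor_improper hu _ _ HZ' => // z /H2[].
Qed.
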